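(* Let $f\in H^r_p([-\pi,\pi]^d)$ for a given integer $r\ge1$ be such that there exists a truncation radius $R=R(r,N)$ providing the estimate $$\|\langle Q^R(f,f),\Phi\rangle\|_2\le\tilde C\,\delta\qquad\text{with}\quad \delta=\delta' N^{-r}.$$ Then there exists a constant $C=C(\|f\|_{H^r_p},R)$ such that $$\|Q^R(f,f)-Q_N^{R,c}(f_N^c,f_N^c)\|_{L^2}\le\frac{C}{N^r}\left(\|f\|_{H^r_p}+\|Q^R(f_N^c,f_N^c)\|_{H^r_p}+\delta'\right),$$ where $f_N^c=\mathcal P_N^c f$.
   Context: $d\le 3$ is the velocity dimension, $N\ge1$ is an integer, $\delta'>0$ and $\tilde C>0$ are constants. Functions on $[-\pi,\pi]^d$ are real-valued and extended periodically to $\mathbb R^d$; $\langle f,g\rangle=\int_{[-\pi,\pi]^d}fg\,dv$, $\|f\|_{L^2_p}^2=\langle f,f\rangle$, and $H^r_p$ is the subspace of periodic functions in the Sobolev space $H^r([-\pi,\pi]^d)$. $\Phi(v)=(1,v_1,\dots,v_d,|v|^2)^T\in\mathbb R^{d+2}$, $\langle f,\Phi\rangle=\int_{[-\pi,\pi]^d} f\,\Phi\,dv\in\mathbb R^{d+2}$ componentwise, and $\|\cdot\|_2$ is the Euclidean norm. Truncated periodized Boltzmann operator: with $\mathcal B_0(2R)$ the ball of radius $2R$ centred at $0$, $$Q^R(f,f)(v)=\int_{\mathcal B_0(2R)\times\mathbb S^{d-1}}B(|q|,\cos\theta)\,\bigl(f(v_*')f(v')-f(v_* )f(v)\bigr)\,dq\,d\sigma,$$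 where $q=v-v_*$ is the relative velocity, $\cos\theta=\frac{q}{|q|}\cdot\sigma$, $v'=\frac{v+v_*}{2}+\frac{|v-v_*|}{2}\sigma$, $v_*'=\frac{v+v_*}{2}-\frac{|v-v_*|}{2}\sigma$. The collision kernel $B\ge0$ has the form $B(|q|,\cos\theta)=|q|\,\sigma(|q|,\cos\theta)$, where $\sigma(\cdot,\cdot)$ denotes the scattering cross-section, and is bounded on the truncated domain. The velocity variable is scaled so that the periodicity box is $[-\pi,\pi]^d$; $R$ is the truncation radius (in the normalized setting $R=\lambda\pi$ with $\lambda=2/(3+\sqrt2)$). $\mathbb P^N=\mathrm{span}\{e^{ik\cdot v}:k\in\mathbb Z^d,\ -N\le k_j\le N,\ j=1,\dots,d\}$. Conservative projection: $$\mathcal P_N^c f=\operatorname{argmin}\{\|g_N-f\|_{L^2_p}^2: g_N\in\mathbb P^N,\ \langle g_N,\Phi\rangle=\langle f,\Phi\rangle\}.$$ Moment-constrained collision operator: $$Q_N^{R,c}(f,f)=\operatorname{argmin}\{\|g_N-Q^R(f,f)\|_{L^2_p}^2: g_N\in\mathbb P^N,\ \langle g_N,\Phi\rangle=0\}.$$ The constant $C$ may also depend on the fixed data $d$, $r$, $B$ and $\tilde C$. *)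

(* Defs.v *)
From HB Require Import structures.
From mathcomp Require Import all_boot all_order all_algebra.
From mathcomp Require Import all_classical all_reals all_analysis.
From mathcomp Require Import measurable_realfun complex.
Set Implicit Arguments.
Unset Strict Implicit.
Unset Printing Implicit Defensive.
Import Order.TTheory GRing.Theory Num.Theory.
Import numFieldNormedType.Exports.
Local Open Scope classical_set_scope.
Local Open Scope ring_scope.

(* The sigma-algebra generated by the coordinates, i.e., the Borel sets of R^n. *)
Section measurable_rV.
Context (R : realType) (n : nat).

Let coords (i : 'I_n) (v : 'rV[R]_n) : R := v ord0 i.

Let rV_set0 : g_sigma_preimage coords set0.
Proof. exact: sigma_algebra0. Qed.

Let rV_setC A : g_sigma_preimage coords A -> g_sigma_preimage coords (~` A).
Proof. exact: sigma_algebraC. Qed.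

Let rV_bigcup (F : (set 'rV[R]_n)^nat) :
  (forall i, g_sigma_preimage coords (F i)) ->
  g_sigma_preimage coords (\bigcup_i (F i)).
Proof. exact: sigma_algebra_bigcup. Qed.

HB.instance Definition _ := @isMeasurable.Build default_measure_display
  'rV[R]_n (g_sigma_preimage coords) rV_set0 rV_setC rV_bigcup.

Lemma measurable_coord (i : 'I_n) :
  measurable_fun [set: 'rV[R]_n] (fun v : 'rV[R]_n => v ord0 i).
Proof.
move=> _ Y mY; rewrite setTI; apply: sub_sigma_algebra => /=.
rewrite -bigcup_seq/=; exists i => /=; first by rewrite mem_index_enum.
by exists Y => //; rewrite setTI.
Qed.

Lemma measurable_fun_rVP d (T : measurableType d) (f : T -> 'rV[R]_n) :
  (forall i, measurable_fun [set: T] (fun x => f x ord0 i)) ->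
  measurable_fun [set: T] f.
Proof.
move=> mf _ A mA; rewrite setTI.
have : g_sigma_preimage (fun i x => f x ord0 i) (f @^-1` A).
  rewrite (g_sigma_preimage_comp coords f).
  by exists A => //; rewrite setTI.
apply: smallest_sub; first exact: sigma_algebra_measurable.
rewrite -bigcup_seq => B [i _ [C mC <-]].
exact: mf.
Qed.

End measurable_rV.

Section lebesgue_step.
Context (R : realType) (n : nat).
Variable m : {sigma_finite_measure set 'rV[R]_n -> \bar R}.

Definition rVcons (p : R * 'rV[R]_n) : 'rV[R]_n.+1 := row_mx p.1%:M p.2.

Definition rVuncons (v : 'rV[R]_n.+1) : R * 'rV[R]_n :=
  (v ord0 ord0, \row_j v ord0 (rshift 1 j)).

Lemma rVconsEl p (j : 'I_1) : rVcons p ord0 (lshift n j) = p.1.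
Proof. by rewrite [LHS]row_mxEl mxE (ord1 j) eqxx mulr1n. Qed.

Lemma rVconsEr p (j : 'I_n) : rVcons p ord0 (rshift 1 j) = p.2 ord0 j.
Proof. by rewrite [LHS]row_mxEr. Qed.

Lemma rVconsE0 p : rVcons p ord0 ord0 = p.1.
Proof. by rewrite -(rVconsEl p ord0); congr (rVcons p _ _); exact/val_inj. Qed.

Lemma rVconsK : cancel rVcons rVuncons.
Proof.
move=> [x v]; congr pair; first exact: rVconsE0.
by apply/rowP => j; rewrite mxE rVconsEr.
Qed.

Lemma measurable_rVcons : measurable_fun setT rVcons.
Proof.
apply: measurable_fun_rVP => i.
have [j ->|j ->] := split_ordP (i : 'I_(1 + n)%N).
  rewrite (_ : (fun _ => _) = fst); first exact: measurable_fst.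
  by apply/funext => p; rewrite rVconsEl.
rewrite (_ : (fun _ => _) = (fun v : 'rV[R]_n => v ord0 j) \o snd); last first.
  by apply/funext => p; rewrite rVconsEr.
apply: measurableT_comp; first exact: measurable_coord.
exact: measurable_snd.
Qed.

Lemma measurable_rVuncons : measurable_fun setT rVuncons.
Proof.
apply/measurable_fun_pairP; split; first exact: measurable_coord.
apply: measurable_fun_rVP => i.
rewrite (_ : (fun _ => _) = (fun v : 'rV[R]_n.+1 => v ord0 (rshift 1 i))).
  exact: measurable_coord.
by apply/funext => v /=; rewrite mxE.
Qed.

Definition lebesgue_step (A : set 'rV[R]_n.+1) : \bar R :=
  (lebesgue_measure \x m)%E (rVcons @^-1` A).

Let step0 : lebesgue_step set0 = 0%E.
Proof. by rewrite /lebesgue_step preimage_set0 measure0. Qed.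

Let step_ge0 A : (0 <= lebesgue_step A)%E.
Proof. exact: measure_ge0. Qed.

Let step_sigma_additive : semi_sigma_additive lebesgue_step.
Proof.
have mf := measurable_rVcons.
exact: (@measure_semi_sigma_additive _ _ _
  (pushforward (lebesgue_measure \x m)%E rVcons)).
Qed.

HB.instance Definition _ := isMeasure.Build _ _ _ lebesgue_step
  step0 step_ge0 step_sigma_additive.

Let step_sigma_finite : sigma_finite setT lebesgue_step.
Proof.
have /sigma_finiteP[F [TF ndF Foo]] := sigma_finiteT (@lebesgue_measure R).
have /sigma_finiteP[G [TG ndG Goo]] := sigma_finiteT m.
exists (fun k => rVuncons @^-1` (F k `*` G k)) => [|k].
  rewrite -preimage_bigcup (_ : \bigcup_k _ = setT) ?preimage_setT//.
  rewrite -subTset => -[x y] _.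
  have [i _ Fix] : (\bigcup_k F k) x by rewrite -TF.
  have [j _ Gjy] : (\bigcup_k G k) y by rewrite -TG.
  exists (maxn i j) => //; split => /=.
    by move: x Fix; exact/subsetPset/ndF/leq_maxl.
  by move: y Gjy; exact/subsetPset/ndG/leq_maxr.
have [mF Fk] := Foo k; have [mG Gk] := Goo k; split.
  rewrite -[X in measurable X]setTI.
  by apply: measurable_rVuncons => //; exact: measurableX.
rewrite /lebesgue_step -comp_preimage (_ : rVuncons \o rVcons = id); last first.
  by apply/funext => p /=; rewrite rVconsK.
by rewrite product_measure1E// lte_mul_pinfty// ge0_fin_numE.
Qed.

HB.instance Definition _ := Measure_isSigmaFinite.Build _ _ _ lebesgue_step
  step_sigma_finite.

End lebesgue_step.

(* Lebesgue measure on R^n, as the n-fold product of the one-dimensional one. *)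
Fixpoint lebesgue_rV (R : realType) (n : nat) :
    {sigma_finite_measure set 'rV[R]_n -> \bar R} :=
  if n is n'.+1 then lebesgue_step (lebesgue_rV R n') else \d_(0 : 'rV[R]_0).

Section euclidean.
Context (R : realType) (d : nat).
Implicit Types u v : 'rV[R]_d.

Definition dotv u v : R := \sum_i u ord0 i * v ord0 i.

(* The library's norm on ['rV[R]_d] is the sup norm. *)
Definition enorm v : R := Num.sqrt (dotv v v).

Definition unit_dir v : 'rV[R]_d := (enorm v)^-1 *: v.

Definition eball (rho : R) : set 'rV[R]_d := [set v | enorm v < rho].

Definition sphere : set 'rV[R]_d := [set v | enorm v = 1].

Lemma measurable_enorm : measurable_fun setT enorm.
Proof.
rewrite (_ : enorm = (@powR R ^~ 2^-1) \o (fun v => dotv v v)); last first.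
  apply/funext => v; rewrite /= powR12_sqrt// sumr_ge0// => i _.
  by rewrite -expr2 sqr_ge0.
apply: (measurableT_comp (measurable_powR _)).
apply: measurable_sum => i.
by apply: measurable_funM; exact: measurable_coord.
Qed.

Lemma measurable_unit_dir : measurable_fun setT unit_dir.
Proof.
apply: measurable_fun_rVP => i.
rewrite (_ : (fun _ => _) =
    fun v => ((@powR R ^~ (-1)) \o enorm) v * v ord0 i); last first.
  apply/funext => v; rewrite /unit_dir mxE/= -powR_inv1//; exact: sqrtr_ge0.
apply: measurable_funM; last exact: measurable_coord.
apply: (measurableT_comp (measurable_powR _)).
exact: measurable_enorm.
Qed.

Lemma measurable_eball rho : measurable (eball rho).
Proof.
rewrite -[X in measurable X]setTI (_ : eball rho = enorm @^-1` `]-oo, rho[).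
  exact: measurable_enorm.
by apply/seteqP; split => v /=; rewrite in_itv.
Qed.

Lemma enorm_ge_coord v i : `|v ord0 i| <= enorm v.
Proof.
rewrite -sqrtr_sqr ler_wsqrtr// /dotv (bigD1 i)//= -expr2 lerDl.
by rewrite sumr_ge0// => j _; rewrite -expr2 sqr_ge0.
Qed.

End euclidean.
Arguments eball {R} d rho.
Arguments sphere R d : clear implicits.

Lemma measurable_cube (R : realType) (n : nat) :
  measurable [set v : 'rV[R]_n | forall i, `|v ord0 i| <= 1].
Proof.
rewrite (_ : mkset _ = \bigcap_(i in [set: 'I_n])
    ((fun v : 'rV[R]_n => v ord0 i) @^-1` `[-1, 1])); last first.
  apply/seteqP; split => [v vk i _ /=|v vk i]; first by rewrite in_itv/= -ler_norml.
  by have := vk i I; rewrite /= in_itv/= -ler_norml.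
apply: fin_bigcap_measurable => // i _.
by rewrite -[X in measurable X]setTI; exact: measurable_coord.
Qed.

Lemma lebesgue_cube_fin (R : realType) (n : nat) :
  (lebesgue_rV R n [set v | forall i, `|v ord0 i| <= 1]%R < +oo)%E.
Proof.
elim: n => [|n IHn] /=; first by rewrite diracE ltry.
rewrite /lebesgue_step (_ : _ @^-1` _ =
  `[-1, 1] `*` [set v : 'rV[R]_n | forall i, `|v ord0 i| <= 1]).
  rewrite product_measure1E//; last exact: measurable_cube.
  have Ifin : (lebesgue_measure (`[(-1)%R, 1%R]%classic : set R) \is a fin_num)%E.
    by rewrite lebesgue_measure_itv/=; case: ifPn.
  apply: lte_mul_pinfty; [exact: measure_ge0|exact: Ifin|exact: IHn].
apply/seteqP; split => [[x v] xv|[x v] [/= x1 v1] i].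
  split=> [|i] /=.
    by have := xv ord0; rewrite rVconsE0 in_itv/= -ler_norml.
  by have := xv (rshift 1 i); rewrite rVconsEr.
have [j ->|j ->] := split_ordP (i : 'I_(1 + n)%N).
  by rewrite rVconsEl ler_norml; move: x1; rewrite in_itv.
by rewrite rVconsEr v1.
Qed.

Section sphere_measure.
Context (R : realType) (d : nat).

(* Surface measure of the unit sphere, as the cone measure
   [d * vol {x | |x| < 1, x / |x| \in A}]; for [d = 1] it is the counting
   measure of [{-1, 1}]. It is carried by [sphere R d]. *)
Definition sphere_measure (A : set 'rV[R]_d) : \bar R :=
  (d%:R%:E * lebesgue_rV R d (@unit_dir R d @^-1` A `&` eball d 1))%E.

Let s0 : sphere_measure set0 = 0%E.
Proof. by rewrite /sphere_measure preimage_set0 set0I measure0 mule0. Qed.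

Let s_ge0 A : (0 <= sphere_measure A)%E.
Proof. by rewrite /sphere_measure mule_ge0// lee_fin. Qed.

Let s_sigma_additive : semi_sigma_additive sphere_measure.
Proof.
have mf := @measurable_unit_dir R d.
have mb := @measurable_eball R d 1.
exact: (@measure_semi_sigma_additive _ _ _ (mscale d%:R%:nng
  (pushforward (mrestr (lebesgue_rV R d) mb) (@unit_dir R d)))).
Qed.

HB.instance Definition _ := isMeasure.Build _ _ _ sphere_measure
  s0 s_ge0 s_sigma_additive.

Let s_fin : fin_num_fun sphere_measure.
Proof.
move=> A mA; rewrite fin_numM// ge0_fin_numE//.
apply: le_lt_trans (lebesgue_cube_fin R d); apply: le_measure; rewrite ?inE.
- apply: measurableI; last exact: measurable_eball.
  by rewrite -[X in measurable X]setTI; exact: measurable_unit_dir.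
- exact: measurable_cube.
- by move=> v [_ v1] i; rewrite (le_trans (enorm_ge_coord v i))// ltW.
Qed.

HB.instance Definition _ := @Measure_isFinite.Build _ _ _ sphere_measure s_fin.

End sphere_measure.
Arguments sphere_measure : clear implicits.

Section periodic_functions.
Context (R : realType) (d : nat).
Implicit Types (f g h phi : 'rV[R]_d -> R) (v : 'rV[R]_d).

Definition box : set 'rV[R]_d := [set v | forall i, - pi <= v ord0 i <= pi].

Definition periodic f : Prop :=
  forall v i, f (v + (pi *+ 2) *: delta_mx ord0 i) = f v.

Definition inner f g : R := \int[lebesgue_rV R d]_(v in box) (f v * g v).

Definition L2norm f : \bar R :=
  'N[lebesgue_rV R d]_(2%:E)[EFin \o (f \_ box)].

Definition L2p f : Prop :=
  [/\ periodic f, measurable_fun setT f & (L2norm f < +oo)%E].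

Definition pderiv (i : 'I_d) f : 'rV[R]_d -> R :=
  fun v => 'D_(delta_mx ord0 i) f v.

Definition smooth f : Prop := forall s : seq 'I_d,
  continuous (foldr pderiv f s) /\
  forall v i, derivable (foldr pderiv f s) v (delta_mx ord0 i).

Definition multi_index (r : nat) := {ffun 'I_d -> 'I_r.+1}.

Definition mi_order r (a : multi_index r) : nat := (\sum_i a i)%N.

Definition mderiv r (a : multi_index r) f : 'rV[R]_d -> R :=
  foldr pderiv f (flatten [seq nseq (a i) i | i <- enum 'I_d]).

(* Weak derivatives on the torus R^d / (2 pi Z)^d: the test functions are the
   smooth periodic functions, so there are no boundary terms, and a jump of the
   periodic extension across the boundary of the box is ruled out. *)
Definition weak_deriv r (a : multi_index r) f g : Prop :=
  forall phi, smooth phi -> periodic phi ->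
    inner f (mderiv a phi) = (-1) ^+ mi_order a * inner g phi.

Definition weak_derivs r f (D : multi_index r -> 'rV[R]_d -> R) : Prop :=
  L2p f /\ forall a : multi_index r, (mi_order a <= r)%N ->
    L2p (D a) /\ weak_deriv a f (D a).

Definition Hp r f : Prop := exists D, @weak_derivs r f D.

(* Weak derivatives are unique almost everywhere, so that the infimum ranges
   over a singleton if [f] is in [Hp r], and over the empty set (whence +oo)
   otherwise. *)
Definition Hnorm r f : \bar R :=
  ereal_inf [set sqrte (\sum_(a : multi_index r | (mi_order a <= r)%N)
                          L2norm (D a) ^+ 2)%E | D in @weak_derivs r f].

End periodic_functions.

Section collision.
Context (R : realType) (d : nat).
Implicit Types (f g h : 'rV[R]_d -> R) (v : 'rV[R]_d).

(* [cs] is the scattering cross-section, a function of |q| and cos(theta). *)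
Definition coll_kernel (cs : R -> R -> R) (q c : R) : R := q * cs q c.

(* [v_] is v_* = v - q and [v_'] is v'_*; the relative velocity q and the
   direction omega (the sigma of the integral) are the integration variables. *)
Definition Q (cs : R -> R -> R) (rho : R) f v : R :=
  \int[(lebesgue_rV R d \x sphere_measure R d)%E]_(p in
      eball d (2 * rho) `*` sphere R d)
    let q := p.1 in let omega := p.2 in
    let v_ := v - q in
    let v' := 2^-1 *: (v + v_) + (enorm (v - v_) / 2) *: omega in
    let v_' := 2^-1 *: (v + v_) - (enorm (v - v_) / 2) *: omega in
    coll_kernel cs (enorm q) (dotv (unit_dir q) omega) *
      (f v_' * f v' - f v_ * f v).

(* (1, v_1, .., v_d, |v|^2) *)
Definition Phi v : 'rV[R]_(1 + d + 1) :=
  row_mx (row_mx 1%:M v) (enorm v ^+ 2)%:M.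

Definition moments f : 'rV[R]_(1 + d + 1) :=
  \row_i inner f (fun v => Phi v ord0 i).

(* e^{i t} *)
Definition expi (t : R) : R[i] := (cos t +i* sin t)%C.

(* The frequencies k in Z^d with -N <= k_j <= N, shifted to 0 <= k_j + N <= 2N. *)
Definition freq (N : nat) (k : {ffun 'I_d -> 'I_(N.*2).+1}) : 'rV[R]_d :=
  \row_j ((k j)%:R - N%:R).

(* The real-valued elements of the complex span of the e^{i k.v}. *)
Definition trig_poly (N : nat) : set ('rV[R]_d -> R) :=
  [set g | exists c : {ffun 'I_d -> 'I_(N.*2).+1} -> R[i],
    forall v, (g v)%:C%C = \sum_k c k * expi (dotv (freq k) v)].

Definition argmin (T : choiceType) (x0 : T) (J : T -> \bar R) (A : set T) : T :=
  xget x0 [set x | A x /\ forall y, A y -> (J x <= J y)%E].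

Definition cons_proj (N : nat) f : 'rV[R]_d -> R :=
  argmin (cst 0) (fun g => L2norm (g \- f)%R ^+ 2)%E
    [set g | trig_poly N g /\ moments g = moments f].

Definition Qc (cs : R -> R -> R) (rho : R) (N : nat) f : 'rV[R]_d -> R :=
  argmin (cst 0) (fun g => L2norm (g \- Q cs rho f)%R ^+ 2)%E
    [set g | trig_poly N g /\ moments g = 0].

End collision.

(* Main.v *)
Require Import Defs.
From HB Require Import structures.
From mathcomp Require Import all_boot all_order all_algebra.
From mathcomp Require Import all_classical all_reals all_analysis.
From mathcomp Require Import measurable_realfun complex ring lra zify.
Set Implicit Arguments.
Unset Strict Implicit.
Unset Printing Implicit Defensive.
Import Order.TTheory GRing.Theory Num.Theory.
Import numFieldNormedType.Exports.
Local Open Scope classical_set_scope.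
Local Open Scope ring_scope.

(** Write [q] for the operator applied to [f], [qN] for the operator applied to
    the conservative projection [fN] of [f], and [G] for the constrained
    approximation of [qN]. The error splits as |q - G| <= |q - qN| + |qN - G|
    in the L^2 norm [nrm] of the box, and each term costs one factor N^-r.

    - The truncated operator is locally Lipschitz on periodic L^2 functions
      ([collision_lipschitz]): |Q f - Q g| <= K (|f| + |g|) |f - g|. It is the
      diagonal of a bilinear operator with bounded weight, so by Cauchy-Schwarz
      in (q, omega) it suffices to bound the integrals over v, q and omega of
      F(v - q) G(v) and F(v_') G(v'), with F and G periodic and nonnegative, by
      a multiple of the product of the integrals of F and G over one period. For
      the loss term the ball in q is covered by finitely many boxes
      ([integral_cover], [loss_bound]). For the gain term one translates v to
      make v' the base point; then v_' = v' - |q| omega, and [polar_bound] turns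
      the integral over (q, omega) into an integral over y = |q| omega, whence
      the covering again ([gain_bound]).

    - Fourier truncation converges at rate N^-r on H^r ([proj_error]): pairing
      the weak r-th derivative in direction j with a product of sines and
      cosines multiplies the k-th Fourier coefficient by k_j^r up to sign, and
      Bessel's inequality bounds the tail. The tail represents f minus its
      projection since trigonometric polynomials are dense ([trig_dense_L2box]).

    - Both constrained minimizers are as good as the Fourier projection P_N up to
      a constant independent of N. Trigonometric polynomials of degree 1
      already realize arbitrary moments ([dual_moments]), so the defect in the
      moments of a projection is repaired by a correction of comparable size
      ([argmin_error]). Hence |f - fN| <= kap |f - P_N f| ([cons_proj_error]).
      For G the target moments are 0, while those of P_N qN are at most a
      multiple of |qN - P_N qN| + |q - qN| plus the moments of q, and the latter
      are at most Ct delta' N^-r by hypothesis ([Qc_error]).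

    The Sobolev norm is an infimum over families of weak derivatives; every
    bound above is proved for each family and then passes to the infimum. If
    [qN] has no weak derivatives then the right-hand side is +oo. *)

(** * Integration on R^n *)

Section lebesgue_rV_integral.
Context (R : realType).
Local Open Scope ereal_scope.

Lemma ge0_integral_rVS n (f : 'rV[R]_n.+1 -> \bar R) :
  measurable_fun setT f -> (forall v, 0 <= f v) ->
  \int[lebesgue_rV R n.+1]_v f v =
  \int[lebesgue_measure]_x \int[lebesgue_rV R n]_v f (rVcons (x, v)).
Proof.
move=> mf f0.
have mc := @measurable_rVcons R n.
transitivity (\int[pushforward (lebesgue_measure \x lebesgue_rV R n) (@rVcons R n)]_v f v).
  by apply: eq_measure_integral.
rewrite ge0_integral_pushforward//.
rewrite preimage_setT fubini_tonelli1//; last by move=> x; exact: f0.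
exact: measurableT_comp.
Qed.

Lemma integrable_rVS n (f : 'rV[R]_n.+1 -> \bar R) :
  (lebesgue_rV R n.+1).-integrable setT f ->
  (lebesgue_measure \x lebesgue_rV R n).-integrable setT (f \o @rVcons R n).
Proof.
move=> /integrableP[mf fi]; apply/integrableP; split.
  by apply: measurableT_comp => //; exact: measurable_rVcons.
rewrite fubini_tonelli1//; last first.
   apply: measurableT_comp => //; apply: measurableT_comp => //; exact: measurable_rVcons.
by move: fi; rewrite ge0_integral_rVS//; exact: measurableT_comp.
Qed.

Local Notation leb := (@lebesgue_measure R).

Lemma measurable_affine (s t : R) :
  measurable_fun [set: measurableTypeR R] ((fun x : R => s * x +
    t)%R : measurableTypeR R -> measurableTypeR R).
Proof. by apply: measurable_funD => //; exact: measurable_funM. Qed.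

(** Both sides are measures that agree on the half-open intervals, which
    determine Lebesgue measure; the sign of [s] decides which end of the
    preimage is closed. *)
Lemma pushforward_affine (s t : R) (A : set (measurableTypeR R)) : s != 0%R ->
  measurable A ->
  leb A = (`|s|%R)%:E * pushforward leb (fun x : R => (s * x + t)%R : measurableTypeR R) A.
Proof.
move=> s0 mA.
have mm := measurable_affine s t.
pose m : {measure set (measurableTypeR R) -> \bar R} :=
  mscale (NngNum (normr_ge0 s)) (pushforward leb (fun x : R => (s * x +
    t)%R : measurableTypeR R)).
rewrite -[RHS]/(m mm A); apply: lebesgue_measure_unique => // X [[a b]] _ <-.
rewrite -[RHS]/(`|s|%:E * leb ((fun x : R => s * x + t)%R @^-1` `]a, b]%classic)).
move: s0; rewrite neq_lt => /orP[s0|s0].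
- rewrite (_ : _ @^-1` _ = `[(b - t) / s, (a - t) / s[%classic)%R; last first.
    apply/seteqP; split => x /=; rewrite !in_itv/= => /andP[];
    rewrite ler_ndivrMr// ltr_ndivlMr//.
      by rewrite -lerBrDr -ltrBlDr (mulrC x) => -> ->.
    by rewrite -lerBrDr -ltrBlDr (mulrC x) => -> ->.
  rewrite !lebesgue_measure_itv/= !lte_fin ltr_ndivrMr// mulfVK ?lt_eqF//.
  rewrite ltrD2r; case: ifPn => ab; last by rewrite mule0.
  rewrite ltr0_norm// -!EFinB -EFinM; congr EFin; field.
  by rewrite lt_eqF.
- rewrite (_ : _ @^-1` _ = `](a - t) / s, (b - t) / s]%classic)%R; last first.
    apply/seteqP; split => x /=; rewrite !in_itv/= => /andP[];
    rewrite ltr_pdivrMr// ler_pdivlMr//.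
      by rewrite -lerBrDr -ltrBlDr (mulrC x) => -> ->.
    by rewrite -lerBrDr -ltrBlDr (mulrC x) => -> ->.
  rewrite !lebesgue_measure_itv/= !lte_fin ltr_pdivrMr// mulfVK ?gt_eqF//.
  rewrite ltrD2r; case: ifPn => ab; last by rewrite mule0.
  rewrite gtr0_norm// -!EFinB -EFinM; congr EFin; field.
  by rewrite gt_eqF.
Qed.

Lemma ge0_integral_affine (s t : R) (h : R -> \bar R) : s != 0%R ->
  measurable_fun setT h -> (forall x, 0 <= h x) ->
  \int[leb]_x h (s * x + t)%R = (`|s|^-1)%:E * \int[leb]_x h x.
Proof.
move=> s0 mh h0; have mm := measurable_affine s t.
have -> : \int[leb]_x h x = (`|s|%R)%:E * \int[pushforward leb (fun x : R => (s * x +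
  t)%R : measurableTypeR R)]_x h x.
  rewrite -(ge0_integral_mscale _ _ (NngNum (normr_ge0 s)))//.
  by apply: eq_measure_integral => A mA _; rewrite /= /mscale/= -pushforward_affine.
rewrite muleA -EFinM mulVf ?normr_eq0// mul1e.
by rewrite ge0_integral_pushforward// preimage_setT.
Qed.

Lemma measurable_rV_affine n (s : R) (a : 'rV[R]_n) :
  measurable_fun setT (fun v : 'rV[R]_n => s *: v + a)%R.
Proof.
apply: measurable_fun_rVP => i.
rewrite (_ : (fun _ => _) = fun v : 'rV[R]_n => s * v ord0 i + a ord0 i)%R; last first.
  by apply/funext => v; rewrite !mxE.
by apply: measurable_funD => //; apply: measurable_funM => //; exact: measurable_coord.
Qed.

(** Induction on the dimension: integrating out the first coordinate gives one
    factor [`|s|^-1]. *)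
Lemma ge0_integral_rV_affine n (s : R) (a : 'rV[R]_n) (f : 'rV[R]_n -> \bar R) :
  s != 0%R -> measurable_fun setT f -> (forall v, 0 <= f v) ->
  \int[lebesgue_rV R n]_v f (s *: v + a)%R =
  (`|s| ^- n)%:E * \int[lebesgue_rV R n]_v f v.
Proof.
move=> s0; elim: n a f => [|n IH] a f mf f0.
  rewrite /= expr0 invr1 mul1e; apply: eq_integral => v _; congr (f _).
  by apply/rowP => -[].
have mfa := measurable_rV_affine s a.
have mc := @measurable_rVcons R n.
rewrite [LHS]ge0_integral_rVS//; last exact: (measurableT_comp mf).
rewrite [in RHS]ge0_integral_rVS//.
pose a' : 'rV[R]_n := (\row_j a ord0 (rshift 1 j))%R.
pose F x := \int[lebesgue_rV R n]_v f (rVcons (x, v)).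
have mF : measurable_fun setT F.
  apply: (measurable_fun_fubini_tonelli_F (f \o @rVcons R n)); last by move=> x; exact: f0.
  exact: measurableT_comp.
transitivity (\int[leb]_x ((`|s| ^- n)%:E * F (s * x + a ord0 ord0)%R)).
  apply: eq_integral => x _; rewrite -(IH a').
  - apply: eq_integral => v _; congr (f _).
    apply/rowP => i; rewrite [LHS]mxE [X in (X + _)%R = _]mxE.
    have [j ->|j ->] := split_ordP (i : 'I_(1 + n)%N).
      rewrite !rVconsEl; congr (_ + a _ _)%R; rewrite (ord1 j); exact/val_inj.
    by rewrite !rVconsEr [RHS]mxE [X in _ = (X + _)%R]mxE [X in _ = (_ + X)%R]mxE.
  - apply: (measurableT_comp mf); apply: (measurableT_comp mc).
    exact: measurable_pair1.
  - by move=> v.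
have F0 x : 0 <= F x by exact: integral_ge0.
have mFa : measurable_fun setT (fun x => F (s * x + a ord0 ord0)%R).
  exact: (measurableT_comp mF (measurable_affine _ _)).
have k0 : 0 <= (`|s| ^- n)%:E by rewrite lee_fin invr_ge0 exprn_ge0.
rewrite (ge0_integralZl leb measurableT mFa (fun x _ => F0 _) k0).
rewrite ge0_integral_affine// muleA -EFinM -invfM mulrC -exprS.
by [].
Qed.

End lebesgue_rV_integral.

Section product_formula.
Context (R : realType).
Local Notation leb := (@lebesgue_measure R).

Lemma integral_rVS n (f : 'rV[R]_n.+1 -> \bar R) :
  (lebesgue_rV R n.+1).-integrable setT f ->
  (\int[lebesgue_rV R n.+1]_v f v =
  \int[leb]_x \int[lebesgue_rV R n]_v f (rVcons (x, v)))%E.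
Proof.
move=> fi; have mc := @measurable_rVcons R n.
have mf := measurable_int _ fi.
have fci := integrable_rVS fi.
transitivity (\int[pushforward (leb \x lebesgue_rV R n) (@rVcons R n)]_v f v)%E.
  by apply: eq_measure_integral.
rewrite integral_pushforward// preimage_setT.
by rewrite -integral12_prod_meas1.
Qed.

(** Integrability and the formula are proved together, since the induction needs
    the integrability of the product over the remaining variables to apply
    Fubini. *)
Lemma integrable_Rintegral_prod n (g : 'I_n -> R -> R) :
  (forall j, leb.-integrable setT (EFin \o g j)) ->
  (lebesgue_rV R n).-integrable setT (fun v => (\prod_j g j (v ord0 j))%:E) /\
  (\int[lebesgue_rV R n]_v \prod_j g j (v ord0 j) =
   \prod_j \int[leb]_x g j x).
Proof.
elim: n g => [|n IH] g gi.
  have E : (fun v : 'rV[R]_0 => (\prod_(j < 0) g j (v ord0 j))%:E) = cst 1%:E.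
    by apply/funext => v; rewrite big_ord0.
  rewrite E; split.
    exact: (@finite_measure_integrable_cst _ _ _ (\d_(0 : 'rV[R]_0)) _ _ measurableT).
  rewrite /Rintegral big_ord0 [X in fine X](_ : _ = 1%:E)//.
  transitivity (\int[lebesgue_rV R 0]_v (cst 1%:E v))%E.
    by apply: eq_integral => v _; rewrite big_ord0.
  by rewrite integral_cst// mul1e /= diracE in_setT.
pose F (v : 'rV[R]_n) := \prod_j g (lift ord0 j) (v ord0 j).
have [Fi FE] := IH _ (fun j => gi (lift ord0 j)).
have mg j : measurable_fun setT (g j).
  by apply/measurable_EFinP; exact: measurable_int (gi j).
have FG x v : \prod_j g j (rVcons (x, v) ord0 j) = g ord0 x * F v.
  rewrite big_ord_recl rVconsE0; congr (_ * _); apply: eq_bigr => j _.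
  by rewrite -(rVconsEr (x, v)); congr (g _ (rVcons _ _ _)); exact/val_inj.
have mG : measurable_fun setT (fun v : 'rV[R]_n.+1 => \prod_j g j (v ord0 j)).
  apply: measurable_prod => j _.
  by apply: measurableT_comp => //; exact: measurable_coord.
have mF : measurable_fun setT F.
  by apply/measurable_EFinP; exact: measurable_int Fi.
have Gi : (lebesgue_rV R n.+1).-integrable setT
    (fun v => (\prod_j g j (v ord0 j))%:E).
  apply/integrableP; split; first exact/measurable_EFinP.
  rewrite ge0_integral_rVS//; last first.
    by apply: measurableT_comp => //; exact/measurable_EFinP.
  rewrite [ltLHS](_ : _ = (\int[leb]_x (`|(g ord0 x)%:E| *
       \int[lebesgue_rV R n]_v `|(F v)%:E|))%E).
    rewrite ge0_integralZr//.
    - apply: lte_mul_pinfty => //.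
      + exact: integral_ge0.
      + rewrite ge0_fin_numE; last exact: integral_ge0.
        by have /integrableP[] := gi ord0.
      + by have /integrableP[] := Fi.
    - by apply: measurableT_comp => //; apply/measurable_EFinP; exact: mg.
    - exact: integral_ge0.
  apply: eq_integral => x _; rewrite -ge0_integralZl//.
    by apply: eq_integral => v _; rewrite FG EFinM abseM.
  by apply: measurableT_comp => //; exact/measurable_EFinP.
split => //.
rewrite /Rintegral integral_rVS// big_ord_recl -FE.
transitivity (\int[leb]_x (g ord0 x * \int[lebesgue_rV R n]_v F v)).
  congr fine; apply: eq_integral => x _.
  rewrite EFinM /Rintegral fineK; last exact: integrable_fin_num.
  rewrite -integralZl//; apply: eq_integral => v _.
  by rewrite FG EFinM.
by rewrite RintegralZr.
Qed.

Lemma measurable_box n : measurable (@box R n).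
Proof.
rewrite [X in measurable X](_ : _ = \bigcap_(i in [set: 'I_n])
    ((fun v : 'rV[R]_n => v ord0 i) @^-1` `[- pi, pi])); last first.
  apply/seteqP; split => [v vk i _ /=|v vk i]; first by rewrite in_itv/=.
  by have := vk i I; rewrite /= in_itv/=.
apply: fin_bigcap_measurable => // i _.
by rewrite -[X in measurable X]setTI; exact: measurable_coord.
Qed.

Lemma restrict_box n (g : 'I_n -> R -> R) :
  (fun v : 'rV[R]_n => \prod_j g j (v ord0 j)) \_ (@box R n) =
  (fun v => \prod_j ((g j) \_ `[- pi, pi]%classic) (v ord0 j)).
Proof.
apply/funext => v; rewrite /patch; case: ifPn => [|vb].
  rewrite inE => vb; apply: eq_bigr => j _; rewrite mem_set//= in_itv/=.
  exact: vb.
suff [j /negP vj] : exists j, ~ (- pi <= v ord0 j <= pi).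
  rewrite (bigD1 j)//= memNset ?mul0r// /= in_itv/=; exact/negP.
by apply/existsNP => vb'; move: vb; rewrite mem_set.
Qed.

Lemma integrable_Rintegral_box n (g : 'I_n -> R -> R) :
  (forall j, leb.-integrable `[- pi, pi] (EFin \o g j)) ->
  (lebesgue_rV R n).-integrable (@box R n) (fun v => (\prod_j g j (v ord0 j))%:E) /\
  (\int[lebesgue_rV R n]_(v in @box R n) \prod_j g j (v ord0 j) =
   \prod_j \int[leb]_(x in `[- pi, pi]) g j x).
Proof.
move=> gi; have mb := @measurable_box n.
have [|i1 i2] := @integrable_Rintegral_prod n (fun j => (g j) \_ `[- pi, pi]%classic).
  move=> j; rewrite -restrict_EFin; apply/(integrable_mkcond _ _).1 => //.
split.
  apply/(integrable_mkcond _ _).2 => //.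
  by rewrite (restrict_EFin (fun v : 'rV[R]_n => \prod_j g j (v ord0 j))) restrict_box.
rewrite Rintegral_mkcond restrict_box i2; apply: eq_bigr => j _.
by rewrite -Rintegral_mkcond.
Qed.

Lemma box_fin n : (lebesgue_rV R n (@box R n) < +oo)%E.
Proof.
have [|i1 _] := @integrable_Rintegral_box n (fun=> cst 1).
  move=> j; apply: continuous_compact_integrable; first exact: segment_compact.
  by apply: continuous_subspaceT => x; exact: cvg_cst.
have /integrableP[_] := i1.
under eq_integral do rewrite big1//= normr1.
by rewrite integral_cst ?mul1e//; exact: measurable_box.
Qed.

(** The indicator of a slice of the box is a product of one-variable functions,
    one of which vanishes almost everywhere. *)
Lemma box_slice0 n (j : 'I_n) (c : R) :
  lebesgue_rV R n (@box R n `&` [set v | v ord0 j = c]) = 0%E.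
Proof.
have mb := @measurable_box n.
pose g (l : 'I_n) : R -> R := if l == j then \1_[set c] else cst 1.
have gi l : leb.-integrable `[- pi, pi] (EFin \o g l).
  rewrite /g; case: ifPn => _.
    apply: (integrableS measurableT) => //.
    by rewrite -set_itv1; exact: integrable_indic_itv.
  apply: continuous_compact_integrable; first exact: segment_compact.
  by apply: continuous_subspaceT => x; exact: cvg_cst.
have [i1 i2] := integrable_Rintegral_box gi.
have E (v : 'rV[R]_n) : \prod_l g l (v ord0 l) = \1_[set v : 'rV[R]_n | v ord0 j = c] v.
  rewrite (bigD1 j)//= big1 ?mulr1 /g ?eqxx//.
  by move=> l /negbTE ->.
have mc : measurable [set v : 'rV[R]_n | v ord0 j = c].
  rewrite -[X in measurable X]setTI (_ : [set v | _] =
     (fun v : 'rV[R]_n => v ord0 j) @^-1` [set c])//.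
  exact: measurable_coord.
have mi : (\int[lebesgue_rV R n]_(v in @box R n)
    (\1_[set v : 'rV[R]_n | v ord0 j = c] v)%:E =
      lebesgue_rV R n (@box R n `&` [set v | v ord0 j = c]))%E.
  by rewrite integral_indic// setIC.
rewrite -mi; under eq_integral do rewrite -E.
apply/eqP; rewrite -fine_eq0; last exact: integrable_fin_num.
rewrite -/(Rintegral _ _ _) i2 (bigD1 j)//= /g eqxx.
rewrite Rintegral_mkcond.
rewrite [X in X * _](_ : _ = 0) ?mul0r// -Rintegral_mkcond.
rewrite /Rintegral integral_indic//.
rewrite [X in fine X](_ : _ = 0%E)//;
  apply: subset_measure0 (lebesgue_measure_set1 c) => //.
by apply: measurableI.
Qed.

End product_formula.

(** * Periodic functions: covering by boxes and translation *)

Lemma sume_const (R : realType) (T : finType) (x : \bar R) : (0 <= x)%E ->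
  (\sum_(i : T) x = #|T|%:R%:E * x)%E.
Proof.
move=> x0; rewrite big_const; elim: #|T| => [|k IH]; first by rewrite mul0e.
by rewrite iterS IH -natr1 EFinD ge0_muleDl// mul1e addeC.
Qed.

Section covering.
Context (R : realType) (n : nat).
Local Notation mu := (lebesgue_rV R n).

Definition lattice (z : 'I_n -> int) : 'rV[R]_n := \row_j ((pi *+ 2) *~ z j).

Lemma periodic_lattice (T : Type) (f : 'rV[R]_n -> T) :
  (forall v i, f (v + (pi *+ 2) *: delta_mx ord0 i) = f v) ->
  forall z v, f (v + lattice z) = f v.
Proof.
move=> pf z.
have pfn m i v : f (v + (pi *+ 2) *: delta_mx ord0 i *+ m) = f v.
  elim: m v => [|m IH] v; first by rewrite mulr0n addr0.
  by rewrite mulrS addrA IH pf.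
have pfz k i v : f (v + ((pi *+ 2) *: delta_mx ord0 i) *~ k) = f v.
  case: k => m; first exact: pfn.
  rewrite NegzE mulrNz -[in RHS](subrK ((pi *+ 2) *: delta_mx ord0 i *+ m.+1) v).
  by rewrite pfn.
have -> : lattice z = \sum_j ((pi *+ 2) *: delta_mx ord0 j) *~ z j.
  apply/rowP => i; rewrite mxE summxE (bigD1 i)//= big1 ?addr0.
    by rewrite -[(_ *: _) *~ _]scaler_int !mxE !eqxx mulr1 mulrzl.
  by move=> j ji; rewrite -[(_ *: _) *~ _]scaler_int !mxE eqxx eq_sym (negbTE ji) !mulr0.
elim: (index_enum _) => [|i s IH] v; first by rewrite big_nil addr0.
by rewrite big_cons addrA IH pfz.
Qed.

(** The segment of half-length [(2m+1)p] is the union of [2m+1] translates of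
    [[-p, p]]; the translate is found by induction on their number, after
    shifting the segment to start at 0. *)
Lemma cover_segment (p : R) (m : nat) (x : R) : 0 < p -> `|x| <= p *+ m.*2.+1 ->
  exists k : 'I_m.*2.+1, - p <= x - (p *+ 2) *~ (k%:Z - m%:Z) <= p.
Proof.
move=> p0.
suff H M (y : R) : 0 <= y <= p *+ 2 *+ M.+1 ->
    exists k : 'I_M.+1, p *+ 2 *+ k <= y <= p *+ 2 *+ k.+1.
  rewrite ler_norml => /andP[x1 x2].
  have [|k /andP[k1 k2]] := H m.*2 (x + p *+ m.*2.+1).
    apply/andP; split; first by rewrite -lerBlDr sub0r.
    by rewrite mulrnAC (mulr2n (p *+ _)) lerD2r.
  exists k; rewrite -mulrzl rmorphB/= -2!pmulrn mulrBl 2!mulr_natl.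
  have e1 : p *+ m.*2.+1 = p *+ 2 *+ m + p :> R.
    by rewrite mulrSr -mulrnA mul2n.
  move: k1 k2; rewrite mulrSr e1 => k1 k2; lra.
elim: M => [|M IH] /andP[y0 y1]; first by exists ord0; rewrite mulr0n y0 y1.
have [yM|yM] := leP y (p *+ 2 *+ M.+1).
  have [|k hk] := IH; first by rewrite y0.
  by exists (widen_ord (leqnSn _) k).
by exists ord_max; rewrite /= y1 ltW.
Qed.

Variable F : 'rV[R]_n -> \bar R.
Hypothesis mF : measurable_fun setT F.
Hypothesis F0 : forall v, (0 <= F v)%E.
Hypothesis pF : forall v i, F (v + (pi *+ 2) *: delta_mx ord0 i) = F v.

(** A set inside the cube of half-side [(2m+1) pi] is covered by [(2m+1)^n]
    translates of the box by periods, and by periodicity each of them carries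
    the same integral. *)
Lemma integral_cover (m : nat) (S : set 'rV[R]_n) : measurable S ->
  (forall v, S v -> forall j, `|v ord0 j| <= pi *+ m.*2.+1) ->
  (\int[mu]_(v in S) F v <= (m.*2.+1 ^ n)%:R%:E * \int[mu]_(v in @box R n) F v)%E.
Proof.
move=> mS Sm.
pose a (z : {ffun 'I_n -> 'I_m.*2.+1}) := lattice (fun j => (z j)%:Z - m%:Z).
pose G := F \_ (@box R n).
have mb := @measurable_box R n.
have mG : measurable_fun setT G.
  by apply/(measurable_restrictT _ _).1 => //; exact: measurable_funTS.
have G0 v : (0 <= G v)%E by rewrite /G /patch; case: ifPn.
have mGa z : measurable_fun setT (fun v : 'rV[R]_n => G (v - a z)).
  rewrite (_ : (fun _ => _) = fun v : 'rV[R]_n => G (1 *: v - a z)).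
    exact: (measurableT_comp mG (measurable_rV_affine _ _)).
  by apply/funext => v; rewrite scale1r.
have Gint z : (\int[mu]_v G (v - a z)%R = \int[mu]_(v in @box R n) F v)%E.
  rewrite [RHS]integral_mkcond -/G.
  have := ge0_integral_rV_affine (- a z) (oner_neq0 R) mG G0.
  rewrite normr1 expr1n invr1 mul1e => <-.
  by apply: eq_integral => v _; rewrite scale1r.
rewrite integral_mkcond.
apply: (@le_trans _ _ (\int[mu]_v (\sum_(z : {ffun 'I_n ->
  'I_m.*2.+1}) G (v - a z)%R)%E)%E).
  apply: ge0_le_integral => //.
  - by move=> v _; rewrite /patch; case: ifPn.
  - by apply/(measurable_restrictT _ _).1 => //; exact: measurable_funTS.
  - exact: emeasurable_sum.
  move=> v _; rewrite /patch; case: ifPn => [|_]; last exact: sume_ge0.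
  rewrite inE => /Sm vm.
  have /choice[k hk] : forall j, exists k : 'I_m.*2.+1,
     - pi <= v ord0 j - (pi *+ 2) *~ (k%:Z - m%:Z) <= pi by move=> j;
       exact: (cover_segment (pi_gt0 R)).
  rewrite (bigD1 [ffun j => k j])//=.
  apply: (@le_trans _ _ (G (v - a [ffun j => k j]))); last first.
    by apply: leeDl; exact: sume_ge0.
  rewrite /G /patch mem_set; last first.
    by move=> j; rewrite !mxE ffunE; exact: hk.
  rewrite -[v in leLHS](subrK (a [ffun j => k j])).
  by rewrite [leLHS](periodic_lattice pF).
rewrite ge0_integral_sum//.
under eq_bigr do rewrite Gint.
by rewrite sume_const ?card_ffun ?card_ord//; exact: integral_ge0.
Qed.

(** An inequality with a crude constant is enough for the estimates, and spares
    the exact invariance of the integral over a period: modulo a period the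
    shift lies in [[0, 2 pi]^n], so the shifted box lies in the cube of
    half-side [3 pi]. *)
Lemma integral_box_shift (a : 'rV[R]_n) :
  (\int[mu]_(v in @box R n) F (v + a)%R <= (3 ^ n)%:R%:E * \int[mu]_(v in @box R n) F v)%E.
Proof.
have p0 := @pi_gt0 R.
have mb := @measurable_box R n.
(* Reduce the shift modulo the period lattice. *)
pose z (j : 'I_n) := Num.floor (a ord0 j / (pi *+ 2)).
pose b := a - lattice z.
have bj j : 0 <= b ord0 j <= pi *+ 2.
  rewrite !mxE.
  have := floor_itv (a ord0 j / (pi *+ 2)).
  rewrite -/(z j) ler_pdivlMr ?ltr_pdivrMr; [|lra|lra].
  rewrite intrD mulrDl mul1r -mulrzl => /andP[] ? ?; lra.
have -> : (\int[mu]_(v in @box R n) F (v + a)%R = \int[mu]_(v in @box R n) F (v + b)%R)%E.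
  apply: eq_integral => v _; rewrite /b.
  by rewrite -[in RHS](periodic_lattice pF z) addrA subrK.
pose S := (fun v : 'rV[R]_n => v - b) @^-1` (@box R n).
have mS : measurable S.
  rewrite -[X in measurable X]setTI; rewrite /S.
  rewrite (_ : (fun v : 'rV[R]_n => v - b) = fun v : 'rV[R]_n => 1 *: v - b).
     by apply: measurable_rV_affine.
  by apply/funext => v; rewrite scale1r.
apply: le_trans (@integral_cover 1 S mS _); last first.
  move=> v Sv j; have := Sv j; rewrite mxE [(- b) _ _]mxE => /andP[v1 v2].
  have /andP[b1 b2] := bj j.
  rewrite ler_norml (_ : 1.*2.+1 = 3%N)// mulrSr; apply/andP; split; lra.
rewrite [leRHS]integral_mkcond.
have := @ge0_integral_rV_affine R n 1 b (F \_ S) (oner_neq0 R).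
rewrite normr1 expr1n invr1 mul1e => <-.
- rewrite [leLHS]integral_mkcond.
  rewrite (eq_integral (fun v : 'rV[R]_n => (F \_ S) (1 *: v + b)))// => v _.
  rewrite scale1r /patch.
  have -> : (v \in @box R n) = (v + b \in S); last by [].
  by apply/idP/idP; rewrite !inE /S /= addrK.
- by apply/(measurable_restrictT _ _).1 => //; exact: measurable_funTS.
- by move=> v; rewrite /patch; case: ifPn.
Qed.
End covering.

(** * The inner product of square-integrable functions on the box *)

(** The source of the Cauchy-Schwarz inequalities below. *)
Lemma discriminant_le0 (R : realFieldType) (a b c : R) : 0 <= a -> 0 <= c ->
  (forall t, 0 <= c * t ^+ 2 + 2 * b * t + a) -> b ^+ 2 <= a * c.
Proof.
move=> a0 c0 H; move: c0; rewrite le_eqVlt => /orP[/eqP c0|c0].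
  rewrite -c0 mulr0 leNgt; apply/negP => P.
  have b0 : b != 0 by rewrite -sqrf_eq0 gt_eqF.
  have := H (- (a + 1) / (2 * b)).
  rewrite -c0 mul0r add0r mulrC mulfVK ?mulf_neq0 ?pnatr_eq0//; lra.
have := H (- b / c).
have -> : c * (- b / c) ^+ 2 + 2 * b * (- b / c) + a = (a * c - b ^+ 2) / c.
  by field; rewrite gt_eqF.
by rewrite pmulr_lge0 ?invr_gt0// subr_ge0.
Qed.

Section square_integrable.
Context (R : realType) (n : nat).
Local Notation L := (lebesgue_rV R n).
Local Notation rV := 'rV[R]_n.
Local Notation box := (@box R n).
Implicit Types f g h : rV -> R.

(** Square-integrability on the box, with measurability on the whole space so
    that translates are measurable too. *)
Definition L2box f :=
  measurable_fun setT f /\ L.-integrable box (fun v => (f v ^+ 2)%:E).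

Definition nrm f : R := Num.sqrt (inner f f).

Lemma eq_inner f g f' g' : (forall v, box v -> f v = f' v) ->
  (forall v, box v -> g v = g' v) -> inner f g = inner f' g'.
Proof.
move=> ff' gg'; apply: eq_Rintegral => v; rewrite inE => vb.
by rewrite ff'// gg'.
Qed.

Lemma innerC f g : inner f g = inner g f.
Proof. by apply: eq_Rintegral => v _; rewrite mulrC. Qed.

(** From [2 |f g| <= f^2 + g^2]. *)
Lemma L2box_mul f g : L2box f -> L2box g ->
  L.-integrable box (fun v => (f v * g v)%:E).
Proof.
move=> [mf fi] [mg gi]; have mb := @measurable_box R n.
have := integrableD mb fi gi; apply: le_integrable => //.
  by apply/measurable_EFinP; apply: measurable_funTS; exact: measurable_funM.
move=> v _ /=; rewrite lee_fin normrM [leRHS]ger0_norm ?addr_ge0 ?sqr_ge0//.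
rewrite -(real_normK (num_real (f v))) -(real_normK (num_real (g v))).
have := sqr_ge0 (`|f v| - `|g v|); rewrite sqrrB => H.
have : 0 <= `|f v| * `|g v| by rewrite mulr_ge0.
lra.
Qed.

Lemma L2box_meas f : L2box f -> measurable_fun setT f. Proof. by case. Qed.

Lemma L2box_ext f g : L2box f -> (forall v, f v = g v) -> L2box g.
Proof. by move=> Lf fg; have <- : f = g by exact/funext. Qed.

Lemma L2boxD f g : L2box f -> L2box g -> L2box (fun v => f v + g v).
Proof.
move=> Lf Lg; have mb := @measurable_box R n.
split; first by apply: measurable_funD; [case: Lf|case: Lg].
have i1 := integrableD mb (integrableD mb Lf.2 Lg.2) (integrableZl mb 2 (L2box_mul Lf Lg)).
apply: eq_integrable i1 => // v _; rewrite /= -!EFinM -!EFinD; congr EFin; ring.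
Qed.

Lemma L2boxZ (c : R) f : L2box f -> L2box (fun v => c * f v).
Proof.
move=> Lf; have mb := @measurable_box R n.
split; first by apply: measurable_funM => //; case: Lf.
apply: eq_integrable (integrableZl mb (c ^+ 2) Lf.2) => // v _.
by rewrite /= -!EFinM exprMn.
Qed.

Lemma L2boxB f g : L2box f -> L2box g -> L2box (fun v => f v - g v).
Proof.
move=> Lf Lg; apply: L2box_ext (L2boxD Lf (L2boxZ (-1) Lg)) _ => v.
by rewrite mulN1r.
Qed.

Lemma L2box_bounded f (M : R) : measurable_fun setT f ->
  (forall v, box v -> `|f v| <= M) -> L2box f.
Proof.
move=> mf fM; have mb := @measurable_box R n; split => //.
have i1 : L.-integrable box (fun v => (M ^+ 2)%:E).
  apply/integrableP; split; first exact: measurable_cst.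
  rewrite integral_cst//; apply: lte_mul_pinfty => //.
  exact: box_fin.
apply: le_integrable i1 => //.
  by apply/measurable_EFinP; apply: measurable_funTS; exact: measurable_funX.
move=> v vb /=; rewrite lee_fin !ger0_norm ?sqr_ge0//.
rewrite -(real_normK (num_real (f v))).
by rewrite lerXn2r ?nnegrE ?fM// (le_trans _ (fM _ vb)).
Qed.

Lemma L2box_cst (c : R) : L2box (fun=> c).
Proof. by apply: (@L2box_bounded _ `|c|). Qed.

Lemma L2box_sum (I : Type) (s : seq I) (c : I -> R) (e : I -> rV -> R) :
  (forall i, L2box (e i)) -> L2box (fun v => \sum_(i <- s) c i * e i v).
Proof.
move=> Le; elim: s => [|i s IH].
  by apply: L2box_ext (L2box_cst 0) _ => v; rewrite big_nil.
by apply: L2box_ext (L2boxD (L2boxZ (c i) (Le i)) IH) _ => v; rewrite big_cons.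
Qed.

Lemma innerDl f g h : L2box f -> L2box g -> L2box h ->
  inner (fun v => f v + g v) h = inner f h + inner g h.
Proof.
move=> Lf Lg Lh; rewrite /inner -RintegralD; [|exact: measurable_box|exact: L2box_mul..].
by apply: eq_Rintegral => v _; rewrite mulrDl.
Qed.

Lemma innerZl (c : R) f h : L2box f -> L2box h ->
  inner (fun v => c * f v) h = c * inner f h.
Proof.
move=> Lf Lh; rewrite /inner -RintegralZl; [|exact: measurable_box|exact: L2box_mul..].
by apply: eq_Rintegral => v _; rewrite mulrA.
Qed.

Lemma innerBl f g h : L2box f -> L2box g -> L2box h ->
  inner (fun v => f v - g v) h = inner f h - inner g h.
Proof.
move=> Lf Lg Lh; rewrite /inner -RintegralB; [|exact: measurable_box|exact: L2box_mul..].
by apply: eq_Rintegral => v _; rewrite mulrBl.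
Qed.

Lemma innerDr f g h : L2box f -> L2box g -> L2box h ->
  inner h (fun v => f v + g v) = inner h f + inner h g.
Proof. by move=> Lf Lg Lh; rewrite innerC innerDl// !(innerC h). Qed.

Lemma innerBr f g h : L2box f -> L2box g -> L2box h ->
  inner h (fun v => f v - g v) = inner h f - inner h g.
Proof. by move=> Lf Lg Lh; rewrite innerC innerBl// !(innerC h). Qed.

Lemma innerZr (c : R) f h : L2box f -> L2box h ->
  inner h (fun v => c * f v) = c * inner h f.
Proof. by move=> Lf Lh; rewrite innerC innerZl// (innerC h). Qed.

Lemma inner_suml (I : Type) (s : seq I) (c : I -> R) (e : I -> rV -> R) h :
  (forall i, L2box (e i)) -> L2box h ->
  inner (fun v => \sum_(i <- s) c i * e i v) h = \sum_(i <- s) c i * inner (e i) h.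
Proof.
move=> Le Lh; elim: s => [|i s IH].
  rewrite big_nil (_ : (fun _ => _) = fun v => 0 * 0); last first.
    by apply/funext => v; rewrite big_nil mul0r.
  by rewrite innerZl ?mul0r//; exact: L2box_cst.
rewrite big_cons -IH -innerZl// -innerDl//.
- by congr inner; apply/funext => v; rewrite big_cons.
- exact: L2boxZ.
- exact: L2box_sum.
Qed.

Lemma inner_sumr (I : Type) (s : seq I) (c : I -> R) (e : I -> rV -> R) h :
  (forall i, L2box (e i)) -> L2box h ->
  inner h (fun v => \sum_(i <- s) c i * e i v) = \sum_(i <- s) c i * inner h (e i).
Proof.
move=> Le Lh; rewrite innerC inner_suml//; apply: eq_bigr => i _.
by rewrite innerC.
Qed.

Lemma inner_ge0 f : 0 <= inner f f.
Proof. by apply: Rintegral_ge0 => v _; rewrite -expr2 sqr_ge0. Qed.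

Lemma nrm_ge0 f : 0 <= nrm f. Proof. exact: sqrtr_ge0. Qed.

Lemma sqr_nrm f : nrm f ^+ 2 = inner f f.
Proof. by rewrite sqr_sqrtr// inner_ge0. Qed.

Lemma inner_CS f g : L2box f -> L2box g -> `|inner f g| <= nrm f * nrm g.
Proof.
move=> Lf Lg.
have H (t : R) : 0 <= inner g g * t ^+ 2 + 2 * inner f g * t + inner f f.
  have -> : inner g g * t ^+ 2 + 2 * inner f g * t + inner f f =
      inner (fun v => f v + t * g v) (fun v => f v + t * g v).
    have Lt := L2boxZ t Lg.
    rewrite innerDl ?innerDr ?innerZl ?innerZr//; last exact: L2boxD.
    by rewrite (innerC g f); ring.
  exact: inner_ge0.
rewrite -sqrtr_sqr /nrm -sqrtrM ?inner_ge0//; apply: ler_wsqrtr.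
by apply: discriminant_le0 H; exact: inner_ge0.
Qed.

Lemma nrmD f g : L2box f -> L2box g -> nrm (fun v => f v + g v) <= nrm f + nrm g.
Proof.
move=> Lf Lg; rewrite -(@ler_pXn2r _ 2)// ?nnegrE ?addr_ge0 ?nrm_ge0//.
rewrite sqr_nrm sqrrD !sqr_nrm innerDl ?innerDr//; last exact: L2boxD.
have := inner_CS Lf Lg; rewrite (innerC g f) => /(le_trans (ler_norm _)); lra.
Qed.

Lemma nrmZ (c : R) f : L2box f -> nrm (fun v => c * f v) = `|c| * nrm f.
Proof.
move=> Lf; rewrite /nrm innerZl ?innerZr//; last exact: L2boxZ.
by rewrite mulrA -expr2 sqrtrM ?sqr_ge0// sqrtr_sqr.
Qed.

Lemma nrmB_sym f g : L2box f -> L2box g -> nrm (fun v => f v - g v) =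
  nrm (fun v => g v - f v).
Proof.
move=> Lf Lg; rewrite -[RHS]mul1r -(normrN1 R) -nrmZ; last exact: L2boxB.
by congr nrm; apply/funext => v; ring.
Qed.

Lemma nrm_triangle f g h : L2box f -> L2box g -> L2box h ->
  nrm (fun v => f v - h v) <= nrm (fun v => f v - g v) + nrm (fun v => g v - h v).
Proof.
move=> Lf Lg Lh; apply: le_trans (nrmD (L2boxB Lf Lg) (L2boxB Lg Lh)).
by rewrite le_eqVlt; apply/orP; left; apply/eqP; congr nrm; apply/funext => v; ring.
Qed.

Lemma nrm_leB f g : L2box f -> L2box g -> nrm f <= nrm g + nrm (fun v => f v - g v).
Proof.
move=> Lf Lg; apply: le_trans (nrmD Lg (L2boxB Lf Lg)).
by rewrite le_eqVlt; apply/orP; left; apply/eqP; congr nrm; apply/funext => v; ring.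
Qed.

Lemma integral_L2norm f :
  (\int[L]_x (`|(EFin \o (f \_ box)) x| `^ 2) = \int[L]_(v in box) (f v ^+ 2)%:E)%E.
Proof.
rewrite [RHS]integral_mkcond; apply: eq_integral => v _; rewrite /= /patch.
case: ifPn => _.
  by rewrite powR_mulrn// real_normK ?num_real.
by rewrite normr0 powR0.
Qed.

Lemma integral_sqr f : L2box f -> (\int[L]_(v in box) (f v ^+ 2)%:E = (inner f f)%:E)%E.
Proof.
move=> Lf; rewrite /inner /Rintegral fineK; last first.
  by apply: integrable_fin_num; [exact: measurable_box|exact: L2box_mul].
by apply: eq_integral => v _; rewrite expr2.
Qed.

Lemma L2norm_nrm f : L2box f -> L2norm f = (nrm f)%:E.
Proof.
move=> Lf; rewrite /L2norm unlock integral_L2norm integral_sqr//.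
by rewrite poweR_EFin powR12_sqrt// inner_ge0.
Qed.

Lemma L2norm_L2box f : measurable_fun setT f -> (L2norm f < +oo)%E -> L2box f.
Proof.
move=> mf; rewrite /L2norm unlock integral_L2norm => foo; split => //.
apply/integrableP; split.
  by apply/measurable_EFinP; apply: measurable_funTS; exact: measurable_funX.
rewrite (eq_integral (fun v => (f v ^+ 2)%:E)); last first.
  by move=> v _; rewrite gee0_abs// lee_fin sqr_ge0.
rewrite ltey; apply: contraTN foo => /eqP ->.
by rewrite poweRyr// ?invr_eq0// ?pnatr_eq0// ltxx.
Qed.

(** Gram-Schmidt on the list [s] inside a class [V] of functions, by induction on
    [s]. That [p] lies in the span of [s] is expressed by the last clause: what is
    orthogonal to [s] is orthogonal to [p]. Dependent or null vectors in [s] need no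
    special care since a division by 0 gives 0. *)
Lemma orthogonal_projection (V : (rV -> R) -> Prop) (s : seq (rV -> R)) :
  V (fun=> 0) -> (forall c f g, V f -> V g -> V (fun v => f v + c * g v)) ->
  (forall f, V f -> L2box f) ->
  (forall e, List.In e s -> V e) ->
  forall f, L2box f -> exists p, [/\ V p,
    forall e, List.In e s -> inner (fun v => f v - p v) e = 0 &
    forall h, L2box h -> (forall e, List.In e s -> inner h e = 0) -> inner h p = 0].
Proof.
move=> V0 VD VL; elim: s => [|e s IH] Vs f Lf.
  exists (fun=> 0); split => // h Lh _.
  rewrite (_ : (fun=> 0) = fun _ : rV => 0 * 0 :> R).
    by rewrite innerZr ?mul0r//; exact: L2box_cst.
  by apply/funext => v; rewrite mulr0.
have Vs' e' : List.In e' s -> V e' by move=> e's; apply: Vs; right.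
have [p [Vp pe pS]] := IH Vs' f Lf.
have Ve : V e by apply: Vs; left.
have [b [Vb be bS]] := IH Vs' e (VL _ Ve).
have Le := VL _ Ve; have Lp := VL _ Vp; have Lb := VL _ Vb.
pose e' v := e v - b v.
have Le' : L2box e' by exact: L2boxB.
have Ve' : V e'.
  by have := VD (-1) _ _ Ve Vb; congr V; apply/funext => v; rewrite /e'; ring.
have Lfp : L2box (fun v => f v - p v) by exact: L2boxB.
(* [e'] is the part of [e] orthogonal to the tail of the list. *)
pose c := inner (fun v => f v - p v) e' / inner e' e'.
pose p' v := p v + c * e' v.
have Lp' : L2box p' by apply: L2boxD => //; exact: L2boxZ.
have Lfp' : L2box (fun v => f v - p' v) by exact: L2boxB.
have E h : L2box h -> inner (fun v => f v - p' v) h =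
    inner (fun v => f v - p v) h - c * inner e' h.
  move=> Lh; rewrite -innerZl// -innerBl//; last exact: L2boxZ.
  by apply: eq_inner => // v _; rewrite /p'; ring.
have Hs e0 : List.In e0 s -> inner (fun v => f v - p' v) e0 = 0.
  move=> e0s; rewrite E; last exact/VL/Vs'.
  by rewrite pe// be// mulr0 subr0.
have He' : inner (fun v => f v - p' v) e' = 0.
  have [z|nz] := eqVneq (inner e' e') 0.
    apply/eqP; rewrite -normr_le0; apply: le_trans (inner_CS Lfp' Le') _.
    by rewrite {2}/nrm z sqrtr0 mulr0.
  by rewrite E// /c mulfVK// subrr.
exists p'; split; first exact: VD.
  move=> e0 [<-|]; last exact: Hs.
  rewrite (@eq_inner _ _ (fun v => f v - p' v) (fun v => e' v + b v))//; last first.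
    by move=> v _; rewrite /e' subrK.
  by rewrite innerDr// He' bS// addr0.
move=> h Lh hs.
have hS e0 : List.In e0 s -> inner h e0 = 0 by move=> e0s; apply: hs; right.
rewrite /p' innerDr//; last exact: L2boxZ.
rewrite pS// innerZr// /e' innerBr// bS// hs; last by left.
by rewrite subrr mulr0 addr0.
Qed.

End square_integrable.

(** * The trigonometric basis in one variable *)

Section one_dim.
Context (R : realType).
Local Notation leb := (@lebesgue_measure R).
Implicit Types (x y c : R) (k l : int).

(** The fundamental theorem of calculus for an antiderivative on the whole line,
    so that no one-sided condition remains. *)
Lemma Rintegral_pi_FTC (f F : R -> R) : (forall x, is_derive x 1 F (f x)) ->
  continuous f -> \int[leb]_(x in `[- pi, pi]) f x = F pi - F (- pi).
Proof.
move=> dF cf; have p0 := @pi_gt0 R.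
have dF' x : derivable F x 1 by have := dF x => -[].
have cF : continuous F.
  by move=> x; apply/differentiable_continuous/derivable1_diffP.
rewrite /Rintegral (@continuous_FTC2 _ f F)//.
- lra.
- exact: continuous_subspaceT.
- split => //; first by apply: cvg_at_right_filter; exact: cF.
  by apply: cvg_at_left_filter; exact: cF.
- by move=> x _; rewrite derive1E; have := dF x => -[].
Qed.

Lemma is_derive_mul c x : is_derive x 1 (fun x => c * x) c.
Proof.
have := is_deriveZ c (is_derive_id x (1 : R)).
by rewrite -[c *: 1]/(c * 1) mulr1.
Qed.

Lemma is_derive_sinZ c x : is_derive x 1 (fun x => sin (c * x)) (c * cos (c * x)).
Proof.
have := @is_derive1_comp _ sin ( *%R c) x _ _ (is_derive_sin _) (is_derive_mul c x).
by rewrite mulrC.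
Qed.

Lemma is_derive_cosZ c x : is_derive x 1 (fun x => cos (c * x)) (- c * sin (c * x)).
Proof.
have := @is_derive1_comp _ cos ( *%R c) x _ _ (is_derive_cos _) (is_derive_mul c x).
by rewrite mulNr mulrC mulNr.
Qed.

Lemma continuous_sinZ c : continuous (fun x => sin (c * x)).
Proof.
move=> x; apply/differentiable_continuous/derivable1_diffP.
by have := is_derive_sinZ c x => -[].
Qed.

Lemma continuous_cosZ c : continuous (fun x => cos (c * x)).
Proof.
move=> x; apply/differentiable_continuous/derivable1_diffP.
by have := is_derive_cosZ c x => -[].
Qed.

Lemma sin_intpi k : sin (k%:~R * pi) = 0 :> R.
Proof.
have H (n : nat) : sin (n%:R * pi) = 0 :> R.
  elim: n => [|n IH]; first by rewrite mul0r sin0.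
  by rewrite -natr1 mulrDl mul1r sinDpi IH oppr0.
case: k => n; first exact: H.
by rewrite NegzE rmorphN/= mulNr sinN H oppr0.
Qed.

Lemma is_derive_scale (f : R -> R) c x df : is_derive x 1 f df ->
  is_derive x 1 (fun x => c * f x) (c * df).
Proof. by move=> H; have := is_deriveZ c H. Qed.

Lemma integral_cosZ k : k != 0 ->
  \int[leb]_(x in `[- pi, pi]) cos (k%:~R * x) = 0 :> R.
Proof.
move=> k0; have kr : k%:~R != 0 :> R by rewrite intr_eq0.
have dF x : is_derive x 1 (fun x => k%:~R^-1 * sin (k%:~R * x)) (cos (k%:~R * x)).
  have := is_derive_scale k%:~R^-1 (is_derive_sinZ k%:~R x).
  by rewrite mulKf.
rewrite (Rintegral_pi_FTC dF); last exact: continuous_cosZ.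
by rewrite mulrN sinN sin_intpi oppr0 subrr.
Qed.

Lemma Rintegral_pi_cst1 : \int[leb]_(x in `[- pi, pi]) 1 = pi *+ 2 :> R.
Proof.
have dF (x : R) : is_derive x 1 (@idfun R) 1 by exact: is_derive_id.
rewrite (Rintegral_pi_FTC dF); last exact: cst_continuous.
by rewrite opprK mulr2n.
Qed.

Lemma integral_sinZ k : \int[leb]_(x in `[- pi, pi]) sin (k%:~R * x) = 0 :> R.
Proof.
have [->|k0] := eqVneq k 0.
  have dF (x : R) : is_derive x 1 (cst 0 : R -> R) 0 by exact: is_derive_cst.
  rewrite (@eq_Rintegral _ _ _ leb _ (cst 0)); last by move=> x _; rewrite mul0r sin0.
  rewrite (Rintegral_pi_FTC dF) ?subrr//; exact: cst_continuous.
have kr : k%:~R != 0 :> R by rewrite intr_eq0.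
have dF x : is_derive x 1 (fun x => - k%:~R^-1 * cos (k%:~R * x)) (sin (k%:~R * x)).
  have := is_derive_scale (- k%:~R^-1) (is_derive_cosZ k%:~R x).
  by rewrite mulNr mulNr mulrN opprK mulKf.
rewrite (Rintegral_pi_FTC dF); last exact: continuous_sinZ.
by rewrite mulrN cosN subrr.
Qed.

(** The orthonormal basis of the circle: a constant for [k = 0], cosines for [k > 0],
    sines for [k < 0]. Numbering the sines by negative integers makes
    differentiation send [k] to [- k] up to the factor [k]. *)
Definition trig1 k x : R :=
  if k == 0 then (Num.sqrt (pi *+ 2))^-1
  else (Num.sqrt pi)^-1 * (if 0 < k then cos (k%:~R * x) else sin (k%:~R * x)).

Lemma is_derive_trig1 k x : is_derive x 1 (trig1 k) (k%:~R * trig1 (- k) x).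
Proof.
have [->|k0] := eqVneq k 0.
  by rewrite mul0r; rewrite /trig1 eqxx; exact: is_derive_cst.
rewrite /trig1 (negbTE k0) oppr_eq0 (negbTE k0) oppr_gt0.
have [kp|kn] := ltP 0 k.
  rewrite ltNge (ltW kp)/= mulrCA.
  have -> : k%:~R * sin ((- k)%:~R * x) = - k%:~R * sin (k%:~R * x) :> R.
    by rewrite rmorphN/= mulNr sinN mulrN mulNr.
  by apply: is_derive_scale; exact: is_derive_cosZ.
have kl : k < 0 by rewrite lt_def eq_sym k0.
rewrite kl mulrCA rmorphN/= mulNr cosN.
by apply: is_derive_scale; exact: is_derive_sinZ.
Qed.

Lemma continuous_trig1 k : continuous (trig1 k).
Proof.
move=> x; apply/differentiable_continuous/derivable1_diffP.
by have := is_derive_trig1 k x => -[].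
Qed.

Lemma trig1_periodic k x : trig1 k (x + pi *+ 2) = trig1 k x.
Proof.
rewrite /trig1; case: ifPn => // k0; rewrite mulrDr.
have H (n : nat) y : cos (y + n%:R * (pi *+ 2)) = cos y :> R /\
      sin (y + n%:R * (pi *+ 2)) = sin y :> R.
  elim: n => [|n [IH1 IH2]]; first by rewrite mul0r addr0.
  by rewrite -natr1 mulrDl mul1r addrA cosD2pi sinD2pi.
have Hz y : cos (y + k%:~R * (pi *+ 2)) = cos y :> R /\
      sin (y + k%:~R * (pi *+ 2)) = sin y :> R.
  case: (k) => n; first exact: H.
  rewrite NegzE rmorphN/=.
  have [<- <-] := H n.+1 (y + - n.+1%:~R * (pi *+ 2)).
  by rewrite mulNr subrK.
by have [-> ->] := Hz (k%:~R * x).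
Qed.

Lemma trig1_bounded k x : `|trig1 k x| <= (Num.sqrt (pi *+ 2))^-1 + (Num.sqrt pi)^-1.
Proof.
have p0 := @pi_gt0 R.
rewrite /trig1; case: ifPn => _.
  by rewrite ger0_norm ?invr_ge0 ?sqrtr_ge0// lerDl invr_ge0 sqrtr_ge0.
rewrite normrM (ger0_norm (x := (Num.sqrt pi)^-1)) ?invr_ge0 ?sqrtr_ge0//.
apply: (@le_trans _ _ (Num.sqrt pi)^-1); last by rewrite lerDr invr_ge0 sqrtr_ge0.
rewrite ler_piMr ?invr_ge0 ?sqrtr_ge0//.
by case: ifPn => _; [exact: cos_max|exact: sin_max].
Qed.

Lemma integrable_pi (f : R -> R) : continuous f ->
  leb.-integrable `[- pi, pi] (EFin \o f).
Proof.
move=> cf; apply: continuous_compact_integrable; first exact: segment_compact.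
exact: continuous_subspaceT.
Qed.

Lemma Rintegral_piZ c (f : R -> R) : continuous f ->
  \int[leb]_(x in `[- pi, pi]) (c * f x) = c * \int[leb]_(x in `[- pi, pi]) f x.
Proof. by move=> cf; rewrite RintegralZl//; exact: integrable_pi. Qed.

Lemma Rintegral_piD (f g : R -> R) : continuous f -> continuous g ->
  \int[leb]_(x in `[- pi, pi]) (f x + g x) =
  \int[leb]_(x in `[- pi, pi]) f x + \int[leb]_(x in `[- pi, pi]) g x.
Proof. by move=> cf cg; rewrite RintegralD//; exact: integrable_pi. Qed.

Let sq (x : R) : 0 < x -> (Num.sqrt x)^-1 * (Num.sqrt x)^-1 = x^-1.
Proof. by move=> x0; rewrite -invfM -expr2 sqr_sqrtr// ltW. Qed.

(** Product-to-sum formulas reduce the integral to those of [cos ((k +- l) x)]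
    and [sin ((k +- l) x)]. *)
Lemma trig1_ortho k l :
  \int[leb]_(x in `[- pi, pi]) (trig1 k x * trig1 l x) = (k == l)%:R.
Proof.
have p0 := @pi_gt0 R.
have p20 : 0 < pi *+ 2 :> R by rewrite pmulrn_rgt0.
have p2n : pi *+ 2 != 0 :> R by rewrite gt_eqF.
have ctb := continuous_trig1.
wlog : k l / k == 0 \/ l != 0.
  move=> H; have [|k0] := boolP (k == 0); first by move=> ?; apply: H; left.
  have [/eqP l0|] := boolP (l == 0); last by move=> ?; apply: H; right.
  rewrite eq_sym -H; last by left; rewrite l0.
  by apply: eq_Rintegral => x _; rewrite mulrC.
have C0 m : m != 0 -> \int[leb]_(x in `[- pi, pi]) trig1 m x = 0.
  move=> m0.
  have E x : trig1 m x = (Num.sqrt pi)^-1 * (if 0 < m then cos (m%:~R *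
    x) else sin (m%:~R * x)).
    by rewrite /trig1 (negbTE m0).
  under eq_Rintegral do rewrite E.
  case: (0 < m).
    by rewrite Rintegral_piZ ?integral_cosZ ?mulr0//; exact: continuous_cosZ.
  by rewrite Rintegral_piZ ?integral_sinZ ?mulr0//; exact: continuous_sinZ.
have [/eqP -> _|k0 [//|l0]] := boolP (k == 0).
  have E x : trig1 0 x = (Num.sqrt (pi *+ 2))^-1 by rewrite /trig1 eqxx.
  under eq_Rintegral do rewrite E.
  rewrite Rintegral_piZ//; have [->|l0] := eqVneq l 0.
    rewrite (@eq_Rintegral _ _ _ leb _ (fun x => (Num.sqrt (pi *+ 2))^-1 * 1)).
      rewrite Rintegral_piZ; last exact: cst_continuous.
      by rewrite Rintegral_pi_cst1 mulrA sq// mulVf// gt_eqF.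
    by move=> x _; rewrite E mulr1.
  by rewrite C0// mulr0.
have sqp : (Num.sqrt pi)^-1 * (Num.sqrt pi)^-1 = pi^-1 :> R by exact: sq.
have IC m : \int[leb]_(x in `[- pi, pi]) cos (m%:~R * x) = (m == 0)%:R * (pi *+ 2).
  have [->|m0] := eqVneq m 0; last by rewrite integral_cosZ// mul0r.
  rewrite (@eq_Rintegral _ _ _ leb _ (cst 1)) ?Rintegral_pi_cst1 ?mul1r// => x _.
  by rewrite mul0r cos0.
have sE (g h : R -> R) c : continuous g -> continuous h ->
    (forall x, trig1 k x * trig1 l x = (pi *+ 2)^-1 * (g x + c * h x)) ->
    \int[leb]_(x in `[- pi, pi]) (trig1 k x * trig1 l x) =
    (pi *+ 2)^-1 * (\int[leb]_(x in `[- pi, pi]) g x +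
      c * \int[leb]_(x in `[- pi, pi]) h x).
  move=> cg ch E; under eq_Rintegral do rewrite E.
  have cch : continuous (fun x => c * h x).
    by move=> x; apply: cvgM; [exact: cvg_cst|exact: ch].
  rewrite Rintegral_piZ; last by move=> x; apply: cvgD; [exact: cg|exact: cch].
  by rewrite Rintegral_piD// Rintegral_piZ.
have ck m := @continuous_cosZ m%:~R; have sk m := @continuous_sinZ m%:~R.
have pE : pi^-1 = (pi *+ 2)^-1 * 2 :> R.
  by rewrite -[pi *+ 2]mulr_natr invfM mulfVK ?pnatr_eq0.
have [kp|kn] := ltP 0 k; have [lp|ln] := ltP 0 l.
- rewrite (sE (fun x => cos ((k - l)%:~R * x)) (fun x => cos ((k + l)%:~R * x)) 1)//.
    rewrite !IC (_ : k + l == 0 = false) ?mul0r ?mulr0 ?addr0; last lia.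
    by rewrite subr_eq0 mulrCA mulVf// mulr1.
  move=> x; rewrite /trig1 (negbTE k0) (negbTE l0) kp lp.
  rewrite mulrACA sqp pE rmorphB rmorphD/= mulrBl mulrDl cosB cosD; ring.
- have ln' : (0 < l) = false by apply/negbTE; rewrite -leNgt.
  rewrite (sE (fun x => sin ((k + l)%:~R * x)) (fun x => sin ((k - l)%:~R * x)) (-1))//.
    rewrite !integral_sinZ (_ : k == l = false) ?mulr0 ?addr0 ?mulr0//; lia.
  move=> x; rewrite /trig1 (negbTE k0) (negbTE l0) kp ln'.
  rewrite mulrACA sqp pE rmorphB rmorphD/= mulrBl mulrDl sinB sinD; ring.
- have kn' : (0 < k) = false by apply/negbTE; rewrite -leNgt.
  rewrite (sE (fun x => sin ((k + l)%:~R * x)) (fun x => sin ((k - l)%:~R * x)) 1)//.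
    rewrite !integral_sinZ (_ : k == l = false) ?mulr0 ?addr0 ?mulr0//; lia.
  move=> x; rewrite /trig1 (negbTE k0) (negbTE l0) lp kn'.
  rewrite mulrACA sqp pE rmorphB rmorphD/= mulrBl mulrDl sinB sinD; ring.
- have ln' : (0 < l) = false by apply/negbTE; rewrite -leNgt.
  have kn' : (0 < k) = false by apply/negbTE; rewrite -leNgt.
  rewrite (sE (fun x => cos ((k - l)%:~R * x)) (fun x => cos ((k + l)%:~R * x)) (-1))//.
    rewrite !IC (_ : k + l == 0 = false) ?mul0r ?mulr0 ?addr0; last lia.
    by rewrite subr_eq0 mulrCA mulVf// mulr1.
  move=> x; rewrite /trig1 (negbTE k0) (negbTE l0) kn' ln'.
  rewrite mulrACA sqp pE rmorphB rmorphD/= mulrBl mulrDl cosB cosD; ring.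
Qed.

End one_dim.

(** * Complex exponentials and the real basis *)

Section trig_polynomials.
Context (R : realType).

(** The frequency encoded by an ordinal [0 <= z <= 2N]. *)
Definition ord_freq (N : nat) (z : 'I_(N.*2).+1) : int := z%:Z - N%:Z.

Lemma ord_freq_intr N z : (@ord_freq N z)%:~R = z%:R - N%:R :> R.
Proof. by rewrite /ord_freq rmorphB/= -!pmulrn. Qed.

Lemma ord_freq_rev N z : ord_freq (rev_ord z) = - @ord_freq N z.
Proof. by rewrite /ord_freq /= subSS; have := ltn_ord z; lia. Qed.

Let sum_delta2 (T : finType) (w w' : T) (a b : R[i]) (E : T -> R[i]) :
  \sum_z ((z == w)%:R * a + (z == w')%:R * b) * E z = a * E w + b * E w'.
Proof.
under eq_bigr do rewrite mulrDl.
have S u c : \sum_z (z == u)%:R * c * E z = c * E u.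
  rewrite (bigD1 u)//= big1 ?addr0 ?eqxx ?mul1r//.
  by move=> z /negbTE ->; rewrite !mul0r.
by rewrite big_split/= !S.
Qed.

(** Euler formulas: only the exponentials of frequencies [k] and [- k] occur. *)
Lemma trig1_expi N (w : 'I_(N.*2).+1) : exists g : 'I_(N.*2).+1 -> R[i],
  forall x : R, ((trig1 (ord_freq w) x)%:C)%C = \sum_z g z * expi ((z%:R - N%:R) * x).
Proof.
have rw : (rev_ord w)%:R - N%:R = - (w%:R - N%:R) :> R.
  by rewrite -!ord_freq_intr ord_freq_rev rmorphN.
pose s : R := (Num.sqrt pi)^-1.
have [w0|w0] := eqVneq (ord_freq w) 0.
  exists (fun z => (z == w)%:R * ((Num.sqrt (pi *+ 2))^-1)%:C%C + (z == w)%:R * 0) => x.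
  rewrite sum_delta2 -ord_freq_intr w0 mul0r mul0r addr0 /trig1 eqxx /expi cos0 sin0.
  by apply/eqP; rewrite eq_complex/= mulr1 !mulr0 mul0r subr0 addr0 !eqxx.
have [wp|wn] := ltP 0 (ord_freq w).
  exists (fun z => (z == w)%:R * (s / 2)%:C%C + (z == rev_ord w)%:R * (s / 2)%:C%C) => x.
  rewrite sum_delta2 rw mulNr -ord_freq_intr /trig1 (negbTE w0) wp /expi cosN sinN.
  apply/eqP; rewrite eq_complex/=; apply/andP; split; apply/eqP; rewrite /s; field.
    by rewrite gt_eqF// sqrtr_gt0 pi_gt0.
  by rewrite gt_eqF// sqrtr_gt0 pi_gt0.
exists (fun z => (z == w)%:R * (0 -i* (s / 2))%C +
  (z == rev_ord w)%:R * (0 +i* (s / 2))%C) => x.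
rewrite sum_delta2 rw mulNr -ord_freq_intr /trig1 (negbTE w0) ltNge wn /= /expi cosN sinN.
apply/eqP; rewrite eq_complex/=; apply/andP; split; apply/eqP; rewrite /s; field.
  by rewrite gt_eqF// sqrtr_gt0 pi_gt0.
by rewrite gt_eqF// sqrtr_gt0 pi_gt0.
Qed.

(** The converse of [trig1_expi], by the definition of the exponential. *)
Lemma expi_trig1 N (z : 'I_(N.*2).+1) : exists g : 'I_(N.*2).+1 -> R[i],
  forall x : R, expi ((z%:R - N%:R) * x) = \sum_w g w * ((trig1 (ord_freq w) x)%:C)%C.
Proof.
pose s : R := Num.sqrt pi.
have s0 : s != 0 by rewrite gt_eqF// sqrtr_gt0 pi_gt0.
have [z0|z0] := eqVneq (ord_freq z) 0.
  exists (fun w => (w == z)%:R * (Num.sqrt (pi *+ 2))%:C%C + (w == z)%:R * 0) => x.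
  rewrite sum_delta2 -ord_freq_intr z0 mul0r mul0r addr0 /trig1 eqxx /expi cos0 sin0.
  apply/eqP; rewrite eq_complex/= mulr0 mul0r subr0 mulr0 addr0 eqxx andbT.
  by rewrite mulfV// gt_eqF// sqrtr_gt0 pmulrn_rgt0// pi_gt0.
have rz0 : - ord_freq z == 0 = false by rewrite oppr_eq0; apply/negbTE.
have [zp|zn] := ltP 0 (ord_freq z).
  exists (fun w => (w == z)%:R * s%:C%C + (w == rev_ord z)%:R * (0 -i* s)%C) => x.
  rewrite sum_delta2 ord_freq_rev -ord_freq_intr /trig1 (negbTE z0) zp rz0 oppr_gt0
    ltNge (ltW zp)/=.
  rewrite /expi rmorphN/= mulNr sinN -/s.
  by apply/eqP; rewrite eq_complex/=; apply/andP; split; apply/eqP; field.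
have zl : ord_freq z < 0 by rewrite lt_neqAle z0.
exists (fun w => (w == z)%:R * (0 +i* s)%C + (w == rev_ord z)%:R * s%:C%C) => x.
rewrite sum_delta2 ord_freq_rev -ord_freq_intr /trig1 (negbTE z0) rz0 oppr_gt0 ltNge zn
  zl/=.
rewrite /expi rmorphN/= mulNr cosN -/s.
by apply/eqP; rewrite eq_complex/=; apply/andP; split; apply/eqP; field.
Qed.

Lemma expiD (a b : R) : expi (a + b) = expi a * expi b.
Proof.
rewrite /expi cosD sinD; apply/eqP; rewrite eq_complex/= eqxx.
by rewrite addrC eqxx.
Qed.

Lemma expi_sum (T : finType) (F : T -> R) : expi (\sum_i F i) = \prod_i expi (F i).
Proof.
apply: (big_morph (@expi R) expiD).
by rewrite /expi cos0 sin0.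
Qed.

Context (n : nat).
Local Notation rV := 'rV[R]_n.

Definition trign (k : {ffun 'I_n -> int}) (v : rV) : R := \prod_j trig1 (k j) (v ord0 j).

Definition ffun_freq N (z : {ffun 'I_n -> 'I_(N.*2).+1}) : {ffun 'I_n -> int} :=
  [ffun j => ord_freq (z j)].

Lemma expi_freq N (z : {ffun 'I_n -> 'I_(N.*2).+1}) (v : rV) :
  expi (dotv (freq R z) v) = \prod_j expi (((z j)%:R - N%:R) * v ord0 j).
Proof. by rewrite /dotv expi_sum; apply: eq_bigr => j _; rewrite mxE. Qed.

(** Real trigonometric polynomials have real coefficients in the basis of sines and
    cosines. Each exponential [e^(i k.v)] is a product over the coordinates, so the
    one-variable change of basis is distributed over the product; the imaginary
    parts of the coefficients so obtained are discarded. *)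
Lemma trig_polyP N (g : rV -> R) : trig_poly N g <->
  exists x : {ffun 'I_n -> 'I_(N.*2).+1} -> R, forall v, g v =
    \sum_z x z * trign (ffun_freq z) v.
Proof.
split.
- move=> [c gc].
  have /choice[G HG] := @expi_trig1 N.
  pose X (z : {ffun 'I_n -> 'I_(N.*2).+1}) := \sum_k c k * \prod_j G (k j) (z j).
  exists (fun z => complex.Re (X z)) => v.
  have : (g v)%:C%C = \sum_z X z * (trign (ffun_freq z) v)%:C%C.
    rewrite gc; transitivity (\sum_k c k * \sum_(z : {ffun 'I_n ->
      'I_(N.*2).+1}) (\prod_j G (k j) (z j)) * (trign (ffun_freq z) v)%:C%C).
      apply: eq_bigr => k _; congr (_ * _); rewrite expi_freq.
      under eq_bigr do rewrite HG.
      rewrite bigA_distr_bigA/=; apply: eq_bigr => z _.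
      rewrite big_split/=; congr (_ * _).
      by rewrite /trign rmorph_prod/=; apply: eq_bigr => j _; rewrite ffunE.
    rewrite /X; under [RHS]eq_bigr do rewrite mulr_suml.
    rewrite exchange_big/=; apply: eq_bigr => k _.
    by rewrite mulr_sumr; apply: eq_bigr => z _; rewrite mulrA.
  move=> /(congr1 (@complex.Re R)) /= ->.
  rewrite (big_morph (@complex.Re R) (id1 := 0) (op1 := +%R))//;
    last by move=> [a b] [a' b'].
  by apply: eq_bigr => z _; case: (X z) => a b /=; rewrite mulr0 subr0.
- move=> [x gx].
  have /choice[G HG] := @trig1_expi N.
  exists (fun k => \sum_(z : {ffun 'I_n ->
    'I_(N.*2).+1}) (x z)%:C%C * \prod_j G (z j) (k j)) => v.
  rewrite gx rmorph_sum/=; under [RHS]eq_bigr do rewrite mulr_suml.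
  rewrite [RHS]exchange_big/=; apply: eq_bigr => z _; rewrite rmorphM/=.
  under [RHS]eq_bigr do rewrite -mulrA.
  rewrite -mulr_sumr; congr (_ * _).
  rewrite /trign rmorph_prod/=.
  transitivity (\prod_j \sum_w G (z j) w * expi ((w%:R - N%:R) * v ord0 j)).
    by apply: eq_bigr => j _; rewrite ffunE HG.
  rewrite bigA_distr_bigA/=; apply: eq_bigr => k _.
  by rewrite big_split/= expi_freq.
Qed.

End trig_polynomials.

(** * The orthonormal basis of the torus and its derivatives *)

Section basis.
Context (R : realType) (n : nat).
Local Notation L := (lebesgue_rV R n).
Local Notation rV := 'rV[R]_n.
Local Notation box := (@box R n).
Local Notation trign := (@trign R n).
Implicit Types (k l : {ffun 'I_n -> int}).

Lemma measurable_trig1 (m : int) : measurable_fun setT (@trig1 R m).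
Proof. by apply: continuous_measurable_fun; exact: continuous_trig1. Qed.

Lemma measurable_trign k : measurable_fun setT (trign k).
Proof.
apply: measurable_prod => j _.
exact: (measurableT_comp (measurable_trig1 _) (measurable_coord j)).
Qed.

Lemma trign_bounded k v :
  `|trign k v| <= ((Num.sqrt (pi *+ 2))^-1 + (Num.sqrt pi)^-1) ^+ n.
Proof.
rewrite normr_prod; apply: (@le_trans _ _ (\prod_(j < n)
  ((Num.sqrt (pi *+ 2))^-1 + (Num.sqrt pi)^-1))).
  by apply: ler_prod => j _; rewrite normr_ge0 trig1_bounded.
by rewrite prodr_const card_ord.
Qed.

Lemma L2box_trign k : L2box (trign k).
Proof. by apply: L2box_bounded (measurable_trign k) _ => v _; exact: trign_bounded. Qed.

Lemma periodic_trign k : Defs.periodic (trign k).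
Proof.
move=> v i; apply: eq_bigr => j _; rewrite !mxE eqxx /=.
case: eqP => _; last by rewrite mulr0 addr0.
by rewrite mulr1 trig1_periodic.
Qed.

Lemma inner_trign k l : inner (trign k) (trign l) = (k == l)%:R.
Proof.
have [|_] := @integrable_Rintegral_box R n (fun j x => trig1 (k j) x * trig1 (l j) x).
  move=> j; apply: integrable_pi => x.
  by apply: cvgM; exact: continuous_trig1.
under eq_Rintegral do rewrite big_split/=.
move=> E; transitivity (\prod_j (k j == l j)%:R : R).
  by under eq_bigr do rewrite -trig1_ortho; rewrite -E.
have [->|kl] := eqVneq k l; first by rewrite big1// => j _; rewrite eqxx.
have [j kj] : exists j, k j != l j.
  apply/existsP; apply: contraNT kl; rewrite negb_exists => /forallP H.
  by apply/eqP/ffunP => j; apply/eqP; rewrite -[_ == _]negbK; exact: H.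
by rewrite (bigD1 j)//= (negbTE kj) mul0r.
Qed.

(** Differentiating in [v_i] exchanges cosines and sines of that variable. *)
Definition flip (i : 'I_n) k : {ffun 'I_n -> int} :=
  [ffun j => if j == i then - k j else k j].

Lemma continuous_trign k : continuous (trign k).
Proof.
have cj j : continuous (fun v : rV => trig1 (k j) (v ord0 j)).
  move=> v; apply: (@continuous_comp _ _ _ (fun v : rV => v ord0 j) (trig1 (k j))).
    exact: coord_continuous.
  exact: continuous_trig1.
rewrite /trign; elim: (index_enum _) => [|j s IH].
  by rewrite (_ : (fun _ => _) = cst 1); [exact: cst_continuous|apply/funext => v;
    rewrite big_nil].
rewrite (_ : (fun _ => _) = fun v : rV => trig1 (k j) (v ord0 j) *
  \prod_(i <- s) trig1 (k i) (v ord0 i)).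
  by move=> v; exact: (continuousM (cj j v) (IH v)).
by apply/funext => v; rewrite big_cons.
Qed.

Lemma is_derive_trign k i v :
  is_derive v (delta_mx ord0 i) (trign k) ((k i)%:~R * trign (flip i k) v).
Proof.
pose P := \prod_(j | j != i) trig1 (k j) (v ord0 j).
have E (h : R) : trign k (h *: delta_mx ord0 i + v) = P * trig1 (k i) (h + v ord0 i).
  rewrite /trign (bigD1 i)//= mulrC; congr (_ * trig1 _ _).
    apply: eq_bigr => j ji; rewrite !mxE eqxx (negbTE ji) mulr0 add0r//.
  by rewrite !mxE !eqxx mulr1.
have E' : trign (flip i k) v = P * trig1 (- k i) (v ord0 i).
  rewrite /trign (bigD1 i)//= mulrC ffunE eqxx; congr (_ * _).
  by apply: eq_bigr => j ji; rewrite ffunE (negbTE ji).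
have [dt vt] := is_derive_scale P (is_derive_trig1 (k i) (v ord0 i)).
(* Along the line v + h e_i the other factors are constant. *)
have eqf : (fun h : R => h^-1 *: ((trign k \o shift v) (h *: delta_mx ord0 i) -
  trign k v)) =
   (fun h : R => h^-1 *: (((fun x => P * trig1 (k i) x) \o shift (v ord0 i)) (h *: 1) -
     P * trig1 (k i) (v ord0 i))).
  apply/funext => h /=; rewrite E -[trign k v]/(trign k v) -[v in X in _ *: (_ - X)]add0r.
  by rewrite -(scale0r (delta_mx ord0 i)) E add0r -[h *: 1]/(h * 1) mulr1.
split.
  by move: dt; rewrite /derivable /= -eqf.
by move: vt; rewrite /derive -eqf E' mulrCA => <-.
Qed.

Lemma pderiv_trign k i c : pderiv i (fun v => c * trign k v) =
  fun v => (c * (k i)%:~R) * trign (flip i k) v.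
Proof.
apply/funext => v; rewrite /pderiv.
have [d1 d2] := is_deriveZ c (is_derive_trign k i v).
by rewrite -mulrA; exact: d2.
Qed.

Lemma derivable_trign k i c v : derivable (fun v => c * trign k v) v (delta_mx ord0 i).
Proof. by have [d1 d2] := is_deriveZ c (is_derive_trign k i v). Qed.

Lemma foldr_pderiv_trign k s : exists c k', foldr (@pderiv R n) (trign k) s =
  fun v => c * trign k' v.
Proof.
elim: s => [|i s [c [k' IH]]] /=.
  by exists 1, k; apply/funext => v; rewrite mul1r.
by rewrite IH pderiv_trign; eexists; eexists.
Qed.

Lemma smooth_trign k : smooth (trign k).
Proof.
move=> s; have [c [k' ->]] := foldr_pderiv_trign k s; split.
  move=> v; apply: (@continuous_comp _ _ _ (trign k') ( *%R c)).
    exact: continuous_trign.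
  exact: mulrl_continuous.
by move=> v i; exact: derivable_trign.
Qed.

(** Differentiation acts on the basis by a scalar and a change of index; only
    the absolute value of the scalar matters for norms. *)
Lemma foldr_pderiv_nseq k j r : exists2 c, `|c| = `|(k j)%:~R| ^+ r &
  foldr (@pderiv R n) (trign k) (nseq r j) = fun v => c * trign (iter r (flip j) k) v.
Proof.
elim: r => [|r [c cE IH]] /=.
  by exists 1; [rewrite normr1 expr0|apply/funext => v; rewrite mul1r].
rewrite IH pderiv_trign; eexists; last by [].
rewrite normrM cE exprSr; congr (_ * _).
elim: (r) => [//|r' IH'] /=.
by rewrite ffunE eqxx rmorphN/= normrN.
Qed.

(** The multi-index of the [r]-th derivative in the single direction [j]. *)
Definition pure_mi (r : nat) (j : 'I_n) : multi_index n r :=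
  [ffun i => if i == j then ord_max else ord0].

Lemma mi_order_pure r j : mi_order (pure_mi r j) = r.
Proof.
rewrite /mi_order (bigD1 j)//= big1 ?addn0 ?ffunE ?eqxx// => i ij.
by rewrite ffunE (negbTE ij).
Qed.

Lemma mderiv_pure r j (f : rV -> R) :
  mderiv (pure_mi r j) f = foldr (@pderiv R n) f (nseq r j).
Proof.
rewrite /mderiv; congr (foldr _ _ _).
set s := flatten _.
have sz : size s = r.
  rewrite /s size_flatten /shape -map_comp sumnE big_map.
  rewrite -[RHS](mi_order_pure r j) /mi_order big_enum/=.
  by apply: eq_bigr => i _; rewrite size_nseq.
have /all_pred1P -> : all (pred1 j) s; last by rewrite sz.
apply/allP => x /flattenP[t /mapP[i _ ->]]; rewrite mem_nseq ffunE.
by case: eqP => [->|_] //= /andP[_ /eqP ->].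
Qed.

Lemma mderiv_zero r (a : multi_index n r) (f : rV -> R) :
  mi_order a = 0%N -> mderiv a f = f.
Proof.
move=> a0; rewrite /mderiv (_ : flatten _ = [::])//.
apply/eqP; rewrite -size_eq0 size_flatten /shape -map_comp sumnE big_map.
rewrite -[X in _ == X]a0 /mi_order big_enum/=; apply/eqP.
by apply: eq_bigr => i _; rewrite size_nseq.
Qed.

Definition freqs (N : nat) : seq {ffun 'I_n -> int} :=
  [seq ffun_freq z | z <- index_enum {ffun 'I_n -> 'I_(N.*2).+1}].

Lemma ord_freq_inj N : injective (@ord_freq N).
Proof. by move=> z w; rewrite /ord_freq => /addIr []/val_inj. Qed.

Lemma ffun_freq_inj N : injective (@ffun_freq n N).
Proof.
move=> z w /ffunP zw; apply/ffunP => j; have := zw j; rewrite !ffunE.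
exact: ord_freq_inj.
Qed.

Lemma uniq_freqs N : uniq (freqs N).
Proof. by rewrite map_inj_uniq ?index_enum_uniq//; exact: ffun_freq_inj. Qed.

Lemma mem_freqs N k : (k \in freqs N) = [forall j, (absz (k j) <= N)%N].
Proof.
apply/mapP/forallP => [[z _ ->] j|kN].
  rewrite ffunE /ord_freq; move: (nat_of_ord (z j)) (ltn_ord (z j)) => m mN.
  case: (leqP N m) => h; [rewrite subzn//|rewrite distnC subzn ?(ltnW h)//] => /=; lia.
have kb j : 0 <= k j + N%:Z /\ k j + N%:Z <= (N.*2)%:Z.
  have : `|k j| <= N%:Z by rewrite -abszE lez_nat kN.
  by rewrite ler_norml; lia.
have b j : (absz (k j + N%:Z)%R < (N.*2).+1)%N.
  by rewrite ltnS -lez_nat gez0_abs; have [? ?] := kb j.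
exists [ffun j => Ordinal (b j)]; first exact: mem_index_enum.
apply/ffunP => j; rewrite !ffunE /ord_freq /= gez0_abs ?addrK//.
by have [] := kb j.
Qed.

Lemma trig_poly_freqs N (g : rV -> R) : trig_poly N g <->
  exists x, forall v, g v = \sum_(k <- freqs N) x k * trign k v.
Proof.
split => [/trig_polyP[x gx]|[x gx]].
  exists (fun k => \sum_z (ffun_freq z == k)%:R * x z) => v.
  rewrite big_map gx; apply: eq_bigr => z _; congr (_ * _).
  rewrite (bigD1 z)//= eqxx mul1r big1 ?addr0// => w wz.
  by rewrite (inj_eq (@ffun_freq_inj N)) (negbTE wz) mul0r.
by apply/trig_polyP; exists (fun z => x (ffun_freq z)) => v; rewrite gx big_map.
Qed.

Definition trig_proj N (f : rV -> R) v := \sum_(k <- freqs N) inner f (trign k) * trign k v.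

End basis.

(** * The algebra of trigonometric polynomials *)

Section trig_algebra.
Context (R : realType) (n : nat).
Local Notation rV := 'rV[R]_n.

Lemma trig_poly_scale N (c : R) (g : rV -> R) :
  trig_poly N g -> trig_poly N (fun v => c * g v).
Proof.
move=> /trig_polyP[x gx]; apply/trig_polyP; exists (fun z => c * x z) => v.
by rewrite gx mulr_sumr; apply: eq_bigr => z _; rewrite mulrA.
Qed.

Lemma trig_poly_add N (g h : rV -> R) :
  trig_poly N g -> trig_poly N h -> trig_poly N (fun v => g v + h v).
Proof.
move=> /trig_polyP[x gx] /trig_polyP[y hy]; apply/trig_polyP.
exists (fun z => x z + y z) => v.
by rewrite gx hy -big_split/=; apply: eq_bigr => z _; rewrite mulrDl.
Qed.

(** Exponentials multiply by adding frequencies. *)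
Lemma trig_poly_mul N M (g h : rV -> R) :
  trig_poly N g -> trig_poly M h -> trig_poly (N + M) (fun v => g v * h v).
Proof.
move=> [c gc] [c' hc'].
have lt (a : 'I_(N.*2).+1) (b : 'I_(M.*2).+1) : (a + b < ((N + M).*2).+1)%N.
  by rewrite doubleD ltnS leq_add// -ltnS.
(* Shifted frequencies add up without correction: (k + N) + (l + M) = (k + l) + (N + M). *)
pose p (k : {ffun 'I_n -> 'I_(N.*2).+1}) (l : {ffun 'I_n -> 'I_(M.*2).+1}) :
  {ffun 'I_n -> 'I_((N + M).*2).+1} := [ffun j => Ordinal (lt (k j) (l j))].
have fp k l : freq R (p k l) = freq R k + freq R l.
  by apply/rowP => j; rewrite !mxE ffunE/= !natrD; ring.
have dD (u w v : rV) : dotv (u + w) v = dotv u v + dotv w v.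
  by rewrite /dotv -big_split/=; apply: eq_bigr => j _; rewrite mxE mulrDl.
exists (fun m => \sum_k \sum_l (p k l == m)%:R * (c k * c' l)) => v.
rewrite rmorphM/= gc hc' mulr_suml.
under [RHS]eq_bigr do rewrite mulr_suml.
rewrite [RHS]exchange_big/=; apply: eq_bigr => k _.
rewrite mulr_sumr; under [RHS]eq_bigr do rewrite mulr_suml.
rewrite [RHS]exchange_big/=; apply: eq_bigr => l _.
rewrite (bigD1 (p k l))//= big1 ?addr0 ?eqxx ?mul1r.
  by rewrite fp dD expiD; ring.
by move=> m /negbTE; rewrite eq_sym => ->; rewrite !mul0r.
Qed.

Lemma trig_poly_trign N (k : {ffun 'I_n -> int}) : [forall j, (absz (k j) <= N)%N] ->
  trig_poly N (@trign R n k).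
Proof.
rewrite -mem_freqs => kN; apply/trig_poly_freqs; exists (fun l => (l == k)%:R) => v.
rewrite (bigD1_seq k)//=; last exact: uniq_freqs.
rewrite eqxx mul1r big1 ?addr0// => l /negbTE ->.
by rewrite mul0r.
Qed.

Let sqrt_neq0 (x : R) : 0 < x -> Num.sqrt x != 0.
Proof. by move=> x0; rewrite gt_eqF// sqrtr_gt0. Qed.

Lemma trig_poly_cst N (c : R) : trig_poly N (fun _ : rV => c).
Proof.
have p0 : Num.sqrt (pi *+ 2) != 0 :> R.
  by rewrite sqrt_neq0// pmulrn_rgt0// pi_gt0.
have := @trig_poly_scale N (c * (Num.sqrt (pi *+ 2)) ^+ n) _
  (@trig_poly_trign N [ffun=> 0] _).
rewrite (_ : (fun _ : rV => _) = (fun _ => c)); last first.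
  apply/funext => v; rewrite /trign; under eq_bigr do rewrite ffunE /trig1 eqxx.
  rewrite prodr_const card_ord -mulrA exprVn mulfV ?mulr1//.
  by rewrite expf_neq0.
by apply; apply/forallP => j; rewrite ffunE.
Qed.

Lemma trig_poly_mono N M (g : rV -> R) : (N <= M)%N -> trig_poly N g -> trig_poly M g.
Proof.
move=> NM Ng; have := trig_poly_mul Ng (trig_poly_cst (M - N) 1).
by rewrite subnKC// (_ : (fun v => _) = g)//; apply/funext => v; rewrite mulr1.
Qed.

Let delta_freq (i : 'I_n) (m : int) : {ffun 'I_n -> int} :=
  [ffun j => if j == i then m else 0].

Lemma trig_poly_coord (m : int) i : (absz m <= 1)%N ->
  trig_poly 1 (fun v : rV => trig1 m (v ord0 i)).
Proof.
move=> m1.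
have p0 : Num.sqrt (pi *+ 2) != 0 :> R.
  by rewrite sqrt_neq0// pmulrn_rgt0// pi_gt0.
have := @trig_poly_scale 1 ((Num.sqrt (pi *+ 2)) ^+ n.-1) _
  (@trig_poly_trign 1 (delta_freq i m) _).
rewrite (_ : (fun _ : rV => _) = (fun v => trig1 m (v ord0 i))); last first.
  apply/funext => v; rewrite /trign (bigD1 i)//= ffunE eqxx.
  rewrite (eq_bigr (fun=> (Num.sqrt (pi *+ 2))^-1)); last first.
    by move=> j ji; rewrite ffunE (negbTE ji) /trig1 eqxx.
  rewrite prodr_const mulrCA cardC1 card_ord exprVn mulfV ?mulr1//.
  by rewrite expf_neq0.
by apply; apply/forallP => j; rewrite ffunE; case: ifP.
Qed.

Lemma trig_poly_cos i : trig_poly 1 (fun v : rV => cos (v ord0 i)).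
Proof.
have p0 : Num.sqrt pi != 0 :> R by rewrite sqrt_neq0// pi_gt0.
have := @trig_poly_scale 1 (Num.sqrt pi) _ (@trig_poly_coord 1 i isT).
rewrite (_ : (fun _ : rV => _) = (fun v => cos (v ord0 i)))//.
by apply/funext => v; rewrite /trig1 /= mulrA mulfV// !mul1r.
Qed.

Lemma trig_poly_sin i : trig_poly 1 (fun v : rV => sin (v ord0 i)).
Proof.
have p0 : Num.sqrt pi != 0 :> R by rewrite sqrt_neq0// pi_gt0.
have := @trig_poly_scale 1 (- Num.sqrt pi) _ (@trig_poly_coord (-1) i isT).
rewrite (_ : (fun _ : rV => _) = (fun v => sin (v ord0 i)))//.
by apply/funext => v; rewrite /trig1 /= mulrA mulNr mulfV// rmorphN/= !mulN1r sinN opprK.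
Qed.

Lemma trig_poly_periodic N (g : rV -> R) : trig_poly N g -> Defs.periodic g.
Proof.
move=> /trig_polyP[x gx] v i; rewrite !gx; apply: eq_bigr => z _.
by rewrite periodic_trign.
Qed.

Lemma trig_poly_L2box N (g : rV -> R) : trig_poly N g -> L2box g.
Proof.
move=> /trig_polyP[x gx].
apply: (@L2box_ext _ _ (fun v => \sum_z x z * trign (ffun_freq z) v));
  last by move=> v; rewrite gx.
by apply: L2box_sum => z; exact: L2box_trign.
Qed.

Definition trigp (g : rV -> R) := exists N, trig_poly N g.

Lemma trigp_cst c : trigp (fun=> c). Proof. by exists 0%N; exact: trig_poly_cst. Qed.

Lemma trigp_scale c g : trigp g -> trigp (fun v => c * g v).
Proof. by move=> [N Ng]; exists N; exact: trig_poly_scale. Qed.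

Lemma trigp_add g h : trigp g -> trigp h -> trigp (fun v => g v + h v).
Proof.
move=> [N Ng] [M Mh]; exists (maxn N M).
apply: trig_poly_add.
  exact: (trig_poly_mono (leq_maxl N M) Ng).
exact: (trig_poly_mono (leq_maxr N M) Mh).
Qed.

Lemma trigp_mul g h : trigp g -> trigp h -> trigp (fun v => g v * h v).
Proof. by move=> [N Ng] [M Mh]; exists (N + M)%N; exact: trig_poly_mul. Qed.

Lemma trigp_exp g m : trigp g -> trigp (fun v => g v ^+ m).
Proof.
move=> Tg; elim: m => [|m IH]; first exact: trigp_cst.
by have := trigp_mul Tg IH; congr trigp; apply/funext => v; rewrite exprS.
Qed.

Lemma trigp_cos i : trigp (fun v => cos (v ord0 i)).
Proof. by exists 1%N; exact: trig_poly_cos. Qed.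

Lemma trigp_sin i : trigp (fun v => sin (v ord0 i)).
Proof. by exists 1%N; exact: trig_poly_sin. Qed.

Lemma trigp_L2box g : trigp g -> L2box g.
Proof. by move=> [N]; exact: trig_poly_L2box. Qed.

End trig_algebra.

(** * Polynomial approximations of a step *)

Section softstep.
Context (R : realType).

(** These polynomials converge on [[0, 1]] to the indicator of [w < 1/2]: with
    [K = m 4^m], the quantity [K w^(2m) = m (2w)^(2m)] tends to 0 if [2w < 1], and
    tends to infinity if [2w >= 1]. *)
Definition softstep (m : nat) (w : R) : R := (1 - w ^+ m.*2) ^+ (m * 4 ^ m).

Lemma softstep_itv m w : 0 <= w <= 1 -> 0 <= softstep m w <= 1.
Proof.
move=> /andP[w0 w1]; have a0 : 0 <= w ^+ m.*2 <= 1 by rewrite exprn_ge0//= exprn_ile1.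
by rewrite /softstep exprn_ge0 ?exprn_ile1//=; lra.
Qed.

Lemma bernoulli_ge (a : R) K : 0 <= a -> 1 + K%:R * a <= (1 + a) ^+ K.
Proof.
move=> a0; elim: K => [|K IH]; first by rewrite mul0r addr0 expr0.
rewrite exprS; apply: (@le_trans _ _ ((1 + a) * (1 + K%:R * a))).
  rewrite -natr1; have : 0 <= K%:R * a * a by rewrite !mulr_ge0.
  lra.
by apply: ler_wpM2l => //; lra.
Qed.

Lemma bernoulliN_ge (a : R) K : 0 <= a <= 1 -> 1 - K%:R * a <= (1 - a) ^+ K.
Proof.
move=> /andP[a0 a1]; elim: K => [|K IH]; first by rewrite mul0r subr0 expr0.
rewrite exprS; apply: (@le_trans _ _ ((1 - a) * (1 - K%:R * a))).
  rewrite -natr1; have : 0 <= K%:R * a * a by rewrite !mulr_ge0.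
  lra.
by apply: ler_wpM2l => //; lra.
Qed.

Lemma pow4 m : (4 ^ m)%:R = 2 ^+ m.*2 :> R.
Proof. by rewrite natrX -addnn exprD -exprMn; congr (_ ^+ _); lra. Qed.

(** [(1 - a)^K (1 + a)^K <= 1], and [(1 + a)^K >= 1 + K a >= m + 1] with [a =
    w^(2m)], so the value is at most [1 / (m + 1)]. *)
Lemma softstep_ge_half (w : R) : 2^-1 <= w <= 1 -> softstep ^~ w @ \oo --> (0 : R).
Proof.
move=> /andP[w0 w1].
have wp : 0 <= w by apply: le_trans w0; rewrite invr_ge0.
have H m : 0 <= softstep m w <= (harmonic m : R).
  have a0 : 0 <= w ^+ m.*2 <= 1 by rewrite exprn_ge0//= exprn_ile1.
  have /andP[a00 a01] := a0.
  have /andP[-> _] /= : 0 <= softstep m w <= 1 by apply: softstep_itv; rewrite wp w1.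
  rewrite /harmonic/= -[leRHS]mul1r ler_pdivlMr ?ltr0n//.
  have := bernoulli_ge (m * 4 ^ m) a00 => B.
  have E : m.+1%:R <= (1 + w ^+ m.*2) ^+ (m * 4 ^ m).
    apply: le_trans B; rewrite natrM pow4 -mulrA -exprMn -natr1 addrC lerD2l.
    rewrite -[leLHS]mulr1 ler_wpM2l// exprn_ege1//; lra.
  apply: (@le_trans _ _ (softstep m w * (1 + w ^+ m.*2) ^+ (m * 4 ^ m))).
    by apply: ler_wpM2l => //; rewrite /softstep exprn_ge0//; lra.
  rewrite /softstep -exprMn; apply: exprn_ile1.
    by rewrite mulr_ge0//; lra.
  by rewrite -subr_sqr expr1n lerBlDr lerDl sqr_ge0.
apply: (@squeeze_cvgr _ _ _ _ (cst 0) harmonic).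
- by apply: nearW => m; exact: H.
- exact: cvg_cst.
- exact: cvg_harmonic.
Qed.

(** Bernoulli gives the lower bound [1 - m y^(2m)] with [y = 2w < 1], and [m
    y^m] is bounded. *)
Lemma softstep_lt_half (w : R) : 0 <= w < 2^-1 -> softstep ^~ w @ \oo --> (1 : R).
Proof.
move=> /andP[w0 w1]; pose y := 2 * w.
have y0 : 0 <= y by rewrite mulr_ge0.
have y1 : y < 1 by rewrite /y; lra.
have wle : w <= 1 by lra.
have Hm m : m%:R * y ^+ m <= (1 - y)^-1.
  have [->|yn] := eqVneq y 0.
    case: m => [|m]; first by rewrite mul0r subr0 invr1.
    by rewrite expr0n mulr0 subr0 invr1.
  have yp : 0 < y by rewrite lt_def yn.
  have := @bernoulli_ge (y^-1 - 1) m.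
  rewrite subrKC exprVn => /(_ _).
  have -> : 0 <= y^-1 - 1 by rewrite subr_ge0 invf_ge1 ?ltW.
  move=> /(_ isT) B.
  rewrite -[leRHS]mul1r ler_pdivlMr ?subr_gt0//.
  (* Bernoulli for y^-1 = 1 + (y^-1 - 1). *)
  have : (1 + m%:R * (y^-1 - 1)) * y ^+ m.+1 <= y.
    apply: (@le_trans _ _ ((y ^+ m)^-1 * y ^+ m.+1)).
      by apply: ler_wpM2r => //; rewrite exprn_ge0.
    by rewrite exprSr mulrA mulVf ?mul1r// expf_neq0.
  have : 0 <= y ^+ m.+1 by rewrite exprn_ge0.
  have -> : (1 + m%:R * (y^-1 - 1)) * y ^+ m.+1 = y ^+ m.+1 + m%:R * y ^+ m * (1 - y).
    by rewrite exprSr; field.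
  lra.
have H m : 1 - (1 - y)^-1 * y ^+ m <= softstep m w <= 1.
  have a0 : 0 <= w ^+ m.*2 <= 1 by rewrite exprn_ge0//= exprn_ile1.
  have /andP[_ ->] : 0 <= softstep m w <= 1 by apply: softstep_itv; rewrite w0.
  rewrite andbT; apply: le_trans (bernoulliN_ge (m * 4 ^ m) a0).
  rewrite lerD2l lerN2 natrM pow4 -mulrA -exprMn -/y -addnn exprD mulrA.
  by apply: ler_wpM2r; [rewrite exprn_ge0|exact: Hm].
apply: (@squeeze_cvgr _ _ _ _ (fun m => 1 - (1 - y)^-1 * y ^+ m) (cst 1)).
- by apply: nearW => m; exact: H.
- rewrite -[X in _ --> X]subr0; apply: cvgB; first exact: cvg_cst.
  by have := @cvg_geometric R (1 - y)^-1 y; apply; rewrite ger0_norm.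
- exact: cvg_cst.
Qed.

End softstep.

(** * Density of trigonometric polynomials *)

Section approximable_sets.
Context (R : realType) (n : nat).
Local Notation L := (lebesgue_rV R n).
Local Notation rV := 'rV[R]_n.
Local Notation box := (@box R n).
Local Notation trigp := (@trigp R n).

Definition open_box : set rV := [set v | forall i, - pi < v ord0 i < pi].

(** On the faces of the box, trigonometric functions do not separate opposite
    points; the faces are null sets. *)
Lemma box_open_box : {ae L, forall v, box v -> open_box v}.
Proof.
have m0 (c : R) j : measurable (box `&` [set v : rV | v ord0 j = c]).
  apply: measurableI; first exact: measurable_box.
  rewrite -[X in measurable X]setTI (_ : [set v | _] =
     (fun v : rV => v ord0 j) @^-1` [set c])//.
  exact: measurable_coord.
have H j : \forall v \ae L, box v -> v ord0 j != pi /\ v ord0 j != - pi.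
  exists (box `&` [set v : rV | v ord0 j = pi] `|` box `&` [set v : rV | v ord0 j = - pi]).
  split; first exact: measurableU.
    by apply: null_set_setU => //; exact: box_slice0.
  move=> v /= /not_implyP[vb /not_andP[/negP|/negP]]; rewrite negbK => /eqP vj.
    by left.
  by right.
have FF : Filter (nbhs (almost_everywhere L)) by exact: ae_filter_ringOfSetsType.
have HA := filter_forall FF H; apply: filterS HA => v vH vb i.
have [vp vn] := vH i vb; have /andP[v1 v2] := vb i.
by rewrite !lt_neqAle v1 v2 vp eq_sym vn.
Qed.

(** The sets whose indicator is a bounded pointwise limit, in the open box, of
    trigonometric polynomials. Boundedness is kept for the sake of dominated
    convergence. *)
Definition approximable (A : set rV) := measurable A /\
  exists T : nat -> rV -> R, [/\ forall m, trigp (T m),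
    exists M, forall m v, `|T m v| <= M &
    forall v, open_box v -> T ^~ v @ \oo --> (\1_A v : R)].

Lemma approximableC A : approximable A -> approximable (~` A).
Proof.
move=> [mA [T [Tt [M TM] Tc]]]; split; first exact: measurableC.
exists (fun m v => 1 + -1 * T m v); split.
- by move=> m; apply: trigp_add; [exact: trigp_cst|exact: trigp_scale].
- exists (1 + M) => m v; rewrite mulN1r; apply: le_trans (ler_normB _ _) _.
  by rewrite normr1 lerD2l.
- move=> v vb; under eq_fun do rewrite mulN1r.
  have -> : \1_(~` A) v = 1 - \1_A v :> R.
    by rewrite !indicE in_setC; case: (v \in A); rewrite ?subrr ?subr0.
  by apply: cvgB; [exact: cvg_cst|exact: Tc].
Qed.

Lemma approximableI : setI_closed approximable.
Proof.
move=> A B [mA [T [Tt [M TM] Tc]]] [mB [T' [Tt' [M' TM'] Tc']]].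
split; first exact: measurableI.
exists (fun m v => T m v * T' m v); split.
- by move=> m; exact: trigp_mul.
- by exists (M * M') => m v; rewrite normrM ler_pM.
- by move=> v vb; rewrite indicI; apply: cvgM; [exact: Tc|exact: Tc'].
Qed.

Lemma approximable_congr A B : approximable A -> measurable B ->
  (forall v, open_box v -> A v <-> B v) -> approximable B.
Proof.
move=> [mA [T [Tt TM Tc]]] mB AB; split => //; exists T; split => // v vb.
suff <- : \1_A v = \1_B v :> R by exact: Tc.
by rewrite !indicE; congr (_%:R); congr nat_of_bool; apply/idP/idP; rewrite !inE; apply AB.
Qed.

(** Compose the step approximations with the affine image of [u] that sends [u >
    0] to [w < 1/2]. *)
Lemma approximable_gt0 (u : rV -> R) : trigp u -> (forall v, `|u v| <= 1) ->
  approximable [set v | 0 < u v].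
Proof.
move=> Tu u1; split.
  rewrite (_ : [set v | _] = setT `&` u @^-1` `]0, +oo[).
    by apply: (L2box_meas (trigp_L2box Tu)) => //; exact: measurable_itv.
  by rewrite setTI; apply/seteqP; split => v /=; rewrite in_itv/= andbT.
pose w v := 2^-1 - u v / 2.
have w01 v : 0 <= w v <= 1.
  by rewrite /w; have := u1 v; rewrite ler_norml => /andP[? ?]; apply/andP; split; lra.
exists (fun m v => softstep m (w v)); split.
- move=> m; apply: trigp_exp.
  have Tw : trigp w.
    have := trigp_add (trigp_cst n (2^-1 : R)) (trigp_scale (- 2^-1) Tu).
    by congr trigp; apply/funext => v; rewrite /w; ring.
  have := trigp_add (trigp_cst n (1 : R)) (trigp_scale (-1) (trigp_exp m.*2 Tw)).
  by congr trigp; apply/funext => v; rewrite mulN1r.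
- exists 1 => m v; have /andP[b0 b1] := softstep_itv m (w01 v).
  by rewrite ger0_norm.
- move=> v _; rewrite indicE; have /andP[w0 w1] := w01 v.
  have [uv|uv] := ltP 0 (u v).
    by rewrite mem_set//=; apply: softstep_lt_half; rewrite w0/= /w; lra.
  rewrite memNset//=; last by rewrite ltNge uv.
  by apply: softstep_ge_half; rewrite w1 andbT /w; lra.
Qed.

Lemma approximableT : approximable setT.
Proof.
have := @approximable_gt0 (fun=> 1) (trigp_cst n 1) _.
rewrite (_ : (fun _ : rV => _) = setT).
  by apply => v; rewrite normr1.
by apply/seteqP; split => v //= _; exact: ltr01.
Qed.

Lemma approximableU A B : approximable A -> approximable B -> approximable (A `|` B).
Proof.
move=> hA hB; rewrite -(setCK A) -(setCK B) -setCI; apply: approximableC.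
by apply: approximableI; exact: approximableC.
Qed.

Lemma sin_sign (x : R) : - pi < x < pi -> (0 < - sin x) = (x < 0).
Proof.
move=> /andP[x1 x2]; rewrite oppr_gt0; apply/idP/idP => h.
  by rewrite ltNge; apply/negP => x0; move: h; rewrite ltNge sin_ge0_pi// x0 ltW.
by rewrite -oppr_gt0 -sinN; apply: sin_gt0_pi; rewrite oppr_gt0 h; lra.
Qed.

(** On the open box [v_i < c] is a combination of sign conditions on [sin v_i] and
    [cos v_i - cos c]: the sine tells the sign of [v_i], and the cosine is monotone
    on each half. *)
Lemma approximable_ray i c : approximable [set v | v ord0 i < c].
Proof.
have mr : measurable [set v : rV | v ord0 i < c].
  rewrite (_ : [set v | _] = setT `&` (fun v : rV => v ord0 i) @^-1` `]-oo, c[).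
    by apply: measurable_coord => //; exact: measurable_itv.
  by rewrite setTI; apply/seteqP; split => v /=; rewrite in_itv.
have p0 := @pi_gt0 R.
have [cp|cp] := leP pi c.
  apply: approximable_congr approximableT mr _ => v /(_ i)/andP[v1 v2]; split => //= _.
  exact: lt_le_trans v2 cp.
have [cn|cn] := leP c (- pi).
  apply: approximable_congr (approximableC approximableT) mr _ => v /(_ i)/andP[v1 v2].
  split => /=; first by move=> /(_ I).
  by move=> vc; move: (lt_trans v1 (lt_le_trans vc cn)); rewrite ltxx.
have sA : approximable [set v | 0 < - sin (v ord0 i)].
  apply: approximable_gt0.
    have := trigp_scale (-1) (@trigp_sin R n i).
    by congr trigp; apply/funext => v; rewrite mulN1r.
  by move=> v; rewrite normrN; exact: sin_max.
have cA (s : R) : `|s| = 1 -> approximable [set v | 0 < s * (cos (v ord0 i) - cos c) / 2].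
  move=> s1; apply: approximable_gt0.
    have := trigp_scale (s / 2) (trigp_add (@trigp_cos R n i) (trigp_cst n (- cos c))).
    by congr trigp; apply/funext => v; ring.
  move=> v; rewrite !normrM s1 mul1r (ger0_norm (x := 2^-1)) ?invr_ge0//.
  rewrite ler_pdivrMr// mul1r; apply: le_trans (ler_normB _ _) _.
  by have := cos_max (v ord0 i); have := cos_max c; lra.
have [c0|c0] := leP c 0.
  have := approximableI sA (cA (-1) (normrN1 _)).
  move=> /approximable_congr; apply => // v /(_ i) vi; rewrite /= sin_sign//.
  have /andP[v1 v2] := vi.
  have key : v ord0 i < 0 -> (0 < -1 * (cos (v ord0 i) - cos c) / 2) = (v ord0 i < c).
    move=> vn; rewrite pmulr_lgt0 ?invr_gt0// mulN1r opprB subr_gt0.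
    rewrite -(cosN c) -(cosN (v ord0 i)) ltr_cos ?ltrN2// in_itv/=; apply/andP; split; lra.
  split; first by move=> [vn]; rewrite key.
  by move=> vc; have vn := lt_le_trans vc c0; rewrite key.
have := approximableU sA (cA 1 (normr1 _)).
move=> /approximable_congr; apply => // v /(_ i) vi; rewrite /= sin_sign//.
have /andP[v1 v2] := vi.
rewrite mul1r pmulr_lgt0 ?invr_gt0// subr_gt0.
have key : 0 <= v ord0 i -> (cos c < cos (v ord0 i)) = (v ord0 i < c).
  by move=> vp; rewrite ltr_cos// in_itv/=; apply/andP; split; lra.
split.
  move=> [vn|]; first exact: lt_trans vn c0.
  by have [vn _|vp] := ltP (v ord0 i) 0; [exact: lt_trans vn c0|rewrite key].
by have [vn _|vp] := ltP (v ord0 i) 0; [left|rewrite -key//; right].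
Qed.

(** Half-spaces [v_i < c] generate the Borel sets. *)
Lemma measurable_approximable : @measurable _ rV = <<s approximable >>.
Proof.
apply/seteqP; split; last first.
  apply: smallest_sub; first exact: sigma_algebra_measurable.
  by move=> A [].
apply: smallest_sub.
  exact: smallest_sigma_algebra.
rewrite -bigcup_seq => B [i _ [C mC <-]].
pose f : g_sigma_algebraType approximable -> R := fun v : rV => v ord0 i.
have mf : measurable_fun setT f.
  apply: (measurability _ (RGenInftyO.measurableE R)).
  move=> _ [_ [x ->] <-]; rewrite setTI; apply: sub_sigma_algebra.
  rewrite (_ : f @^-1` _ = [set v : rV | v ord0 i < x]); first exact: approximable_ray.
  by apply/seteqP; split => v /=; rewrite in_itv.
exact: mf.
Qed.

End approximable_sets.

Section density.
Context (R : realType) (n : nat).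
Local Notation L := (lebesgue_rV R n).
Local Notation rV := 'rV[R]_n.
Local Notation box := (@box R n).
Local Notation trigp := (@trigp R n).

(** Dominated convergence for the squares of the differences, which are at most
    [2 (g^2 + h^2)]. *)
Lemma L2box_dominated_cvg (g_ : nat -> rV -> R) (g h : rV -> R) :
  (forall m, measurable_fun setT (g_ m)) -> measurable_fun setT g -> L2box h ->
  (forall m v, box v -> `|g_ m v| <= h v) ->
  (forall v, open_box v -> g_ ^~ v @ \oo --> g v) ->
  L2box g /\ forall e, 0 < e -> exists m, nrm (fun v => g v - g_ m v) < e.
Proof.
move=> mg_ mg Lh gh gg.
have mb := @measurable_box R n.
have aeb := @box_open_box R n.
have FF : Filter (nbhs (almost_everywhere L)) by exact: ae_filter_ringOfSetsType.
have Lg : L2box g.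
  split => //.
  pose f_ m v := (g_ m v ^+ 2)%:E.
  have H1 m : measurable_fun box (f_ m).
    by apply/measurable_EFinP; apply: measurable_funTS; exact: measurable_funX.
  have H2 : measurable_fun box (fun v => (g v ^+ 2)%:E).
    by apply/measurable_EFinP; apply: measurable_funTS; exact: measurable_funX.
  have H3 : {ae L, forall v, box v -> f_ ^~ v @ \oo --> (g v ^+ 2)%:E}.
    apply: filterS aeb => v vo vb; apply: cvg_EFin; first exact: nearW.
    have gv := gg v (vo vb).
    by rewrite /comp/= expr2; under eq_fun do rewrite expr2; exact: cvgM.
  have H5 : {ae L, forall v m, box v -> (`|f_ m v| <= (h v ^+ 2)%:E)%E}.
    apply: aeW => v m vb; rewrite lee_fin ger0_norm ?sqr_ge0//.
    rewrite -(real_normK (num_real (g_ m v))).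
    by rewrite lerXn2r ?nnegrE ?gh// (le_trans _ (gh m v vb)).
  by have [] := @dominated_convergence _ _ R L box mb f_ _ _ H1 H2 H3 Lh.2 H5.
split=> // e e0.
have Lg_ m : L2box (g_ m).
  split => //; case: (Lh) => mh ih; apply: le_integrable ih => //.
    by apply/measurable_EFinP; apply: measurable_funTS; exact: measurable_funX.
  move=> v vb /=; rewrite lee_fin !ger0_norm ?sqr_ge0//.
  rewrite -(real_normK (num_real (g_ m v))).
  by rewrite lerXn2r ?nnegrE ?gh// (le_trans _ (gh m v vb)).
have LB m := L2boxB Lg (Lg_ m).
pose d_ m v := ((g v - g_ m v) ^+ 2)%:E.
have H1 m : measurable_fun box (d_ m) by case: (LB m) => _ /measurable_int.
have H2 : measurable_fun box (fun _ : rV => 0%E : \bar R) by exact: measurable_cst.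
have H3 : {ae L, forall v, box v -> d_ ^~ v @ \oo --> (0%E : \bar R)}.
  apply: filterS aeb => v vo vb; apply: cvg_EFin; first exact: nearW.
  have gv := gg v (vo vb).
  have d0 : (fun m => g v - g_ m v) @ \oo --> (0 : R).
    by rewrite -(subrr (g v)); apply: cvgB => //; exact: cvg_cst.
  rewrite /comp/= -[X in _ --> X](mul0r (0 : R)).
  by under eq_fun do rewrite expr2; exact: cvgM.
have H4 : L.-integrable box (fun v => (2%:E * ((g v ^+ 2)%:E + (h v ^+ 2)%:E))%E).
  by apply: integrableZl => //; apply: integrableD => //; [case: Lg|case: Lh].
have H5 : {ae L, forall v m, box v ->
    (`|d_ m v| <= 2%:E * ((g v ^+ 2)%:E + (h v ^+ 2)%:E))%E}.
  apply: aeW => v m vb; rewrite -EFinD -EFinM lee_fin ger0_norm ?sqr_ge0//.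
  have : g_ m v ^+ 2 <= h v ^+ 2.
    rewrite -(real_normK (num_real (g_ m v))).
    by rewrite lerXn2r ?nnegrE ?gh// (le_trans _ (gh m v vb)).
  have := sqr_ge0 (g v + g_ m v); rewrite sqrrD sqrrB; lra.
have [_ _ C] := @dominated_convergence _ _ R L box mb d_ _ _ H1 H2 H3 H4 H5.
have C' : (fun m => inner (fun v => g v - g_ m v) (fun v => g v -
  g_ m v)) @ \oo --> (0 : R).
  move: C; rewrite integral0 => /fine_cvg; apply: cvg_trans; apply: near_eq_cvg.
  by apply: nearW => m; rewrite /inner /Rintegral /=; congr fine;
    apply: eq_integral => v _; rewrite expr2.
have [m _ /(_ m (leqnn m))] := @cvgr0_norm_lt _ _ _ _ _ _ C' _ (exprn_gt0 2 e0).
move=> Hm; exists m; rewrite -(@ltr_pXn2r _ 2)// ?nnegrE ?nrm_ge0 ?(ltW e0)//.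
by rewrite sqr_nrm; apply: le_lt_trans Hm; exact: ler_norm.
Qed.

Definition trig_dense (g : rV -> R) := L2box g /\
  forall e, 0 < e -> exists t, trigp t /\ nrm (fun v => g v - t v) < e.

Lemma trig_dense_trigp t : trigp t -> trig_dense t.
Proof.
move=> Tt; split; first exact: trigp_L2box.
move=> e e0; exists t; split => //; rewrite /nrm.
rewrite (@eq_inner _ _ _ _ (fun=> 0 * 0) (fun=> 0)); last 2 first.
- by move=> v _; rewrite subrr mul0r.
- by move=> v _; rewrite subrr.
by rewrite innerZl ?mul0r ?sqrtr0//; exact: L2box_cst.
Qed.

Lemma trig_dense_lim g : L2box g ->
  (forall e, 0 < e -> exists h, trig_dense h /\ nrm (fun v => g v - h v) < e) ->
  trig_dense g.
Proof.
move=> Lg gh; split => // e e0.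
have e20 : 0 < e / 2 by rewrite divr_gt0.
have [h [[Lh hd] gh2]] := gh _ e20; have [t [Tt ht]] := hd _ e20.
exists t; split => //; apply: le_lt_trans (nrm_triangle Lg Lh (trigp_L2box Tt)) _.
lra.
Qed.

Lemma trig_dense_add g h : trig_dense g -> trig_dense h ->
  trig_dense (fun v => g v + h v).
Proof.
move=> [Lg gd] [Lh hd]; split; first exact: L2boxD.
move=> e e0; have e20 : 0 < e / 2 by rewrite divr_gt0.
have [t [Tt gt]] := gd _ e20; have [s [Ts hs]] := hd _ e20.
exists (fun v => t v + s v); split; first exact: trigp_add.
have Lt := trigp_L2box Tt; have Ls := trigp_L2box Ts.
rewrite (_ : (fun v => _) = fun v => (g v - t v) + (h v - s v)); last first.
  by apply/funext => v; ring.
apply: le_lt_trans (nrmD (L2boxB Lg Lt) (L2boxB Lh Ls)) _; lra.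
Qed.

Lemma trig_dense_scale c g : trig_dense g -> trig_dense (fun v => c * g v).
Proof.
move=> [Lg gd]; split; first exact: L2boxZ.
move=> e e0; have ec : 0 < e / (`|c| + 1) by rewrite divr_gt0// ltr_wpDl.
have [t [Tt gt]] := gd _ ec; exists (fun v => c * t v); split; first exact: trigp_scale.
have Lt := trigp_L2box Tt.
rewrite (_ : (fun v => _) = fun v => c * (g v - t v)); last first.
  by apply/funext => v; ring.
rewrite nrmZ; last exact: L2boxB.
apply: (@le_lt_trans _ _ ((`|c| + 1) * nrm (fun v => g v - t v))).
  by apply: ler_wpM2r; [exact: nrm_ge0|rewrite lerDl].
by rewrite mulrC -ltr_pdivlMr// ltr_wpDl.
Qed.

(** L^2-closure turns dominated pointwise limits into limits in norm. *)
Lemma trig_dense_dominated (g_ : nat -> rV -> R) (g h : rV -> R) :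
  (forall m, trig_dense (g_ m)) -> measurable_fun setT g -> L2box h ->
  (forall m v, box v -> `|g_ m v| <= h v) ->
  (forall v, open_box v -> g_ ^~ v @ \oo --> g v) -> trig_dense g.
Proof.
move=> gd mg Lh gh gg.
have [|Lg H] := L2box_dominated_cvg _ mg Lh gh gg.
  by move=> m; have [[]] := gd m.
by apply: trig_dense_lim => // e e0; have [m Hm] := H e e0; exists (g_ m).
Qed.

Lemma trig_dense_sum (I : Type) (s : seq I) (g : I -> rV -> R) :
  (forall i, trig_dense (g i)) -> trig_dense (fun v => \sum_(i <- s) g i v).
Proof.
move=> gd; elim: s => [|i s IH].
  rewrite (_ : (fun _ => _) = fun=> 0); first exact/trig_dense_trigp/trigp_cst.
  by apply/funext => v; rewrite big_nil.
rewrite (_ : (fun _ => _) = fun v => g i v + \sum_(j <- s) g j v).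
  exact: trig_dense_add.
by apply/funext => v; rewrite big_cons.
Qed.

(** The approximable sets are stable under intersection and generate the Borel
    sets, so the Dynkin lemma applies to the sets whose indicator is a limit of
    trigonometric polynomials. *)
Lemma trig_dense_indic (A : set rV) : measurable A -> trig_dense (\1_A : rV -> R).
Proof.
rewrite (measurable_approximable R n) => sA.
move: A sA; apply: (dynkin_induction (measurable_approximable R n)).
- exact: approximableI.
- rewrite (_ : \1_setT = fun=> 1); first exact/trig_dense_trigp/trigp_cst.
  by apply/funext => v; rewrite indicT.
- move=> A [mA [T [Tt [M TM] Tc]]].
  apply: (@trig_dense_dominated T _ (fun=> M)) => //.
  + by move=> m; exact: trig_dense_trigp.
  + exact: L2box_cst.
- move=> A mA dA.
  rewrite (_ : \1_(~` A) = fun v => 1 + -1 * \1_A v).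
    apply: trig_dense_add; last exact: trig_dense_scale.
    exact/trig_dense_trigp/trigp_cst.
  apply/funext => v; rewrite !indicE in_setC.
  by case: (v \in A); rewrite mulN1r ?subrr ?subr0.
- move=> F mF tF dF.
  (* By disjointness the partial sums are eventually stationary, equal to 0 or 1. *)
  have key (v : rV) : (exists k, \1_(\bigcup_k F k) v = 1 :> R /\
       forall m, \sum_(i <- iota 0 m) \1_(F i) v = (k < m)%N%:R :> R) \/
     (\1_(\bigcup_k F k) v = 0 :> R /\
       forall m, \sum_(i <- iota 0 m) \1_(F i) v = 0 :> R).
    have [[k _ Fkv]|NF] := pselect ((\bigcup_k F k) v).
      left; exists k; split; first by rewrite indicE mem_set//; exists k.
      have N i : i != k -> \1_(F i) v = 0 :> R.
        move=> ik; rewrite indicE memNset// => Fiv.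
        by move: ik; rewrite (tF i k I I)// ?eqxx//; exists v.
      move=> m; have [km|mk] := ltnP k m.
        rewrite (bigD1_seq k)//= ?mem_iota ?iota_uniq//.
        by rewrite big1 ?addr0 ?indicE ?mem_set// => i /N.
      rewrite big_seq big1// => i; rewrite mem_iota add0n => /andP[_ im].
      by apply: N; rewrite ltn_eqF// (leq_trans im).
    right; split; first by rewrite indicE memNset.
    move=> m; rewrite big1// => i _; rewrite indicE memNset// => Fiv.
    by apply: NF; exists i.
  apply: (@trig_dense_dominated (fun m v => \sum_(i <- iota 0 m) \1_(F i) v) _ (fun=> 1)).
  + by move=> m; apply: trig_dense_sum.
  + by apply: measurable_indic; exact: bigcup_measurable.
  + exact: L2box_cst.
  + move=> m v _; have [[k [_ ->]]|[_ ->]] := key v; last by rewrite normr0.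
    by rewrite ger0_norm// lern1 leq_b1.
  + move=> v _; have [[k [-> kE]]|[-> kE]] := key v; under eq_fun do rewrite kE.
      apply: cvg_near_cst; exists k.+1 => // m /= km.
      by rewrite km.
    exact: cvg_cst.
Qed.

(** Round [f] down to a multiple of [1/m] where this multiple is at most [m] in
    absolute value, and to 0 elsewhere: these simple functions are dominated by
    [1 + |f|] and converge pointwise. *)
Lemma trig_dense_L2box f : L2box f -> trig_dense f.
Proof.
move=> Lf; have mf := L2box_meas Lf.
pose A m (i : 'I_((m * m).*2).+1) : set rV := [set v | Num.floor (m%:R * f v) = ord_freq i].
pose g m v : R := \sum_(i : 'I_((m * m).*2).+1) ((ord_freq i)%:~R / m%:R) * \1_(A m i) v.
have mA m i : measurable (A m i).
  rewrite (_ : A m i = setT `&` (fun v => m%:R * f v) @^-1` `[(ord_freq i)%:~R,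
    (ord_freq i + 1)%:~R[).
    by apply: measurable_funM => //; exact: measurable_itv.
  rewrite setTI; apply/seteqP; split => v /=; rewrite in_itv/=.
    by move=> <-; rewrite floor_itv.
  exact: floor_def.
have gE m v : g m v = if (absz (Num.floor (m%:R * f v)) <= m * m)%N
    then (Num.floor (m%:R * f v))%:~R / m%:R else 0.
  case: ifPn => fm.
    have [i iE] : exists i : 'I_((m * m).*2).+1, ord_freq i = Num.floor (m%:R * f v).
      have := @mem_freqs 1 (m * m) [ffun=> Num.floor (m%:R * f v)].
      rewrite (_ : [forall j, _] = true); last by apply/forallP => j; rewrite ffunE.
      move=> /mapP[z _ zE]; exists (z ord0).
      by have := congr1 (fun h : {ffun 'I_1 -> int} => h ord0) zE; rewrite !ffunE.
    rewrite /g (bigD1 i)//= big1 ?addr0.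
      by rewrite indicE mem_set ?mulr1 ?iE//= /A /= iE.
    move=> j ji; rewrite indicE memNset ?mulr0// /A /= -iE => /ord_freq_inj ij.
    by rewrite ij eqxx in ji.
  rewrite /g big1// => i _; rewrite indicE memNset ?mulr0// /A /= => fi.
  have := @mem_freqs 1 (m * m) [ffun=> ord_freq i].
  have -> : [ffun=> ord_freq i] \in freqs 1 (m * m).
    apply/mapP; exists [ffun=> i]; first exact: mem_index_enum.
    by apply/ffunP => j; rewrite !ffunE.
  move=> /esym/forallP/(_ ord0); rewrite ffunE -fi => h.
  by rewrite h in fm.
have near_f m v : (0 < m)%N -> `|(Num.floor (m%:R * f v))%:~R / m%:R - f v| <= m%:R^-1.
  move=> m0; have mp : 0 < m%:R :> R by rewrite ltr0n.
  have := floor_itv (m%:R * f v) => /andP[f1 f2].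
  have -> : (Num.floor (m%:R * f v))%:~R / m%:R - f v =
     ((Num.floor (m%:R * f v))%:~R - m%:R * f v) / m%:R.
    by field; rewrite gt_eqF.
  rewrite normrM (ger0_norm (x := m%:R^-1)) ?invr_ge0//.
  rewrite -[leRHS]mul1r; apply: ler_wpM2r; first by rewrite invr_ge0.
  rewrite rmorphD/= in f2; rewrite ler_norml; lra.
apply: (@trig_dense_dominated g _ (fun v => 1 + `|f v|)) => //.
- move=> m; apply: trig_dense_sum => i; apply: trig_dense_scale.
  exact: trig_dense_indic.
- apply: L2boxD; first exact: L2box_cst.
  split; first by apply: measurableT_comp.
  by case: Lf => _; under eq_fun do rewrite -real_normK ?num_real//.
- move=> m v _; rewrite gE; case: ifPn => _; last by rewrite normr0 addr_ge0.
  case: m => [|m]; first by rewrite invr0 mulr0 normr0 addr_ge0.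
  rewrite -[X in `|X|](subrK (f v)); apply: le_trans (ler_normD _ _) _.
  rewrite lerD2r; apply: le_trans (near_f _ _ (ltn0Sn m)) _.
  by rewrite invf_le1 ?ltr0n// ler1n.
- move=> v _; apply/cvgrPdist_le => e e0.
  near=> m.
  have m0 : (0 < m)%N by near: m; exact: nbhs_infty_gt.
  have mp : 0 < m%:R :> R by rewrite ltr0n.
  have me : e^-1 <= m%:R by near: m; exact: nbhs_infty_ger.
  have mf1 : `|f v| + 1 <= m%:R by near: m; exact: nbhs_infty_ger.
  rewrite gE ifT.
    rewrite distrC; apply: le_trans (near_f _ _ m0) _.
    by rewrite -[e]invrK lef_pV2// posrE ?invr_gt0.
  rewrite -(ler_nat R) natrM.
  have := near_f m v m0; set w := Num.floor _ => H.
  have -> : (absz w)%:R = `|w%:~R| :> R by rewrite -intr_norm -abszE pmulrn.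
  have : `|w%:~R / m%:R| <= m%:R :> R.
    rewrite -[X in `|X|](subrK (f v)); apply: le_trans (ler_normD _ _) _.
    apply: le_trans mf1; rewrite addrC lerD2l; apply: le_trans H _.
    by rewrite invf_le1// ler1n.
  by rewrite normrM normfV (ger0_norm (x := m%:R))// ler_pdivrMr.
Unshelve. all: by end_near. Qed.

End density.

(** * Fourier projection of functions with weak derivatives *)

Section fourier.
Context (R : realType) (n : nat).
Local Notation L := (lebesgue_rV R n).
Local Notation rV := 'rV[R]_n.
Local Notation box := (@box R n).
Local Notation trign := (@trign R n).
Local Notation freqs := (freqs n).
Local Notation index := {ffun 'I_n -> int}.
Implicit Types f g : rV -> R.

Definition trig_sum (s : seq index) (x : index -> R) (v : rV) :=
  \sum_(k <- s) x k * trign k v.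

Lemma L2box_trig_sum s x : L2box (trig_sum s x).
Proof. by apply: L2box_sum => k; exact: L2box_trign. Qed.

Lemma inner_trig_sum_trign s x l : uniq s ->
  inner (trig_sum s x) (trign l) = if l \in s then x l else 0.
Proof.
move=> us; rewrite inner_suml//; [|exact: L2box_trign|exact: L2box_trign].
under eq_bigr do rewrite inner_trign.
case: ifPn => ls.
  rewrite (bigD1_seq l)//= eqxx mulr1 big1 ?addr0// => k /negbTE ->.
  by rewrite mulr0.
rewrite big_seq big1// => k ks; case: eqP => [kl|_]; last by rewrite mulr0.
by rewrite -kl ks in ls.
Qed.

Lemma sqr_nrm_trig_sum s x : uniq s -> nrm (trig_sum s x) ^+ 2 = \sum_(k <- s) x k ^+ 2.
Proof.
move=> us; rewrite sqr_nrm {2}/trig_sum inner_sumr; last exact: L2box_trig_sum.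
  rewrite big_seq [RHS]big_seq; apply: eq_bigr => k ks.
  by rewrite inner_trig_sum_trign// ks expr2.
by move=> k; exact: L2box_trign.
Qed.

Lemma trig_poly_sum N g : trig_poly N g <-> exists x, g = trig_sum (freqs N) x.
Proof.
rewrite trig_poly_freqs; split => [[x gx]|[x ->]]; exists x => //.
exact/funext.
Qed.

Lemma trig_poly_proj N f : trig_poly N (trig_proj N f).
Proof. by apply/trig_poly_sum; exists (fun k => inner f (trign k)). Qed.

Lemma L2box_proj N f : L2box (trig_proj N f).
Proof. exact: trig_poly_L2box (trig_poly_proj N f). Qed.

Lemma inner_proj N f k : inner (trig_proj N f) (trign k) =
  if k \in freqs N then inner f (trign k) else 0.
Proof. exact: (inner_trig_sum_trign (fun k => inner f (trign k)) k (uniq_freqs n N)). Qed.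

Lemma proj_orthogonal N f t : L2box f -> trig_poly N t ->
  inner (fun v => f v - trig_proj N f v) t = 0.
Proof.
move=> Lf /trig_poly_sum[x ->]; have Lp := L2box_proj N f.
rewrite inner_sumr; [|by move=> k; exact: L2box_trign|exact: L2boxB].
rewrite big_seq big1// => k kN; rewrite innerBl//; last exact: L2box_trign.
by rewrite inner_proj kN subrr mulr0.
Qed.

(** Pythagoras. *)
Lemma orthogonal_nrm_le f g t : L2box f -> L2box g -> L2box t ->
  inner (fun v => f v - g v) (fun v => g v - t v) = 0 ->
  nrm (fun v => f v - g v) <= nrm (fun v => f v - t v).
Proof.
move=> Lf Lg Lt fg0; rewrite -(@ler_pXn2r _ 2)// ?nnegrE ?nrm_ge0// !sqr_nrm.
have L1 := L2boxB Lf Lg; have L2 := L2boxB Lg Lt.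
rewrite [leRHS](@eq_inner _ _ _ _ (fun v => (f v - g v) + (g v - t v))
  (fun v => (f v - g v) + (g v - t v))); last 2 first.
- by move=> v _; ring.
- by move=> v _; ring.
rewrite (innerDl L1 L2 (L2boxD L1 L2)) (innerDr L1 L2 L1) (innerDr L1 L2 L2).
rewrite fg0 innerC fg0 addr0 add0r lerDl; exact: inner_ge0.
Qed.

(** The projection error is orthogonal to all trigonometric polynomials of
    degree [N]. *)
Lemma proj_best N f t : L2box f -> trig_poly N t ->
  nrm (fun v => f v - trig_proj N f v) <= nrm (fun v => f v - t v).
Proof.
move=> Lf Nt; apply: orthogonal_nrm_le => //.
- exact: L2box_proj.
- exact: trig_poly_L2box Nt.
apply: proj_orthogonal => //.
have := trig_poly_add (trig_poly_proj N f) (trig_poly_scale (-1) Nt).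
by congr trig_poly; apply/funext => v; rewrite mulN1r.
Qed.

Lemma bessel s f : L2box f -> uniq s -> \sum_(k <- s) inner f (trign k) ^+ 2 <= nrm f ^+ 2.
Proof.
move=> Lf us; pose p := trig_sum s (fun k => inner f (trign k)).
have Lp : L2box p by exact: L2box_trig_sum.
have : 0 <= inner (fun v => f v - p v) (fun v => f v - p v) by exact: inner_ge0.
rewrite innerBl ?innerBr//; [|exact: L2boxB].
have E : inner f p = \sum_(k <- s) inner f (trign k) ^+ 2.
  by rewrite inner_sumr// => k; exact: L2box_trign.
have E2 : inner p p = \sum_(k <- s) inner f (trign k) ^+ 2.
  by rewrite -sqr_nrm sqr_nrm_trig_sum.
by rewrite (innerC p f) E E2 sqr_nrm; lra.
Qed.

(** Density, together with the optimality of the projection. *)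
Lemma proj_cvg f e : L2box f -> 0 < e ->
  exists N0, forall N, (N0 <= N)%N -> nrm (fun v => f v - trig_proj N f v) < e.
Proof.
move=> Lf e0; have [_ /(_ e e0)[t [[N0 Nt] ft]]] := trig_dense_L2box Lf.
exists N0 => N NN; apply: le_lt_trans ft; apply: proj_best => //.
exact: trig_poly_mono Nt.
Qed.

Lemma proj_diff N M f : (N <= M)%N ->
  nrm (fun v => trig_proj M f v - trig_proj N f v) ^+ 2 =
  \sum_(k <- freqs M | k \notin freqs N) inner f (trign k) ^+ 2.
Proof.
move=> NM; rewrite -big_filter -sqr_nrm_trig_sum ?filter_uniq ?uniq_freqs//.
congr (nrm _ ^+ 2); apply/funext => v; rewrite /trig_sum big_filter /trig_proj.
have P : \sum_(k <- freqs M | k \in freqs N) inner f (trign k) * trign k v =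
         \sum_(k <- freqs N) inner f (trign k) * trign k v.
  rewrite -big_filter; apply: perm_big.
  apply: uniq_perm; rewrite ?filter_uniq ?uniq_freqs// => k.
  rewrite mem_filter; have [/= kN|//] := boolP (k \in freqs N).
  move: kN; rewrite !mem_freqs => /forallP kN; apply/forallP => j.
  exact: leq_trans (kN j) NM.
by rewrite (bigID (mem (freqs N)))/= P addrAC subrr add0r.
Qed.

Lemma iter_flipK r j : involutive (iter r (@flip n j)).
Proof.
have fK : involutive (@flip n j).
  move=> k; apply/ffunP => i; rewrite !ffunE; case: eqP => // ->.
  by rewrite opprK.
elim: r => [//|r IH] k; rewrite iterSr.
by rewrite iterS fK IH.
Qed.

(** Changing the sign of a frequency permutes the frequencies of absolute value
    at most [M]; this reindexes the sums of squares of coefficients. *)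
Lemma iter_flip_freqs r j M : perm_eq (map (iter r (flip j)) (freqs M)) (freqs M).
Proof.
apply: uniq_perm; [|exact: uniq_freqs|].
  rewrite (map_inj_uniq (inv_inj (iter_flipK r j))); exact: uniq_freqs.
have fM k : k \in freqs M -> iter r (flip j) k \in freqs M.
  rewrite !mem_freqs => /forallP kM.
  elim: r => [|r IH] /=; first exact/forallP.
  apply/forallP => i; rewrite ffunE; have /forallP/(_ i) := IH.
  by case: ifP => //; rewrite abszN.
move=> k; apply/mapP/idP => [[l lM ->]|kM]; first exact: fM.
by exists (iter r (flip j) k); [exact: fM|rewrite iter_flipK].
Qed.

Lemma L2p_L2box f : L2p f -> L2box f.
Proof. by move=> [_ mf foo]; exact: L2norm_L2box. Qed.

Section weak_derivatives.
Variables (r : nat) (f : rV -> R) (D : multi_index n r -> rV -> R).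
Hypothesis fD : weak_derivs f D.

Let Lf : L2box f. Proof. by case: fD => /L2p_L2box. Qed.

Let LD (a : multi_index n r) : (mi_order a <= r)%N -> L2box (D a).
Proof. by move=> ar; have [_ /(_ a ar)[/L2p_L2box]] := fD. Qed.

(** Test the weak derivative against the basis function whose [r]-th derivative
    is a multiple of the [k]-th one. *)
Lemma coef_weak_deriv j (k : index) :
  `|(k j)%:~R : R| ^+ r * `|inner f (trign k)| =
  `|inner (D (pure_mi r j)) (trign (iter r (flip j) k))|.
Proof.
have [_ H] := fD; have [|_ W] := H (pure_mi r j); first by rewrite mi_order_pure.
pose l := iter r (flip j) k.
have := W _ (smooth_trign R l) (@periodic_trign R n l).
have [c cE] := foldr_pderiv_nseq R l j r.
rewrite mderiv_pure => ->; rewrite innerZr//; last exact: L2box_trign.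
rewrite /l iter_flipK mi_order_pure => /(congr1 (fun x => `|x|)).
rewrite !normrM normrX normrN1 expr1n mul1r => <-; congr (_ * _).
rewrite cE /l; congr (_ ^+ _).
elim: (r) => [//|r' IH] /=.
by rewrite ffunE eqxx rmorphN/= normrN.
Qed.

(** A frequency outside the range has some [|k_j| > N], so its coefficient is at most
    [N^-r] times a coefficient of the derivative in direction [j]; Bessel's
    inequality sums these bounds. This bounds [P_M f - P_N f] uniformly in [M], and
    [P_M f] tends to [f]. *)
Lemma proj_error N : (0 < N)%N ->
  nrm (fun v => f v - trig_proj N f v) <=
  Num.sqrt (\sum_j nrm (D (pure_mi r j)) ^+ 2) / N%:R ^+ r.
Proof.
move=> N0; have Np : 0 < N%:R ^+ r :> R by rewrite exprn_gt0// ltr0n.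
have H M : (N <= M)%N -> nrm (fun v => trig_proj M f v - trig_proj N f v) <=
    Num.sqrt (\sum_j nrm (D (pure_mi r j)) ^+ 2) / N%:R ^+ r.
  move=> NM.
  rewrite -(@ler_pXn2r _ 2)// ?nnegrE ?nrm_ge0 ?divr_ge0 ?sqrtr_ge0 ?(ltW Np)//.
  have S0 : 0 <= \sum_j nrm (D (pure_mi r j)) ^+ 2.
    by apply: sumr_ge0 => j _; rewrite sqr_ge0.
  rewrite [leRHS]expr_div_n (sqr_sqrtr S0).
  rewrite proj_diff//.
  have key j : \sum_(k <- freqs M | (N < absz (k j))%N) inner f (trign k) ^+ 2 <=
      nrm (D (pure_mi r j)) ^+ 2 / (N%:R ^+ r) ^+ 2.
    have LDj : L2box (D (pure_mi r j)) by apply: LD; rewrite mi_order_pure.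
    rewrite ler_pdivlMr ?(exprn_gt0 2 Np)//.
    apply: le_trans (bessel LDj (uniq_freqs n M)).
    have -> : \sum_(k <- freqs M) inner (D (pure_mi r j)) (trign k) ^+ 2 =
        \sum_(k <- freqs M) inner (D (pure_mi r j)) (trign (iter r (flip j) k)) ^+ 2.
      by rewrite -(perm_big _ (iter_flip_freqs r j M)) big_map.
    rewrite mulr_suml [leRHS](bigID (fun k : index => (N < absz (k j))%N))/=.
    rewrite -[leLHS]addr0; apply: lerD; last by apply: sumr_ge0 => k _; rewrite sqr_ge0.
    apply: ler_sum => k Nk.
    rewrite -(real_normK (num_real (inner (D _) _))) -coef_weak_deriv.
    rewrite -(real_normK (num_real (inner f _))) -exprMn mulrC.
    rewrite lerXn2r ?nnegrE ?mulr_ge0 ?exprn_ge0//; apply: ler_wpM2r => //.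
    rewrite lerXn2r ?nnegrE//.
    by rewrite -intr_norm -abszE -pmulrn ler_nat ltnW.
  apply: (@le_trans _ _ (\sum_j \sum_(k <- freqs M | (N < absz (k j))%N) inner f (trign
    k) ^+ 2)).
    under [leRHS]eq_bigr do rewrite big_mkcond.
    rewrite exchange_big/= big_mkcond/=; apply: ler_sum => k _.
    case: ifPn => [|_]; last by apply: sumr_ge0 => j _; case: ifP => // _; rewrite sqr_ge0.
    rewrite mem_freqs negb_forall => /existsP[j]; rewrite -ltnNge => Nk.
    rewrite (bigD1 j)//= Nk lerDl; apply: sumr_ge0 => i _.
    by case: ifP => // _; rewrite sqr_ge0.
  by rewrite mulr_suml; apply: ler_sum => j _.
apply/ler_addgt0Pl => e e0; have [N1 HN] := proj_cvg Lf e0.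
pose M := maxn N N1.
have := HN M (leq_maxr _ _); have := H M (leq_maxl _ _) => h1 h2.
apply: le_trans (nrm_triangle Lf (L2box_proj M f) (L2box_proj N f)) _.
lra.
Qed.

(** The derivative of order 0 has the same Fourier coefficients as [f]; by density
    [f - D a] is orthogonal to trigonometric polynomials as close to it as desired, so
    its norm vanishes. *)
Lemma nrm_weak_deriv0 (a : multi_index n r) : mi_order a = 0%N -> nrm f <= nrm (D a).
Proof.
move=> a0; have [_ H] := fD; have [|_ W] := H a; first by rewrite a0.
have LDa : L2box (D a) by apply: LD; rewrite a0.
have E k : inner f (trign k) = inner (D a) (trign k).
  by have := W _ (smooth_trign R k) (@periodic_trign R n k); rewrite mderiv_zero// a0 mul1r.
have LB := L2boxB Lf LDa.
apply: le_trans (nrm_leB Lf LDa) _; rewrite gerDl.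
apply/ler_addgt0Pl => e e0; rewrite addr0.
have [_ /(_ e e0)[t [[N /trig_poly_sum[x ->]] Ht]]] := trig_dense_L2box LB.
apply: le_trans (ltW Ht).
set s := trig_sum _ _; have Ls : L2box s by exact: L2box_trig_sum.
have o : inner (fun v => f v - D a v) s = 0.
  rewrite inner_sumr//; last by move=> k; exact: L2box_trign.
  by rewrite big1// => k _; rewrite innerBl// ?E ?subrr ?mulr0//; exact: L2box_trign.
rewrite -(@ler_pXn2r _ 2)// ?nnegrE ?nrm_ge0// !sqr_nrm.
move: o LB; set h := (fun v => f v - D a v) => o LB.
rewrite [leRHS](innerBl LB Ls (L2boxB LB Ls)) (innerBr LB Ls LB) (innerBr LB Ls Ls).
by rewrite (innerC s h) o subr0 sub0r opprK lerDl; exact: inner_ge0.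
Qed.

End weak_derivatives.
End fourier.

(** * Comparison with the Sobolev norm *)

Section sobolev_norm.
Context (R : realType) (d r : nat).
Hypothesis r0 : (0 < r)%N.
Local Notation rV := 'rV[R]_d.
Implicit Types f : rV -> R.

(** The norm over which [Hnorm] takes the infimum, as a real number. *)
Definition deriv_norm (D : multi_index d r -> rV -> R) : R :=
  Num.sqrt (\sum_(a : multi_index d r | (mi_order a <= r)%N) nrm (D a) ^+ 2).

Lemma deriv_norm_sqrte f D : weak_derivs f D ->
  sqrte (\sum_(a : multi_index d r | (mi_order a <= r)%N) L2norm (D a) ^+ 2)%E =
  (deriv_norm D)%:E.
Proof.
move=> [_ H]; rewrite (eq_bigr (fun a => (nrm (D a) ^+ 2)%:E)); last first.
  by move=> a ar; have [/L2p_L2box La _] := H a ar; rewrite (L2norm_nrm La).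
by rewrite sumEFin.
Qed.

(** The pure derivatives are among those summed in the Sobolev norm; they are
    distinct because [r > 0]. *)
Lemma proj_deriv_norm f D N : (0 < N)%N -> weak_derivs f D ->
  N%:R ^+ r * nrm (fun v => f v - trig_proj N f v) <= deriv_norm D.
Proof.
move=> N0 fD; have Np : 0 < N%:R ^+ r :> R by rewrite exprn_gt0// ltr0n.
rewrite mulrC -ler_pdivlMr//; apply: le_trans (proj_error fD N0) _.
apply: ler_wpM2r; first by rewrite invr_ge0 ltW.
apply: ler_wsqrtr.
have pinj : injective (@pure_mi d r).
  move=> i j /ffunP/(_ i); rewrite !ffunE eqxx; case: eqP => // _ /(congr1 val)/=.
  by move=> r00; move: r0; rewrite r00.
rewrite -(@big_imset _ _ _ _ _ (@pure_mi d r) predT (fun a => nrm (D a) ^+ 2))/=;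
  last first.
  by move=> i j _ _; exact: pinj.
rewrite big_mkcond [leRHS]big_mkcond; apply: ler_sum => a _.
case: ifPn => [/imsetP[j _ ->]|_]; first by rewrite mi_order_pure leqnn.
by case: ifP => // _; rewrite sqr_ge0.
Qed.

Lemma nrm_deriv_norm f D : weak_derivs f D -> nrm f <= deriv_norm D.
Proof.
move=> fD; pose a0 : multi_index d r := [ffun=> ord0].
have a00 : mi_order a0 = 0%N by rewrite /mi_order big1// => i _; rewrite ffunE.
apply: le_trans (nrm_weak_deriv0 fD a00) _.
rewrite -(ger0_norm (nrm_ge0 (D a0))) -sqrtr_sqr; apply: ler_wsqrtr.
rewrite (bigD1 a0)/= ?a00// lerDl; apply: sumr_ge0 => a _; exact: sqr_ge0.
Qed.

Lemma nrm_Hnorm f : ((nrm f)%:E <= Hnorm r f)%E.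
Proof.
apply: le_ereal_inf_tmp => _ [D fD <-].
by rewrite (deriv_norm_sqrte fD) lee_fin nrm_deriv_norm.
Qed.

Lemma proj_Hnorm f N : (0 < N)%N ->
  ((N%:R ^+ r * nrm (fun v => f v - trig_proj N f v))%:E <= Hnorm r f)%E.
Proof.
move=> N0; apply: le_ereal_inf_tmp => _ [D fD <-].
by rewrite (deriv_norm_sqrte fD) lee_fin proj_deriv_norm.
Qed.

Lemma Hnorm_fin f : Hp r f -> Hnorm r f \is a fin_num.
Proof.
move=> [D fD]; rewrite ge0_fin_numE; last first.
  by apply: le_trans (nrm_Hnorm f); rewrite lee_fin nrm_ge0.
apply: le_lt_trans (ltry (deriv_norm D)).
by rewrite -(deriv_norm_sqrte fD); apply: ereal_inf_lbound; exists D.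
Qed.

End sobolev_norm.

(** * Moments of trigonometric polynomials of degree one *)

Section one_dim_moments.
Context (R : realType).
Local Notation leb := (@lebesgue_measure R).
Implicit Types x : R.

Let cid : continuous (fun x => x). Proof. by move=> x; exact: cvg_id. Qed.
Let csin : continuous (@sin R). Proof. exact: continuous_sin. Qed.
Let ccos : continuous (@cos R). Proof. exact: continuous_cos. Qed.

Let cM (f g : R -> R) : continuous f -> continuous g -> continuous (fun x => f x * g x).
Proof. by move=> cf cg x; exact: (continuousM (cf x) (cg x)). Qed.

Lemma Rintegral_pi_id : \int[leb]_(x in `[- pi, pi]) x = 0 :> R.
Proof.
have dF x : is_derive x 1 (2^-1 *: (id * id)) x.
  by apply: is_derive_eq; rewrite /GRing.scale/=; field.
by rewrite (Rintegral_pi_FTC dF)// !fctE /GRing.scale/= mulrNN subrr.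
Qed.

Lemma integral_sin : \int[leb]_(x in `[- pi, pi]) sin x = 0 :> R.
Proof.
have dF x : is_derive x 1 (- cos) (sin x).
  by apply: is_derive_eq; rewrite opprK.
by rewrite (Rintegral_pi_FTC dF)// !fctE cosN subrr.
Qed.

Lemma integral_cos : \int[leb]_(x in `[- pi, pi]) cos x = 0 :> R.
Proof.
have dF x : is_derive x 1 sin (cos x) by exact: is_derive_sin.
by rewrite (Rintegral_pi_FTC dF)// sinN sinpi oppr0 subr0.
Qed.

Lemma integral_sin_id : \int[leb]_(x in `[- pi, pi]) (sin x * x) = pi *+ 2 :> R.
Proof.
have dF x : is_derive x 1 (sin - id * cos) (sin x * x).
  by apply: is_derive_eq; rewrite ?fctE /GRing.scale/=; ring.
rewrite (Rintegral_pi_FTC dF); last exact: cM.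
by rewrite !fctE sinN cosN sinpi cospi; ring.
Qed.

Lemma integral_cos_id : \int[leb]_(x in `[- pi, pi]) (cos x * x) = 0 :> R.
Proof.
have dF x : is_derive x 1 (cos + id * sin) (cos x * x).
  by apply: is_derive_eq; rewrite ?fctE /GRing.scale/=; ring.
rewrite (Rintegral_pi_FTC dF); last exact: cM.
by rewrite !fctE sinN cosN sinpi cospi; ring.
Qed.

Lemma integral_sin_sqr : \int[leb]_(x in `[- pi, pi]) (sin x * x ^+ 2) = 0 :> R.
Proof.
have dF x : is_derive x 1 (2 *: cos + 2 *: (id * sin) - id * (id * cos)) (sin x * x ^+ 2).
  by apply: is_derive_eq; rewrite ?fctE /GRing.scale/=; ring.
rewrite (Rintegral_pi_FTC dF); last by apply: cM => // x; apply: exprn_continuous.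
by rewrite !fctE /GRing.scale/= sinN cosN sinpi cospi; ring.
Qed.

Lemma integral_cos_sqr :
  \int[leb]_(x in `[- pi, pi]) (cos x * x ^+ 2) = - (pi *+ 4) :> R.
Proof.
have dF x : is_derive x 1 (id * (id * sin) + 2 *: (id * cos) - 2 *: sin) (cos x * x ^+ 2).
  by apply: is_derive_eq; rewrite ?fctE /GRing.scale/=; ring.
rewrite (Rintegral_pi_FTC dF); last by apply: cM => // x; apply: exprn_continuous.
by rewrite !fctE /GRing.scale/= sinN cosN sinpi cospi; ring.
Qed.

End one_dim_moments.

Section moment_maps.
Context (R : realType) (d : nat).
Local Notation rV := 'rV[R]_d.
Local Notation L := (lebesgue_rV R d).
Local Notation leb := (@lebesgue_measure R).
Implicit Types f g : rV -> R.
Implicit Types i j : 'I_d.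

(** A function of [v_i] times a function of [v_j] is a product of one-variable
    functions, also when [i = j]. *)
Lemma inner_coord (a b : R -> R) i j : continuous a -> continuous b ->
  inner (fun v : rV => a (v ord0 i)) (fun v => b (v ord0 j)) =
  \prod_k \int[leb]_(x in `[- pi, pi])
     ((if k == i then a x else 1) * (if k == j then b x else 1)).
Proof.
move=> ca cb.
pose g (k : 'I_d) x := (if k == i then a x else 1) * (if k == j then b x else 1).
have cif (e : bool) (h : R -> R) : continuous h ->
  continuous (fun x => if e then h x else 1).
  by case: e => // _; exact: cst_continuous.
have cg k : continuous (g k).
  by move=> x; exact: (continuousM (cif _ _ ca x) (cif _ _ cb x)).
have [|_ <-] := @integrable_Rintegral_box R d g.
  by move=> k; exact: integrable_pi.
apply: eq_Rintegral => v _; rewrite big_split/=; congr (_ * _).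
  by rewrite (bigD1 i)//= eqxx big1 ?mulr1// => k /negbTE ->.
by rewrite (bigD1 j)//= eqxx big1 ?mulr1// => k /negbTE ->.
Qed.

Lemma inner_coord_diag (a b : R -> R) i : continuous a -> continuous b ->
  inner (fun v : rV => a (v ord0 i)) (fun v => b (v ord0 i)) =
  \int[leb]_(x in `[- pi, pi]) (a x * b x) * (pi *+ 2) ^+ d.-1.
Proof.
move=> ca cb; rewrite inner_coord// (bigD1 i)//=; congr (_ * _).
  by under eq_Rintegral do rewrite eqxx.
rewrite (eq_bigr (fun=> pi *+ 2)); last first.
  move=> k /negbTE ki; rewrite -Rintegral_pi_cst1.
  by apply: eq_Rintegral => x _; rewrite ki mulr1.
by rewrite prodr_const cardC1 card_ord.
Qed.

Lemma inner_coord_off (a b : R -> R) i j : continuous a -> continuous b -> i != j ->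
  \int[leb]_(x in `[- pi, pi]) a x = 0 ->
  inner (fun v : rV => a (v ord0 i)) (fun v => b (v ord0 j)) = 0.
Proof.
move=> ca cb ij a0; rewrite inner_coord// (bigD1 i)//=.
rewrite (_ : Rintegral _ _ _ = 0) ?mul0r// -a0.
by apply: eq_Rintegral => x _; rewrite eqxx (negbTE ij) mulr1.
Qed.

Definition moment_fun (j : 'I_(1 + d + 1)) : rV -> R := fun v => Phi v ord0 j.

Lemma momentsE f (j : 'I_(1 + d + 1)) : moments f ord0 j = inner f (moment_fun j).
Proof. by rewrite mxE. Qed.

Lemma moment_fun_one : moment_fun (lshift 1 (lshift d ord0)) = fun=> 1.
Proof. by apply/funext => v; rewrite /moment_fun /Phi !row_mxEl mxE eqxx. Qed.

Lemma moment_fun_coord i : moment_fun (lshift 1 (rshift 1 i)) = fun v => v ord0 i.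
Proof. by apply/funext => v; rewrite /moment_fun /Phi row_mxEl row_mxEr. Qed.

Lemma moment_fun_sqr : moment_fun (rshift (1 + d) ord0) = fun v => \sum_i 1 * v ord0 i ^+ 2.
Proof.
apply/funext => v; rewrite /moment_fun /Phi row_mxEr mxE eqxx sqr_sqrtr.
  by apply: eq_bigr => i _; rewrite mul1r expr2.
by apply: sumr_ge0 => i _; rewrite -expr2 sqr_ge0.
Qed.

Lemma L2box_coord i (a : R -> R) : continuous a -> L2box (fun v : rV => a (v ord0 i)).
Proof.
move=> ca; have [x xpi Hx] : exists2 x, x \in `[- pi, pi]%R & forall t, t \in `[- pi,
  pi]%R -> `|a t| <= `|a x|.
  have p0 := @pi_gt0 R; apply: (@EVT_max R (fun t => `|a t|)); first by lra.
  apply: continuous_subspaceT => t; apply: continuous_comp; first exact: ca.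
  exact: norm_continuous.
apply: (@L2box_bounded _ _ _ `|a x|).
  apply: (measurableT_comp (continuous_measurable_fun ca)); exact: measurable_coord.
by move=> v vb; apply: Hx; rewrite in_itv; exact: vb.
Qed.

Let cid : continuous (fun x : R => x). Proof. by move=> x; exact: cvg_id. Qed.

Lemma L2box_moment_fun (j : 'I_(1 + d + 1)) : L2box (moment_fun j).
Proof.
have [k ->|k ->] := split_ordP (j : 'I_(1 + d + 1)).
  have [l ->|l ->] := split_ordP (k : 'I_(1 + d)).
    by rewrite (ord1 l) moment_fun_one; exact: L2box_cst.
  by rewrite moment_fun_coord; exact: (L2box_coord _ cid).
rewrite (ord1 k) moment_fun_sqr; apply: L2box_sum => i.
exact: (L2box_coord i (@exprn_continuous R 2)).
Qed.

End moment_maps.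

Section corrections.
Context (R : realType) (d : nat).
Local Notation rV := 'rV[R]_d.
Local Notation L := (lebesgue_rV R d).
Local Notation leb := (@lebesgue_measure R).
Implicit Types f g : rV -> R.
Implicit Types i : 'I_d.
Local Notation mom := 'I_(1 + d + 1).
Local Notation mom_coord i := (lshift 1 (rshift 1 i)).
Local Notation mom_sqr := (rshift (1 + d) ord0).

Let V : R := (pi *+ 2) ^+ d.-1 * (pi *+ 2).

Let V_neq0 : V != 0.
Proof. by rewrite /V mulf_neq0 ?expf_neq0// gt_eqF// pmulrn_rgt0// pi_gt0. Qed.

Let cid : continuous (fun x : R => x). Proof. by move=> x; exact: cvg_id. Qed.
Let cc1 : continuous (fun x : R => 1 : R). Proof. exact: cst_continuous. Qed.
Let csin := @continuous_sin R.
Let ccos := @continuous_cos R.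
Let csqr := @exprn_continuous R 2.

(** [cos v_i] is even with mean 0, so it is orthogonal to the other invariants,
    and it sees only the term [v_i^2] of the energy. *)
Lemma inner_cos_moment_fun i (l : mom) :
  inner (fun v : rV => cos (v ord0 i)) (@moment_fun R d l) =
    (l == mom_sqr)%:R * (- (V *+ 2)).
Proof.
have [k ->|k ->] := split_ordP (l : 'I_(1 + d + 1)).
  rewrite eq_lrshift mul0r.
  have [m ->|m ->] := split_ordP (k : 'I_(1 + d)).
    rewrite (ord1 m) moment_fun_one (inner_coord_diag i ccos cc1).
    under eq_Rintegral do rewrite mulr1.
    by rewrite integral_cos mul0r.
  rewrite moment_fun_coord; have [->|im] := eqVneq i m.
    by rewrite (inner_coord_diag m ccos cid) integral_cos_id mul0r.
  exact: (inner_coord_off ccos cid im (integral_cos R)).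
rewrite (ord1 k) eqxx mul1r moment_fun_sqr inner_sumr; last 2 first.
- by move=> j; exact: (L2box_coord j csqr).
- exact: (L2box_coord i ccos).
rewrite (bigD1 i)//= big1 ?addr0 => [|j ji]; last first.
  by rewrite (inner_coord_off ccos csqr _ (integral_cos R)) ?mulr0// eq_sym.
rewrite (inner_coord_diag i ccos csqr) integral_cos_sqr /V; ring.
Qed.

(** [sin v_i] is odd in [v_i], and it sees only the momentum [v_i]. *)
Lemma inner_sin_moment_fun i (l : mom) :
  inner (fun v : rV => sin (v ord0 i)) (@moment_fun R d l) = (l == mom_coord i)%:R * V.
Proof.
have [k ->|k ->] := split_ordP (l : 'I_(1 + d + 1)).
  have [m ->|m ->] := split_ordP (k : 'I_(1 + d)).
    rewrite (inj_eq (@lshift_inj _ _)) eq_lrshift mul0r.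
    rewrite (ord1 m) moment_fun_one (inner_coord_diag i csin cc1).
    under eq_Rintegral do rewrite mulr1.
    by rewrite integral_sin mul0r.
  rewrite (inj_eq (@lshift_inj _ _)) (inj_eq (@rshift_inj _ _)) moment_fun_coord.
  have [->|im] := eqVneq m i.
    by rewrite (inner_coord_diag i csin cid) integral_sin_id mul1r mulrC.
  by rewrite mul0r (inner_coord_off csin cid _ (integral_sin R))// eq_sym.
rewrite eq_rlshift mul0r (ord1 k) moment_fun_sqr inner_sumr; last 2 first.
- by move=> j; exact: (L2box_coord j csqr).
- exact: (L2box_coord i csin).
rewrite big1// => j _; have [->|im] := eqVneq j i.
  by rewrite (inner_coord_diag i csin csqr) integral_sin_sqr mul0r mulr0.
by rewrite (inner_coord_off csin csqr _ (integral_sin R)) ?mulr0// eq_sym.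
Qed.

Lemma inner_one_coord i : inner (fun=> 1) (fun v : rV => v ord0 i) = 0.
Proof.
rewrite innerC (inner_coord_diag i cid cc1).
by under eq_Rintegral do rewrite mulr1; rewrite Rintegral_pi_id mul0r.
Qed.

Lemma inner_one_one i : inner (fun=> 1) (fun _ : rV => 1) = V.
Proof.
rewrite (inner_coord_diag i cc1 cc1).
under eq_Rintegral do rewrite mulr1.
by rewrite Rintegral_pi_cst1 mulrC.
Qed.

(** Trigonometric polynomials of degree 1 biorthogonal to the collision invariants.
    The moments of 1, [sin v_i] and [cos v_i] form a triangular matrix: only the
    constant 1 has two nonzero moments, mass and energy, and its energy is cancelled
    by a multiple of the cosine. *)
Lemma dual_moments : (0 < d)%N -> exists tau : mom -> rV -> R,
  forall j, trig_poly 1 (tau j) /\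
    forall l, inner (tau j) (@moment_fun R d l) = (l == j)%:R.
Proof.
move=> d0; pose i0 : 'I_d := Ordinal d0.
suff H (j : mom) : exists t : rV -> R, trig_poly 1 t /\
    forall l, inner t (@moment_fun R d l) = (l == j)%:R.
  by have [tau Htau] := choice H; exists tau.
have Lc : L2box (fun v : rV => cos (v ord0 i0)) by exact: (L2box_coord i0 ccos).
have [k ->|k ->] := split_ordP (j : 'I_(1 + d + 1)); last first.
  exists (fun v => - (V *+ 2)^-1 * cos (v ord0 i0)); split.
    exact: trig_poly_scale (@trig_poly_cos _ _ _).
  move=> l; rewrite innerZl//; last exact: L2box_moment_fun.
  rewrite inner_cos_moment_fun (ord1 k) mulrCA mulrNN mulVf ?mulr1//.
  by rewrite mulrn_eq0.
have [m ->|m ->] := split_ordP (k : 'I_(1 + d)); last first.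
  exists (fun v => V^-1 * sin (v ord0 m)); split.
    exact: trig_poly_scale (@trig_poly_sin _ _ _).
  move=> l; rewrite innerZl//; [|exact: (L2box_coord m csin)|exact: L2box_moment_fun].
  by rewrite inner_sin_moment_fun mulrCA mulVf ?mulr1.
pose a := inner (fun=> 1) (@moment_fun R d mom_sqr).
exists (fun v => V^-1 * 1 + (a / V / (V *+ 2)) * cos (v ord0 i0)); split.
  apply: trig_poly_add; apply: trig_poly_scale; first exact: trig_poly_cst.
  exact: trig_poly_cos.
move=> l; have Ll := @L2box_moment_fun R d l; have L1 := @L2box_cst R d 1.
rewrite innerDl// ?innerZl//; [|exact: L2boxZ..].
rewrite inner_cos_moment_fun (ord1 m).
have [k' ->|k' ->] := split_ordP (l : 'I_(1 + d + 1)).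
  rewrite eq_lrshift mul0r mulr0 addr0.
  have [m' ->|m' ->] := split_ordP (k' : 'I_(1 + d)).
    by rewrite (ord1 m') eqxx moment_fun_one (inner_one_one i0) mulVf.
  by rewrite (inj_eq (@lshift_inj _ _)) eq_rlshift moment_fun_coord inner_one_coord mulr0.
rewrite (ord1 k') eqxx eq_rlshift mul1r -/a.
rewrite mulrN mulfVK ?mulrn_eq0//= mulrC subrr//.
Qed.

End corrections.

(** * Best approximation under moment constraints *)

Section constrained_best_approximation.
Context (R : realType) (d : nat).
Hypothesis d0 : (0 < d)%N.
Local Notation rV := 'rV[R]_d.
Local Notation mom := 'I_(1 + d + 1).
Local Notation moment_fun := (@moment_fun R d).
Implicit Types f g h : rV -> R.

Lemma momentsP f (m : 'rV[R]_(1 + d + 1)) :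
  moments f = m <-> forall l, inner f (moment_fun l) = m ord0 l.
Proof.
split => [<- l|H]; first by rewrite momentsE.
by apply/rowP => l; rewrite -H -momentsE.
Qed.

Definition dual_moment : mom -> rV -> R := sval (cid (@dual_moments R d d0)).

Lemma trig_poly_dual N j : (0 < N)%N -> trig_poly N (dual_moment j).
Proof.
by move=> N0; have [+ _] := svalP (cid (@dual_moments R d d0)) j; exact: trig_poly_mono.
Qed.

Lemma inner_dual j l : inner (dual_moment j) (moment_fun l) = (l == j)%:R.
Proof. by have [_] := svalP (cid (@dual_moments R d d0)) j; exact. Qed.

Lemma L2box_dual j : L2box (dual_moment j).
Proof. exact: trig_poly_L2box (@trig_poly_dual 1 j isT). Qed.

Definition moment_lift (m : mom -> R) (v : rV) := \sum_j m j * dual_moment j v.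

Lemma trig_poly_lift N m : (0 < N)%N -> trig_poly N (moment_lift m).
Proof.
move=> N0; rewrite /moment_lift.
have : forall s : seq mom, trig_poly N (fun v => \sum_(j <- s) m j * dual_moment j v).
  elim=> [|j s IH].
    have := @trig_poly_cst R d N 0; congr trig_poly.
    by apply/funext => v; rewrite big_nil.
  have := trig_poly_add (trig_poly_scale (m j) (@trig_poly_dual N j N0)) IH.
  by congr trig_poly; apply/funext => v; rewrite big_cons.
exact.
Qed.

Lemma L2box_lift m : L2box (moment_lift m).
Proof. exact: trig_poly_L2box (@trig_poly_lift 1 m isT). Qed.

Lemma inner_lift m l : inner (moment_lift m) (moment_fun l) = m l.
Proof.
rewrite inner_suml; [|exact: L2box_dual|exact: L2box_moment_fun].
rewrite (bigD1 l)//= inner_dual eqxx mulr1 big1 ?addr0// => j jl.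
by rewrite inner_dual eq_sym (negbTE jl) mulr0.
Qed.

Definition lift_const : R := \sum_j nrm (dual_moment j).

Lemma lift_const_ge0 : 0 <= lift_const.
Proof. by apply: sumr_ge0 => j _; exact: nrm_ge0. Qed.

Lemma nrm_lift m (M : R) : (forall j, `|m j| <= M) -> nrm (moment_lift m) <= lift_const * M.
Proof.
move=> mM; rewrite /moment_lift /lift_const.
have : forall s : seq mom, L2box (fun v => \sum_(j <- s) m j * dual_moment j v) /\
  nrm (fun v => \sum_(j <- s) m j * dual_moment j v) <=
    (\sum_(j <- s) nrm (dual_moment j)) * M.
  elim=> [|j s [IHL IH]].
    have -> : (fun v => \sum_(j <- [::]) m j * dual_moment j v) = fun=> 0 * 0.
      by apply/funext => v; rewrite big_nil mul0r.
    split; first exact: L2box_cst.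
    by rewrite (nrmZ 0 (L2box_cst d (0 : R))) normr0 big_nil !mul0r.
  have Lj := L2boxZ (m j) (L2box_dual j).
  have E : (fun v => \sum_(i <- j :: s) m i * dual_moment i v) =
     fun v => m j * dual_moment j v + \sum_(i <- s) m i * dual_moment i v.
    by apply/funext => v; rewrite big_cons.
  rewrite E; split; first exact: L2boxD.
  apply: le_trans (nrmD Lj IHL) _; rewrite big_cons mulrDl; apply: lerD => //.
  rewrite nrmZ; last exact: L2box_dual.
  by rewrite mulrC; apply: ler_wpM2l => //; exact: nrm_ge0.
by move=> /(_ (index_enum mom))[].
Qed.

Section fixed_degree.
Variable N : nat.
Hypothesis N0 : (0 < N)%N.

Definition centred_basis k (v : rV) :=
  trign k v - moment_lift (fun l => inner (trign k) (moment_fun l)) v.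

(** For a function without moments, the corrections subtracted from the basis
    functions cancel by linearity. *)
Lemma centred_spans t : trig_poly N t -> (forall l, inner t (moment_fun l) = 0) ->
  exists x, t = fun v => \sum_(k <- freqs d N) x k * centred_basis k v.
Proof.
move=> /trig_poly_sum[x tE] t0; exists x; apply/funext => v.
under eq_bigr do rewrite mulrBr.
rewrite sumrB [X in _ = _ - X](_ : _ = 0) ?subr0 ?tE//.
rewrite /moment_lift; under eq_bigr do rewrite mulr_sumr.
rewrite exchange_big/= big1// => j _.
have := t0 j; rewrite tE inner_suml; [|by move=> k;
  exact: L2box_trign|exact: L2box_moment_fun].
move=> /(congr1 (fun y => y * dual_moment j v)); rewrite mul0r mulr_suml => H.
by rewrite -[RHS]H; apply: eq_bigr => k _; rewrite mulrA.
Qed.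

(** The linear space that directs the affine space of competitors. *)
Let V0 t := trig_poly N t /\ forall l, inner t (moment_fun l) = 0.

Let L2box_V0 t : V0 t -> L2box t. Proof. by case=> /trig_poly_L2box. Qed.

Let V0_lin c f g : V0 f -> V0 g -> V0 (fun v => f v + c * g v).
Proof.
move=> Vf Vg; have [Nf f0] := Vf; have [Ng g0] := Vg.
have Lf := L2box_V0 Vf; have Lg := L2box_V0 Vg; split.
  by apply: trig_poly_add => //; exact: trig_poly_scale.
move=> l; have Ll := @L2box_moment_fun R d l.
rewrite (innerDl Lf (L2boxZ c Lg) Ll) (innerZl c Lg Ll) f0 g0 mulr0 addr0//.
Qed.

Let V0_0 : V0 (fun=> 0).
Proof.
split; first exact: trig_poly_cst.
move=> l; rewrite (_ : (fun=> 0) = fun _ : rV => 0 * 0).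
  by rewrite innerZl ?mul0r//; [exact: L2box_cst|exact: L2box_moment_fun].
by apply/funext => v; rewrite mulr0.
Qed.

Let V0_basis k : k \in freqs d N -> V0 (centred_basis k).
Proof.
move=> kN; have Lm := L2box_lift (fun l => inner (trign k) (moment_fun l)).
split.
  have := trig_poly_add (trig_poly_trign R (N := N) (k := k) _)
    (trig_poly_scale (-1) (trig_poly_lift (fun l => inner (trign k) (moment_fun l)) N0)).
  rewrite -mem_freqs => /(_ kN); congr trig_poly; apply/funext => v.
  by rewrite mulN1r.
move=> l; rewrite (innerBl (L2box_trign _ _) Lm (@L2box_moment_fun R d l)).
by rewrite inner_lift subrr.
Qed.

Lemma moment_free_projection h : L2box h ->
  exists p, V0 p /\ forall t, V0 t -> inner (fun v => h v - p v) t = 0.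
Proof.
move=> Lh; pose s := map centred_basis (freqs d N).
have sP e : List.In e s -> exists2 k, k \in freqs d N & e = centred_basis k.
  rewrite /s; elim: (freqs d N) => //= k r IH [<-|/IH[l lr ->]].
    by exists k => //; rewrite mem_head.
  by exists l => //; rewrite inE lr orbT.
have Ps k : k \in freqs d N -> List.In (centred_basis k) s.
  rewrite /s; elim: (freqs d N) => //= l r IH; rewrite inE => /orP[/eqP ->|/IH];
    [by left|by right].
have sV e : List.In e s -> V0 e by move=> /sP[k kN ->]; exact: V0_basis.
have [p [Vp ps _]] := orthogonal_projection V0_0 V0_lin L2box_V0 sV Lh.
exists p; split => // t [Nt t0]; have [x ->] := centred_spans Nt t0.
have Lc k : L2box (centred_basis k).
  by apply: L2boxB; [exact: L2box_trign|exact: L2box_lift].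
rewrite inner_sumr//; last exact: L2boxB Lh (L2box_V0 Vp).
by rewrite big_seq big1// => k kN; rewrite ps ?mulr0//; exact: Ps.
Qed.

(** The competitors form an affine space of finite dimension. The foot of the
    perpendicular from [h] is a minimizer, so the choice made by [argmin] is one too;
    minimizers are equal only almost everywhere, and only the inequality is used. *)
Lemma argmin_moments h m : L2box h ->
  let A := [set g | trig_poly N g /\ moments g = m] in
  let p := argmin (cst 0) (fun g => L2norm (g \- h)%R ^+ 2)%E A in
  A p /\ forall g, A g -> nrm (fun v => h v - p v) <= nrm (fun v => h v - g v).
Proof.
move=> Lh A p.
have LA g : A g -> L2box g by case=> /trig_poly_L2box.
have J g : A g -> (L2norm (g \- h)%R ^+ 2 = (nrm (fun v => h v - g v) ^+ 2)%:E)%E.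
  move=> /LA Lg; rewrite (nrmB_sym Lh Lg) -[LHS]/(_ ^+ _)%E.
  by rewrite (_ : (g \- h)%R = fun v => g v - h v)// (L2norm_nrm (L2boxB Lg Lh)).
have [q [Aq qmin]] : exists q, A q /\ forall g, A g ->
    nrm (fun v => h v - q v) <= nrm (fun v => h v - g v).
  (* The competitors are g0 plus the functions without moments. *)
  pose g0 := moment_lift (m ord0).
  have Lg0 : L2box g0 by exact: L2box_lift.
  have Ng0 : trig_poly N g0 by exact: trig_poly_lift.
  have [p0 [Vp0 Hp0]] := moment_free_projection (L2boxB Lh Lg0).
  have Lp0 := L2box_V0 Vp0.
  pose q v := g0 v + p0 v.
  have Aq : A q.
    split; first by apply: trig_poly_add => //; case: Vp0.
    apply/momentsP => l; rewrite (innerDl Lg0 Lp0 (@L2box_moment_fun R d l)).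
    by rewrite inner_lift Vp0.2 addr0.
  exists q; split => // g Ag; have Lq := LA _ Aq; have Lg := LA _ Ag.
  apply: orthogonal_nrm_le => //.
  rewrite (_ : (fun v => h v - q v) = fun v => h v - g0 v - p0 v); last first.
    by apply/funext => v; rewrite /q opprD addrA.
  apply: Hp0; split.
    have := trig_poly_add Aq.1 (trig_poly_scale (-1) Ag.1).
    by congr trig_poly; apply/funext => v; rewrite mulN1r.
  move=> l; rewrite (innerBl Lq Lg (@L2box_moment_fun R d l)).
  by rewrite ((momentsP _ _).1 Aq.2) ((momentsP _ _).1 Ag.2) subrr.
have [|Ap pmin] := @xgetPex _ (cst 0) [set x | A x /\ forall y, A y ->
    (L2norm (x \- h)%R ^+ 2 <= L2norm (y \- h)%R ^+ 2)%E].
  exists q; split => // g Ag; rewrite !J// lee_fin lerXn2r ?nnegrE ?nrm_ge0//.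
  exact: qmin.
split => // g Ag; have := pmin _ Ag; rewrite !J// lee_fin.
by rewrite ler_pXn2r ?nnegrE ?nrm_ge0.
Qed.

End fixed_degree.
End constrained_best_approximation.

(** * Errors of the constrained approximations *)

Section constrained_errors.
Context (R : realType) (d : nat).
Hypothesis d0 : (0 < d)%N.
Local Notation rV := 'rV[R]_d.
Local Notation moment_fun := (@moment_fun R d).
Local Notation lift_const := (@lift_const R d d0).
Implicit Types f g h : rV -> R.

Definition moment_const : R := \sum_j nrm (moment_fun j).

Lemma moment_const_ge0 : 0 <= moment_const.
Proof. by apply: sumr_ge0 => j _; exact: nrm_ge0. Qed.

Lemma inner_moment_fun_le f j : L2box f ->
  `|inner f (moment_fun j)| <= nrm f * moment_const.
Proof.
move=> Lf; apply: le_trans (inner_CS Lf (@L2box_moment_fun R d j)) _.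
apply: ler_wpM2l; first exact: nrm_ge0.
by rewrite /moment_const (bigD1 j)//= lerDl; apply: sumr_ge0 => i _; exact: nrm_ge0.
Qed.

(** Compare the minimizer with the Fourier projection of [h], corrected to have
    the required moments. *)
Lemma argmin_error N h (m : 'rV[R]_(1 + d + 1)) (M : R) : (0 < N)%N -> L2box h ->
  (forall j, `|inner (trig_proj N h) (moment_fun j) - m ord0 j| <= M) ->
  nrm (fun v => h v - argmin (cst 0) (fun g => L2norm (g \- h)%R ^+ 2)%E
    [set g | trig_poly N g /\ moments g = m] v) <=
  nrm (fun v => h v - trig_proj N h v) + lift_const * M.
Proof.
move=> N0 Lh hM.
pose c j := m ord0 j - inner (trig_proj N h) (moment_fun j).
have Lc := L2box_lift d0 c; have Lp := L2box_proj N h.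
have Np := trig_poly_proj N h.
pose g v := trig_proj N h v + moment_lift d0 c v.
have Lg : L2box g by exact: L2boxD.
have [_ /(_ g)] := argmin_moments d0 N0 m Lh.
move=> /(_ _)/le_trans; apply.
  split; first by apply: trig_poly_add => //; exact: trig_poly_lift.
  apply/momentsP => l; rewrite (innerDl Lp Lc (@L2box_moment_fun R d l)) inner_lift.
  by rewrite /c addrC subrK.
apply: le_trans (nrm_triangle Lh Lp Lg) _; rewrite lerD2l.
rewrite nrmB_sym// (_ : (fun v => _) = moment_lift d0 c); last first.
  by apply/funext => v; rewrite /g addrAC subrr add0r.
by apply: nrm_lift => j; rewrite /c distrC.
Qed.

Definition constraint_const : R := 1 + lift_const * moment_const.

Lemma constraint_const_ge1 : 1 <= constraint_const.
Proof.
by rewrite /constraint_const lerDl mulr_ge0 ?moment_const_ge0// lift_const_ge0.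
Qed.

Lemma cons_proj_error N f : (0 < N)%N -> L2box f ->
  nrm (fun v => f v - cons_proj N f v) <=
  constraint_const * nrm (fun v => f v - trig_proj N f v).
Proof.
move=> N0 Lf; have Lp := L2box_proj N f.
apply: (@le_trans _ _ (nrm (fun v => f v - trig_proj N f v) +
   lift_const * (nrm (fun v => f v - trig_proj N f v) * moment_const))).
  apply: argmin_error => // j; rewrite momentsE -(innerBl Lp Lf (@L2box_moment_fun R d j)).
  by rewrite (nrmB_sym Lf Lp); apply: inner_moment_fun_le; exact: L2boxB.
by rewrite /constraint_const; lra.
Qed.

Lemma trig_poly_cons_proj N f : (0 < N)%N -> L2box f -> trig_poly N (cons_proj N f).
Proof. by move=> N0 Lf; have [[]] := argmin_moments d0 N0 (moments f) Lf. Qed.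

Lemma trig_poly_Qc cs rho N f : (0 < N)%N -> L2box (Q cs rho f) ->
  trig_poly N (Qc cs rho N f).
Proof. by move=> N0 Lf; have [[]] := argmin_moments d0 N0 0 Lf. Qed.

(** The moments of the projection of [Q cs rho f] are split along
    [P_N q - q], [q - h] and [h]. In the application [h] is the operator applied to the
    original function, whose moments are small by hypothesis. *)
Lemma Qc_error cs rho N f (h : rV -> R) : (0 < N)%N ->
  L2box (Q cs rho f) -> L2box h ->
  nrm (fun v => Q cs rho f v - Qc cs rho N f v) <=
  constraint_const * nrm (fun v => Q cs rho f v - trig_proj N (Q cs rho f) v) +
  lift_const * (moment_const * nrm (fun v => h v - Q cs rho f v) + enorm (moments h)).
Proof.
move=> N0; set q := Q cs rho f => Lq Lh; have Lp := L2box_proj N q.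
set e := nrm (fun v => q v - trig_proj N q v).
set e' := nrm (fun v => h v - q v).
apply: (@le_trans _ _ (e + lift_const *
    (e * moment_const + (e' * moment_const + enorm (moments h))))); last first.
  by rewrite /constraint_const; lra.
apply: argmin_error => // j; rewrite mxE subr0.
have Lj := @L2box_moment_fun R d j.
have -> : inner (trig_proj N q) (moment_fun j) =
    inner (fun v => trig_proj N q v - q v) (moment_fun j) +
    (inner (fun v => q v - h v) (moment_fun j) + inner h (moment_fun j)).
  by rewrite !innerBl// ; ring.
rewrite /e /e' (nrmB_sym Lq Lp) (nrmB_sym Lh Lq).
apply: le_trans (ler_normD _ _) _; apply: lerD.
  by apply: inner_moment_fun_le; exact: L2boxB.
apply: le_trans (ler_normD _ _) _; apply: lerD.
  by apply: inner_moment_fun_le; exact: L2boxB.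
by rewrite -momentsE; exact: enorm_ge_coord.
Qed.

End constrained_errors.

(** * Spheres and polar coordinates *)

Lemma ge0_integral_mrestr d (T : measurableType d) (R : realType)
    (m : {measure set T -> \bar R}) (D : set T) (mD : measurable D)
    (f : T -> \bar R) : measurable_fun setT f -> (forall x, 0 <= f x)%E ->
  (\int[mrestr m mD]_x f x = \int[m]_(x in D) f x)%E.
Proof.
move=> mf f0.
rewrite (@ge0_negligible_integral _ _ _ (mrestr m mD) setT (~` D))//.
- rewrite setDE setCK setTI; apply: eq_measure_integral => A mA AD.
  by rewrite /= /mrestr setIidl.
- exact: measurableC.
- by rewrite /= /mrestr setICl measure0.
Qed.

Lemma measurable_bool_real d (T : measurableType d) (R : realType) (f : T -> bool) :
  measurable_fun setT f -> measurable_fun setT (fun x => (f x)%:R : R).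
Proof.
move=> mf; exact: (@measurableT_comp _ _ _ _ _ _ (fun b : bool => b%:R : R)).
Qed.

Section enorm_theory.
Context (R : realType) (n : nat).
Implicit Types v w : 'rV[R]_n.

Lemma enorm_ge0 v : 0 <= enorm v. Proof. exact: sqrtr_ge0. Qed.

Lemma enormZ (s : R) v : enorm (s *: v) = `|s| * enorm v.
Proof.
rewrite /enorm (_ : dotv (s *: v) (s *: v) = s ^+ 2 * dotv v v).
  by rewrite sqrtrM ?sqr_ge0// sqrtr_sqr.
rewrite /dotv mulr_sumr; apply: eq_bigr => i _; rewrite !mxE; ring.
Qed.

Lemma enorm_eq0 v : enorm v = 0 -> v = 0.
Proof.
move=> v0; apply/rowP => i; rewrite mxE; apply/eqP; rewrite -normr_le0 -v0.
exact: enorm_ge_coord.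
Qed.

Lemma enorm_gt0 v : v != 0 -> 0 < enorm v.
Proof.
move=> v0; rewrite lt_def enorm_ge0 andbT; apply: contra v0 => /eqP /enorm_eq0 ->.
by [].
Qed.

Lemma measurable_enormV : measurable_fun setT (fun v => (enorm v)^-1).
Proof.
rewrite (_ : (fun _ => _) = (@powR R ^~ (-1)) \o @enorm R n); last first.
  by apply/funext => v /=; rewrite powR_inv1// enorm_ge0.
by apply: (measurableT_comp (measurable_powR _)); exact: measurable_enorm.
Qed.

Lemma measurable_scale_rV d (T : measurableType d) (s : T -> R) (g : T -> 'rV[R]_n) :
  measurable_fun setT s -> measurable_fun setT g ->
  measurable_fun setT (fun x => s x *: g x).
Proof.
move=> ms mg; apply: measurable_fun_rVP => i.
rewrite (_ : (fun _ => _) = fun x => s x * g x ord0 i).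
  by apply: measurable_funM => //; exact: (measurableT_comp (measurable_coord i)).
by apply/funext => x; rewrite mxE.
Qed.

Lemma measurable_add_rV d (T : measurableType d) (f g : T -> 'rV[R]_n) :
  measurable_fun setT f -> measurable_fun setT g ->
  measurable_fun setT (fun x => f x + g x).
Proof.
move=> ms mg; apply: measurable_fun_rVP => i.
rewrite (_ : (fun _ => _) = fun x => f x ord0 i + g x ord0 i).
  by apply: measurable_funD; apply: (measurableT_comp (measurable_coord i)).
by apply/funext => x; rewrite mxE.
Qed.

Lemma measurable_opp_rV d (T : measurableType d) (g : T -> 'rV[R]_n) :
  measurable_fun setT g -> measurable_fun setT (fun x => - g x).
Proof.
move=> mg; rewrite (_ : (fun _ => _) = fun x => -1 *: g x).
  by apply: measurable_scale_rV => //; exact: measurable_cst.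
by apply/funext => x; rewrite scaleN1r.
Qed.

Lemma measurable_dotv d (T : measurableType d) (f g : T -> 'rV[R]_n) :
  measurable_fun setT f -> measurable_fun setT g ->
  measurable_fun setT (fun x => dotv (f x) (g x)).
Proof.
move=> mf mg; apply: measurable_sum => i.
by apply: measurable_funM; apply: (measurableT_comp (measurable_coord i)).
Qed.

(** Unfolds the cone measure. *)
Lemma ge0_integral_sphere (g : 'rV[R]_n -> \bar R) :
  measurable_fun setT g -> (forall v, 0 <= g v)%E ->
  (\int[sphere_measure R n]_w g w =
   n%:R%:E * \int[lebesgue_rV R n]_(x in eball n 1) g (unit_dir x))%E.
Proof.
move=> mg g0.
have mf := @measurable_unit_dir R n.
have mb := @measurable_eball R n 1.
pose m : {measure set 'rV[R]_n -> \bar R} := mscale (NngNum (ler0n R n))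
  (pushforward (mrestr (lebesgue_rV R n) mb) (@unit_dir R n)).
transitivity (\int[m mf]_w g w)%E.
  by apply: eq_measure_integral.
rewrite ge0_integral_mscale//=.
rewrite ge0_integral_pushforward//.
rewrite preimage_setT ge0_integral_mrestr//; last by move=> x; exact: g0.
exact: measurableT_comp.
Qed.

End enorm_theory.

Lemma measurable_rV_point0 (R : realType) (n : nat) :
  (0 < n)%N -> measurable [set (0 : 'rV[R]_n)].
Proof.
move=> n0; case: n n0 => // n _.
rewrite (_ : [set 0] = \bigcap_(i in [set: 'I_n.+1])
    ((fun v : 'rV[R]_n.+1 => v ord0 i) @^-1` [set 0])).
  apply: fin_bigcap_measurable => // i _.
  by rewrite -[X in measurable X]setTI; exact: measurable_coord.
apply/seteqP; split => [v -> i _ /=|v vk]; first by rewrite mxE.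
by apply/rowP => i; rewrite mxE; exact: (vk i).
Qed.

Lemma lebesgue_rV_point0 (R : realType) (n : nat) : (0 < n)%N ->
  lebesgue_rV R n [set 0] = 0%E.
Proof.
case: n => // n _.
have m0 : measurable [set v : 'rV[R]_n.+1 | v ord0 ord0 = 0].
  rewrite -[X in measurable X]setTI (_ : [set v | _] =
     (fun v : 'rV[R]_n.+1 => v ord0 ord0) @^-1` [set 0])//.
  exact: measurable_coord.
have mz := @measurable_rV_point0 R n.+1 isT.
apply: (subset_measure0 _ _ _ (@box_slice0 R n.+1 ord0 0)) => //.
  by apply: measurableI => //; exact: measurable_box.
move=> _ ->; split => /=; last by rewrite mxE.
by move=> i; rewrite mxE oppr_le0 pi_ge0.
Qed.

Lemma ge0_eq_integral_off0 (R : realType) (n : nat) (f g : 'rV[R]_n -> \bar R) :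
  (0 < n)%N ->
  measurable_fun setT f -> measurable_fun setT g ->
  (forall v, 0 <= f v)%E -> (forall v, 0 <= g v)%E ->
  (forall v, v != 0 -> f v = g v) ->
  (\int[lebesgue_rV R n]_v f v = \int[lebesgue_rV R n]_v g v)%E.
Proof.
move=> n0 mf mg f0 g0 fg; apply: ge0_ae_eq_integral => //.
have := lebesgue_rV_point0 R n0 => z0.
exists [set 0]; split => //.
  exact: measurable_rV_point0.
move=> v /=; have [->//|v0] := eqVneq v 0.
by move=> H; exfalso; apply: H => _; exact: fg.
Qed.

Section polar.
Context (R : realType) (n : nat) (n0 : (0 < n)%N).
Local Notation L := (lebesgue_rV R n).
Local Notation rV := 'rV[R]_n.

(** The volume of the unit ball, in the form in which it comes out of the
    changes of variables below. *)
Definition polar_const : \bar R :=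
  (\int[L]_p ((1 < enorm p)%R%:R * ((enorm p)^-1) ^+ n.*2)%:E)%E.

Lemma integral_eball (a : R) (f : rV -> \bar R) :
  (\int[L]_(v in eball n a) f v = \int[L]_v ((enorm v < a)%R%:R%:E * f v))%E.
Proof.
rewrite integral_mkcond; apply: eq_integral => v _; rewrite /patch.
have -> : (v \in eball n a) = (enorm v < a) by apply/idP/idP; rewrite inE.
by case: ifPn => _; rewrite ?mul1e ?mul0e.
Qed.

Lemma ge0_integral_scale (s : R) (f : rV -> \bar R) : 0 < s ->
  measurable_fun setT f -> (forall v, 0 <= f v)%E ->
  (\int[L]_v f v = \int[L]_v ((s ^+ n)%:E * f (s *: v)))%E.
Proof.
move=> s0 mf f0.
have ms : measurable_fun setT (fun v : rV => f (s *: v)).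
  apply: (measurableT_comp mf).
  by apply: measurable_scale_rV => //; exact: measurable_cst.
have k0 : (0 <= (s ^+ n)%:E :> \bar R)%E by rewrite lee_fin exprn_ge0// ltW.
rewrite (ge0_integralZl L measurableT ms (fun v _ => f0 _) k0).
have := ge0_integral_rV_affine 0 (lt0r_neq0 s0) mf f0.
rewrite (_ : (fun v : rV => f (s *: v + 0)) = (fun v => f (s *: v))); last first.
  by apply/funext => v; rewrite addr0.
move=> ->; rewrite muleA -EFinM gtr0_norm// divff ?mul1e//.
by rewrite expf_neq0// gt_eqF.
Qed.

Variables (a : R) (h : rV -> \bar R).
Hypothesis mh : measurable_fun setT h.
Hypothesis h0 : (forall v, 0 <= h v)%E.

(** The integrand in the variables [(q, x)]. *)
Let A (z : rV * rV) : \bar R :=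
  (((enorm z.1 < a)%R%:R * (enorm z.2 < 1)%R%:R)%:E * h (enorm z.1 *: unit_dir z.2))%E.
(** The same after [q = |x| p], in the variables [(x, p)]. *)
Let B (z : rV * rV) : \bar R :=
  (((enorm z.1 < 1)%R%:R * (enorm z.1 * enorm z.2 < a)%R%:R * enorm z.1 ^+ n)%:E *
   h (enorm z.2 *: z.1))%E.
(** The same after [y = |p| x], in the variables [(p, y)]. *)
Let C (z : rV * rV) : \bar R :=
  (((enorm z.2 < enorm z.1)%R%:R * ((enorm z.1)^-1 ^+ n.*2 * enorm z.2 ^+ n))%:E *
   ((enorm z.2 < a)%R%:R%:E * h z.2))%E.

Let me1 : measurable_fun setT (fun z : rV * rV => enorm z.1).
Proof. exact: (measurableT_comp (@measurable_enorm R n) measurable_fst). Qed.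
Let me2 : measurable_fun setT (fun z : rV * rV => enorm z.2).
Proof. exact: (measurableT_comp (@measurable_enorm R n) measurable_snd). Qed.
Let mv1 : measurable_fun setT (fun z : rV * rV => (enorm z.1)^-1).
Proof. exact: (measurableT_comp (@measurable_enormV R n) measurable_fst). Qed.

Let mA : measurable_fun setT A.
Proof.
apply: emeasurable_funM.
  apply/measurable_EFinP; apply: measurable_funM;
  by apply: measurable_bool_real; apply: measurable_fun_ltr.
apply: (measurableT_comp mh); apply: measurable_scale_rV => //.
exact: (measurableT_comp (@measurable_unit_dir R n) measurable_snd).
Qed.

Let mB : measurable_fun setT B.
Proof.
apply: emeasurable_funM.
  apply/measurable_EFinP; apply: measurable_funM; last exact: measurable_funX.
  by apply: measurable_funM; apply: measurable_bool_real; apply: measurable_fun_ltr => //;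
    apply: measurable_funM.
by apply: (measurableT_comp mh); apply: measurable_scale_rV.
Qed.

Let mC : measurable_fun setT C.
Proof.
apply: emeasurable_funM.
  apply/measurable_EFinP; apply: measurable_funM.
    by apply: measurable_bool_real; apply: measurable_fun_ltr.
  by apply: measurable_funM; exact: measurable_funX.
apply: emeasurable_funM; last exact: (measurableT_comp mh measurable_snd).
by apply/measurable_EFinP; apply: measurable_bool_real; apply: measurable_fun_ltr.
Qed.

Let A0 z : (0 <= A z)%E.
Proof. by apply: mule_ge0 => //; rewrite lee_fin mulr_ge0. Qed.
Let B0 z : (0 <= B z)%E.
Proof. by apply: mule_ge0 => //; rewrite lee_fin !mulr_ge0// exprn_ge0// enorm_ge0. Qed.
Let C0 z : (0 <= C z)%E.
Proof.
apply: mule_ge0; last by rewrite mule_ge0// lee_fin.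
by rewrite lee_fin !mulr_ge0// exprn_ge0// ?invr_ge0 enorm_ge0.
Qed.

Let stepAB x : x != 0 -> (\int[L]_q A (q, x) = \int[L]_p B (x, p))%E.
Proof.
move=> x0; have ex := enorm_gt0 x0.
rewrite (ge0_integral_scale ex); last 2 first.
  - by apply: (measurableT_comp mA); exact: measurable_pair2.
  - by move=> v.
apply: eq_integral => p _; rewrite /A /B/= enormZ ger0_norm ?ltW//.
rewrite muleA -EFinM; congr (_%:E * h _)%E; first by ring.
rewrite /unit_dir scalerA; congr (_ *: _).
by rewrite mulrAC mulrV ?mul1r// unitfE gt_eqF.
Qed.

Let stepBC p : p != 0 -> (\int[L]_x B (x, p) = \int[L]_y C (p, y))%E.
Proof.
move=> p0; have ep := enorm_gt0 p0.
rewrite [RHS](ge0_integral_scale ep); last 2 first.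
  - by apply: (measurableT_comp mC); exact: measurable_pair1.
  - by move=> v.
apply: eq_integral => x _; rewrite /B /C/= enormZ ger0_norm ?ltW//.
rewrite [in RHS]muleA -EFinM [in RHS]muleA -EFinM; congr (_%:E * h _)%E.
rewrite gtr_pMr// (mulrC (enorm x)) exprMn -addnn exprD.
have e1 : enorm p ^+ n * (enorm p)^-1 ^+ n = 1.
  by rewrite exprVn mulfV// expf_neq0// gt_eqF.
transitivity ((enorm x < 1)%R%:R * (enorm p * enorm x < a)%R%:R * enorm x ^+ n *
  ((enorm p ^+ n * (enorm p)^-1 ^+ n) * (enorm p ^+ n * (enorm p)^-1 ^+ n))).
  by rewrite e1 !mulr1.
ring.
Qed.

Let stepC y : y != 0 -> (\int[L]_p C (p, y) =
  polar_const * ((enorm y < a)%R%:R%:E * h y))%E.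
Proof.
move=> y0; have ey := enorm_gt0 y0.
rewrite /C /=.
have mD (t : R) (k : nat) : measurable_fun setT (fun p : rV =>
    ((t < enorm p)%R%:R * ((enorm p)^-1 ^+ k))%:E).
  apply/measurable_EFinP; apply: measurable_funM.
    by apply: measurable_bool_real; apply: measurable_fun_ltr => //;
      exact: measurable_enorm.
  by apply: measurable_funX; exact: measurable_enormV.
have mE : measurable_fun setT (fun p : rV =>
    ((enorm y < enorm p)%R%:R * ((enorm p)^-1 ^+ n.*2 * enorm y ^+ n))%:E).
  apply/measurable_EFinP.
  rewrite (_ : (fun _ => _) = fun p : rV => enorm y ^+ n * ((enorm y < enorm p)%R%:R *
    (enorm p)^-1 ^+ n.*2)).
     apply: measurable_funM; first exact: measurable_cst.
     by apply/measurable_EFinP; exact: mD.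
  by apply/funext => p; ring.
rewrite ge0_integralZr//; last 2 first.
  - by move=> p _; rewrite lee_fin !mulr_ge0// exprn_ge0// ?invr_ge0 enorm_ge0.
  - by rewrite mule_ge0// lee_fin.
congr (_ * _)%E.
rewrite (ge0_integral_scale ey)//; last first.
  by move=> p; rewrite lee_fin !mulr_ge0// exprn_ge0// ?invr_ge0 enorm_ge0.
apply: eq_integral => p _; rewrite -EFinM enormZ ger0_norm ?ltW//; congr EFin.
rewrite ltr_pMr// invfM exprMn -addnn !exprD.
have e1 : enorm y ^+ n * (enorm y)^-1 ^+ n = 1.
  by rewrite exprVn mulfV// expf_neq0// gt_eqF.
transitivity ((1 < enorm p)%R%:R * ((enorm p)^-1 ^+ n * (enorm p)^-1 ^+ n) *
  ((enorm y ^+ n * (enorm y)^-1 ^+ n) * (enorm y ^+ n * (enorm y)^-1 ^+ n))).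
  ring.
by rewrite e1 !mulr1.
Qed.

(** Integrals over the sphere being integrals over cones, the change to polar
    coordinates is obtained from dilations alone: substitute [q = |x| p], exchange,
    substitute [y = |p| x], exchange, and integrate out [p] by [p = |y| p']. The
    intermediate integrands are [A], [B] and [C]. The point 0, where the dilations
    degenerate, is negligible. *)
Lemma polar_eball :
  (\int[L]_(q in eball n a) \int[L]_(x in eball n 1) h (enorm q *: unit_dir x) =
   polar_const * \int[L]_(y in eball n a) h y)%E.
Proof.
have K0 : (0 <= polar_const)%E.
  by apply: integral_ge0 => p _; rewrite lee_fin mulr_ge0// exprn_ge0// invr_ge0 enorm_ge0.
have mhb : measurable_fun setT (fun y => (enorm y < a)%R%:R%:E * h y)%E.
  apply: emeasurable_funM => //; apply/measurable_EFinP; apply: measurable_bool_real.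
  by apply: measurable_fun_ltr => //; exact: measurable_enorm.
have hb0 y : (0 <= (enorm y < a)%R%:R%:E * h y)%E by rewrite mule_ge0// lee_fin.
transitivity (\int[L]_q \int[L]_x A (q, x))%E.
  rewrite integral_eball; apply: eq_integral => q _.
  rewrite integral_eball -ge0_integralZl//.
  - apply: eq_integral => x _; by rewrite muleA -EFinM.
  - apply: emeasurable_funM.
      apply/measurable_EFinP; apply: measurable_bool_real.
      by apply: measurable_fun_ltr => //; exact: measurable_enorm.
    apply: (measurableT_comp mh); apply: measurable_scale_rV => //.
    exact: measurable_unit_dir.
  - by move=> x _; rewrite mule_ge0// lee_fin.
rewrite fubini_tonelli//.
transitivity (\int[L]_x \int[L]_p B (x, p))%E.
  apply: ge0_eq_integral_off0 => //.
  - exact: (measurable_fun_fubini_tonelli_G A).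
  - exact: (measurable_fun_fubini_tonelli_F B).
  - by move=> v; exact: integral_ge0.
  - by move=> v; exact: integral_ge0.
rewrite fubini_tonelli//.
transitivity (\int[L]_p \int[L]_y C (p, y))%E.
  apply: ge0_eq_integral_off0 => //.
  - exact: (measurable_fun_fubini_tonelli_G B).
  - exact: (measurable_fun_fubini_tonelli_F C).
  - by move=> v; exact: integral_ge0.
  - by move=> v; exact: integral_ge0.
rewrite fubini_tonelli//.
rewrite integral_eball -ge0_integralZl//.
apply: ge0_eq_integral_off0 => //.
- exact: (measurable_fun_fubini_tonelli_G C).
- by apply: emeasurable_funM => //; exact: measurable_cst.
- by move=> v; exact: integral_ge0.
- by move=> v; rewrite mule_ge0.
Qed.

End polar.

(** * Gain and loss integrals *)

Lemma ge0_integral_setX d1 d2 (T1 : measurableType d1) (T2 : measurableType d2)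
    (R : realType) (m1 : {sigma_finite_measure set T1 -> \bar R})
    (m2 : {sigma_finite_measure set T2 -> \bar R}) (A : set T1) (B : set T2)
    (H : T1 * T2 -> \bar R) :
  measurable A -> measurable B -> measurable_fun setT H -> (forall z, 0 <= H z)%E ->
  (\int[m1 \x m2]_(z in A `*` B) H z = \int[m1]_(x in A) \int[m2]_(y in B) H (x, y))%E.
Proof.
move=> mA mB mH H0.
have mAB : measurable (A `*` B) by exact: measurableX.
rewrite integral_mkcond fubini_tonelli1; last 2 first.
  - by apply/(measurable_restrictT _ _).1 => //; exact: measurable_funTS.
  - by move=> z; rewrite /patch; case: ifPn.
rewrite [RHS]integral_mkcond; apply: eq_integral => x _.
rewrite /fubini_F /patch; case: ifPn => xA.
  rewrite [RHS]integral_mkcond; apply: eq_integral => y _; rewrite /patch.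
  have -> // : ((x, y) \in A `*` B) = (y \in B).
  by apply/idP/idP; rewrite !inE; [by case|move=> yB; split => //; rewrite inE in xA].
rewrite integral0_eq// => y _; rewrite memNset// => -[/= Ax _].
by move: xA; rewrite mem_set.
Qed.

Section tonelli_in.
Context d1 d2 (T1 : measurableType d1) (T2 : measurableType d2)
    (R : realType) (m1 : {sigma_finite_measure set T1 -> \bar R})
    (m2 : {sigma_finite_measure set T2 -> \bar R}) (A : set T1) (B : set T2)
    (H : T1 * T2 -> \bar R).
Hypotheses (mA : measurable A) (mB : measurable B).
Hypotheses (mH : measurable_fun setT H) (H0 : forall z, (0 <= H z)%E).

Lemma measurable_integral_param :
  measurable_fun setT (fun x => \int[m2]_(y in B) H (x, y))%E.
Proof.
have mB' : measurable ([set: T1] `*` B) by exact: measurableX.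
rewrite (_ : (fun _ => _) = fubini_F m2 (H \_ ([set: T1] `*` B))).
  apply: measurable_fun_fubini_tonelli_F.
    by apply/(measurable_restrictT _ _).1 => //; exact: measurable_funTS.
  by move=> z; rewrite /patch; case: ifPn.
apply/funext => x; rewrite integral_mkcond; apply: eq_integral => y _.
rewrite /patch; have -> // : ((x, y) \in [set: T1] `*` B) = (y \in B).
by apply/idP/idP; rewrite !inE => //; case.
Qed.

Lemma measurable_integral_param2 :
  measurable_fun setT (fun y => \int[m1]_(x in A) H (x, y))%E.
Proof.
have mA' : measurable (A `*` [set: T2]) by exact: measurableX.
rewrite (_ : (fun _ => _) = fubini_G m1 (H \_ (A `*` [set: T2]))).
  apply: measurable_fun_fubini_tonelli_G.
    by apply/(measurable_restrictT _ _).1 => //; exact: measurable_funTS.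
  by move=> z; rewrite /patch; case: ifPn.
apply/funext => y; rewrite integral_mkcond; apply: eq_integral => x _.
rewrite /patch; have -> // : ((x, y) \in A `*` [set: T2]) = (x \in A).
by apply/idP/idP; rewrite !inE => //; case.
Qed.

Lemma fubini_tonelli_in :
  (\int[m1]_(x in A) \int[m2]_(y in B) H (x, y) =
   \int[m2]_(y in B) \int[m1]_(x in A) H (x, y))%E.
Proof.
have mAB : measurable (A `*` B) by exact: measurableX.
rewrite -ge0_integral_setX// integral_mkcond fubini_tonelli2; last 2 first.
  - by apply/(measurable_restrictT _ _).1 => //; exact: measurable_funTS.
  - by move=> z; rewrite /patch; case: ifPn.
rewrite [RHS]integral_mkcond; apply: eq_integral => y _.
rewrite /fubini_G /patch; case: ifPn => yB.
  rewrite [RHS]integral_mkcond; apply: eq_integral => x _; rewrite /patch.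
  have -> // : ((x, y) \in A `*` B) = (x \in A).
  by apply/idP/idP; rewrite !inE; [by case|move=> xA; split => //; rewrite inE in yB].
rewrite integral0_eq// => x _; rewrite memNset// => -[_ /= By].
by move: yB; rewrite mem_set.
Qed.

End tonelli_in.

Section convolution_bounds.
Context (R : realType) (d : nat) (d0 : (0 < d)%N).
Local Notation L := (lebesgue_rV R d).
Local Notation S := (sphere_measure R d).
Local Notation rV := 'rV[R]_d.

(** The product measure under a name of its own, so that it carries a
    sigma-finite structure. *)
Definition pair_measure (A : set (rV * rV)) : \bar R := (L \x S)%E A.

Let pair0 : pair_measure set0 = 0%E.
Proof. exact: (@measure0 _ _ _ (L \x S)%E). Qed.

Let pair_ge0 A : (0 <= pair_measure A)%E.
Proof. exact: (@measure_ge0 _ _ _ (L \x S)%E). Qed.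

Let pair_sigma_additive : semi_sigma_additive pair_measure.
Proof. exact: (@measure_semi_sigma_additive _ _ _ (L \x S)%E). Qed.

HB.instance Definition _ := isMeasure.Build _ _ _ pair_measure
  pair0 pair_ge0 pair_sigma_additive.

Let pair_measure_sigma_finite : sigma_finite setT pair_measure.
Proof.
have /sigma_finiteP[F [TF ndF Foo]] := sigma_finiteT L.
have Sfin : S setT \is a fin_num by exact: fin_num_measure.
exists (fun k => F k `*` setT).
  rewrite -setXTT {1}TF; apply/seteqP;
    split => [[x y] [/= [k _ Fkx] _]|[x y] [k _ [/= Fkx _]]].
    by exists k.
  by split => //; exists k.
move=> k; have [? ?] := Foo k; split; first exact: measurableX.
by rewrite /pair_measure product_measure1E// lte_mul_pinfty// ?ge0_fin_numE// -ge0_fin_numE.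
Qed.

HB.instance Definition _ := Measure_isSigmaFinite.Build _ _ _ pair_measure
  pair_measure_sigma_finite.

Lemma measurable_sphere : measurable (sphere R d).
Proof.
rewrite -[X in measurable X]setTI (_ : sphere R d = @enorm R d @^-1` [set 1])//.
exact: measurable_enorm.
Qed.

Lemma eball1_fin : (L (eball d 1) < +oo)%E.
Proof.
apply: le_lt_trans (lebesgue_cube_fin R d); apply: le_measure; rewrite ?inE.
- exact: measurable_eball.
- exact: measurable_cube.
- by move=> v v1 i; rewrite (le_trans (enorm_ge_coord v i))// ltW.
Qed.

(** The constant [polar_const] is finite: [polar_eball] for [h = 1] and radius 1
    expresses it through the volume of the unit ball, unless this volume is 0, in
    which case the sphere is null and there is nothing to prove. *)
Lemma polar_bound : exists K : R, 0 <= K /\ forall a (h : rV -> \bar R),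
  measurable_fun setT h -> (forall v, 0 <= h v)%E ->
  (\int[L]_(q in eball d a) \int[S]_w h (enorm q *: w) <=
   K%:E * \int[L]_(y in eball d a) h y)%E.
Proof.
have mb a := @measurable_eball R d a.
have E a h : measurable_fun setT h -> (forall v, 0 <= h v)%E ->
  (\int[L]_(q in eball d a) \int[S]_w h (enorm q *: w) =
   d%:R%:E * \int[L]_(q in eball d a) \int[L]_(x in eball d 1) h (enorm q *: unit_dir x))%E.
  move=> mh h0; rewrite -ge0_integralZl//; last 2 first.
  - apply: measurable_funTS.
    rewrite (_ : (fun _ => _) = (fun q => \int[L]_x ((fun z : rV * rV =>
       (enorm z.2 < 1)%R%:R%:E * h (enorm z.1 *: unit_dir z.2)) (q, x)))%E); last first.
      by apply/funext => q; rewrite integral_eball.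
    apply: (measurable_fun_fubini_tonelli_F (fun z : rV * rV =>
       (enorm z.2 < 1)%R%:R%:E * h (enorm z.1 *: unit_dir z.2))%E); last first.
      by move=> z; rewrite mule_ge0// lee_fin.
    apply: emeasurable_funM.
      apply/measurable_EFinP; apply: measurable_bool_real; apply: measurable_fun_ltr => //.
      exact: (measurableT_comp (@measurable_enorm R d) measurable_snd).
    apply: (measurableT_comp mh); apply: measurable_scale_rV => //.
      exact: (measurableT_comp (@measurable_enorm R d) measurable_fst).
    exact: (measurableT_comp (@measurable_unit_dir R d) measurable_snd).
  - by move=> q _; exact: integral_ge0.
  apply: eq_integral => q _; rewrite ge0_integral_sphere//.
  apply: (measurableT_comp mh); apply: measurable_scale_rV => //; exact: measurable_cst.
have V0 : (0 <= L (eball d 1))%E by exact: measure_ge0.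
have [V1|V1] := eqVneq (L (eball d 1)) 0%E.
  exists 0; split => // a h mh h0; rewrite E// mul0e.
  rewrite [X in (_ * X)%E](_ : _ = 0%E) ?mule0//.
  apply: integral0_eq => q _; apply: null_set_integral => //.
  apply: measurable_funTS; apply: (measurableT_comp mh); apply: measurable_scale_rV;
    [exact: measurable_cst|exact: measurable_unit_dir].
have : polar_const R d \is a fin_num.
  have := @polar_eball R d d0 1 (cst 1%E) (measurable_cst _) (fun _ => lee01).
  rewrite (eq_integral (cst (L (eball d 1)))); last first.
    by move=> q _; rewrite integral_cst// mul1e.
  rewrite !integral_cst// mul1e.
  have K0 : (0 <= polar_const R d)%E.
    by apply: integral_ge0 => p _; rewrite lee_fin mulr_ge0// exprn_ge0// invr_ge0
      enorm_ge0.
  rewrite ge0_fin_numE// ltey; move: eball1_fin => Vf + ; apply: contraPN => /eqP ->.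
  rewrite gt0_mulye ?lt0e ?V1//.
  apply/eqP; rewrite -ltey; apply: lte_mul_pinfty => //.
  by rewrite ge0_fin_numE.
move=> Kf; exists (d%:R * fine (polar_const R d)); split.
  rewrite mulr_ge0// fine_ge0//.
  by apply: integral_ge0 => p _; rewrite lee_fin mulr_ge0// exprn_ge0// invr_ge0 enorm_ge0.
by move=> a h mh h0; rewrite E// polar_eball// EFinM fineK// muleA.
Qed.

(** The post-collisional velocities as functions of [v] and of the pair [p] of the
    relative velocity and the direction; the form is that of the collision integral,
    with [v - (v - q)] left unsimplified. *)
Definition vpost (v : rV) (p : rV * rV) : rV :=
  2^-1 *: (v + (v - p.1)) + (enorm (v - (v - p.1)) / 2) *: p.2.
Definition vpost_ (v : rV) (p : rV * rV) : rV :=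
  2^-1 *: (v + (v - p.1)) - (enorm (v - (v - p.1)) / 2) *: p.2.

Lemma vpostE v p : vpost v p = v + ((enorm p.1 / 2) *: p.2 - 2^-1 *: p.1).
Proof. by rewrite /vpost subKr; apply/rowP => i; rewrite !mxE; field. Qed.

Lemma vpost_E v p : vpost_ v p = vpost v p - enorm p.1 *: p.2.
Proof. by rewrite /vpost /vpost_ subKr; apply/rowP => i; rewrite !mxE; field. Qed.

Lemma measurable_vpost : measurable_fun setT (fun z : rV * (rV * rV) => vpost z.1 z.2).
Proof.
rewrite (_ : (fun _ => _) = fun z : rV * (rV * rV) =>
   z.1 + ((enorm z.2.1 / 2) *: z.2.2 - 2^-1 *: z.2.1)); last first.
  by apply/funext => z; rewrite vpostE.
have m21 : measurable_fun setT (fun z : rV * (rV * rV) => z.2.1).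
  exact: (measurableT_comp measurable_fst measurable_snd).
have m22 : measurable_fun setT (fun z : rV * (rV * rV) => z.2.2).
  exact: (measurableT_comp measurable_snd measurable_snd).
apply: measurable_add_rV => //; apply: measurable_add_rV.
  apply: measurable_scale_rV => //; apply: measurable_funM; last exact: measurable_cst.
  exact: (measurableT_comp (@measurable_enorm R d) m21).
by apply: measurable_opp_rV; apply: measurable_scale_rV => //; exact: measurable_cst.
Qed.

Lemma measurable_vpost_ : measurable_fun setT (fun z : rV * (rV * rV) => vpost_ z.1 z.2).
Proof.
rewrite (_ : (fun _ => _) = fun z : rV * (rV * rV) => vpost z.1 z.2 -
  enorm z.2.1 *: z.2.2); last first.
  by apply/funext => z; rewrite vpost_E.
have m21 : measurable_fun setT (fun z : rV * (rV * rV) => z.2.1).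
  exact: (measurableT_comp measurable_fst measurable_snd).
have m22 : measurable_fun setT (fun z : rV * (rV * rV) => z.2.2).
  exact: (measurableT_comp measurable_snd measurable_snd).
apply: measurable_add_rV; first exact: measurable_vpost.
apply: measurable_opp_rV; apply: measurable_scale_rV => //.
exact: (measurableT_comp (@measurable_enorm R d) m21).
Qed.

Section periodic_pair.
Variables F G : rV -> \bar R.
Hypothesis mF : measurable_fun setT F.
Hypothesis F0 : (forall v, 0 <= F v)%E.
Hypothesis pF : forall v i, F (v + (pi *+ 2) *: delta_mx ord0 i) = F v.
Hypothesis mG : measurable_fun setT G.
Hypothesis G0 : (forall v, 0 <= G v)%E.
Hypothesis pG : forall v i, G (v + (pi *+ 2) *: delta_mx ord0 i) = G v.

Variables (m : nat) (a : R).
Hypothesis ma : pi + a <= pi *+ m.*2.+1.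

(** The points [w - q] with [q] in the ball fill a ball around [w], which is
    covered by periods of the box. *)
Lemma integral_ball_reflect w : box w ->
  (\int[L]_(q in eball d a) F (w - q)%R <=
   (m.*2.+1 ^ d)%:R%:E * \int[L]_(v in @box R d) F v)%E.
Proof.
move=> wb.
have me (v : rV) : measurable_fun setT (fun q : rV => v - q).
  by apply: measurable_add_rV; [exact: measurable_cst|exact: measurable_opp_rV].
pose S := (fun y : rV => w - y) @^-1` eball d a.
have mS : measurable S.
  by rewrite -[X in measurable X]setTI; apply: me => //; exact: measurable_eball.
apply: le_trans (integral_cover mF F0 pF mS (m := m) _); last first.
  move=> y Sy j; have := le_lt_trans (enorm_ge_coord _ j) Sy.
  rewrite !mxE => wy; have := wb j => wj; apply: le_trans ma.
  rewrite -[y ord0 j](subKr (w ord0 j)).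
  apply: le_trans (ler_normB _ _) _; apply: lerD; last exact: ltW.
  by rewrite ler_norml.
have := @ge0_integral_rV_affine R d (-1) w (F \_ S).
rewrite oppr_eq0 oner_eq0 normrN1 expr1n invr1 mul1e [leRHS]integral_mkcond => <-//.
- rewrite [leLHS]integral_mkcond.
  rewrite (eq_integral (fun v : rV => (F \_ S) (-1 *: v + w)))// => v _.
  rewrite scaleN1r addrC /patch.
  have -> : (v \in @eball R d a) = (w - v \in S); last by [].
  by apply/idP/idP; rewrite !inE /S /= subKr.
- by apply/(measurable_restrictT _ _).1 => //; exact: measurable_funTS.
- by move=> v; rewrite /patch; case: ifPn.
Qed.

Let D := eball d a `*` sphere R d.
Let mD : measurable D.
Proof. by apply: measurableX; [exact: measurable_eball|exact: measurable_sphere]. Qed.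

Let D1 : (S (sphere R d) < +oo)%E.
Proof. by rewrite ltey_eq fin_num_measure//; exact: measurable_sphere. Qed.

Let mH1 : measurable_fun setT (fun z : rV * (rV * rV) => F (z.1 - z.2.1) * G z.1)%E.
Proof.
apply: emeasurable_funM; last exact: (measurableT_comp mG measurable_fst).
apply: (measurableT_comp mF); apply: measurable_add_rV => //.
by apply: measurable_opp_rV; exact: (measurableT_comp measurable_fst measurable_snd).
Qed.

(** [G] does not depend on the relative velocity, over which [F] is integrated
    first. *)
Lemma loss_bound :
  (\int[L]_(v in @box R d) \int[pair_measure]_(p in D) (F (v - p.1)%R * G v) <=
   (S (sphere R d) * (m.*2.+1 ^ d)%:R%:E) *
   (\int[L]_(v in @box R d) F v * \int[L]_(v in @box R d) G v))%E.
Proof.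
have mb := @measurable_eball R d a.
have ms := measurable_sphere.
have IF0 : (0 <= \int[L]_(v in @box R d) F v)%E by exact: integral_ge0.
have C0 : (0 <= S (sphere R d) * (m.*2.+1 ^ d)%:R%:E)%E.
  by rewrite mule_ge0// lee_fin.
rewrite muleA -ge0_integralZl//; last 3 first.
  - exact: measurable_box.
  - exact: measurable_funTS.
  - by rewrite mule_ge0.
apply: ge0_le_integral.
- exact: measurable_box.
- by move=> v _; apply: integral_ge0 => p _; rewrite mule_ge0.
- apply: measurable_funTS.
  pose H1 (z : rV * (rV * rV)) := (F (z.1 - z.2.1)%R * G z.1)%E.
  have H10 z : (0 <= H1 z)%E by rewrite mule_ge0.
  exact: (@measurable_integral_param _ _ _ _ R pair_measure D H1 mD mH1 H10).
- by apply: emeasurable_funM; [exact: measurable_cst|exact: measurable_funTS].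
move=> v vb.
have mFv : measurable_fun setT (fun q : rV => F (v - q)).
  apply: (measurableT_comp mF); apply: measurable_add_rV; first exact: measurable_cst.
  exact: measurable_opp_rV.
have mFp : measurable_fun setT (fun p : rV * rV => F (v - p.1)).
  exact: (measurableT_comp mFv measurable_fst).
rewrite ge0_integralZr//; last exact: measurable_funTS.
apply: lee_wpmul2r => //.
rewrite ge0_integral_setX//.
rewrite /=; under eq_integral do rewrite integral_cst//.
rewrite ge0_integralZr//; last exact: measurable_funTS.
rewrite [leLHS]muleC -[leRHS]muleA; apply: lee_wpmul2l => //.
exact: integral_ball_reflect.
Qed.

Let J (z : rV * (rV * rV)) := (F (vpost_ z.1 z.2) * G (vpost z.1 z.2))%E.
Let J' (z : rV * (rV * rV)) := (F (z.1 - enorm z.2.1 *: z.2.2)%R * G z.1)%E.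

Let mJ : measurable_fun setT J.
Proof.
apply: emeasurable_funM; first exact: (measurableT_comp mF measurable_vpost_).
exact: (measurableT_comp mG measurable_vpost).
Qed.

Let mshift : measurable_fun setT (fun z : rV * (rV * rV) => z.1 - enorm z.2.1 *: z.2.2).
Proof.
have m21 : measurable_fun setT (fun z : rV * (rV * rV) => z.2.1).
  exact: (measurableT_comp measurable_fst measurable_snd).
have m22 : measurable_fun setT (fun z : rV * (rV * rV) => z.2.2).
  exact: (measurableT_comp measurable_snd measurable_snd).
apply: measurable_add_rV => //.
apply: measurable_opp_rV; apply: measurable_scale_rV => //.
exact: (measurableT_comp (@measurable_enorm R d) m21).
Qed.

Let mJ' : measurable_fun setT J'.
Proof.
apply: emeasurable_funM; first exact: (measurableT_comp mF mshift).
exact: (measurableT_comp mG measurable_fst).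
Qed.

Let J0 z : (0 <= J z)%E. Proof. exact: mule_ge0. Qed.
Let J'0 z : (0 <= J' z)%E. Proof. exact: mule_ge0. Qed.

(** For fixed [(q, omega)] both post-collisional velocities are translates of [v] and
    differ by [|q| omega]. A translation in [v] moves [v'] to [v], up to the factor
    [3^d] of [integral_box_shift]; then [q] and [omega] enter only through
    [y = |q| omega], and [K] bounds the passage from [(q, omega)] to [y]. *)
Lemma gain_bound (K : R) : 0 <= K ->
  (forall (h : rV -> \bar R),
    measurable_fun setT h -> (forall v, 0 <= h v)%E ->
    (\int[L]_(q in eball d a) \int[S]_w h (enorm q *: w) <=
     K%:E * \int[L]_(y in eball d a) h y)%E) ->
  (\int[L]_(v in @box R d) \int[pair_measure]_(p in D) (F (vpost_ v p) * G (vpost v p)) <=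
   ((3 ^ d)%:R * (K * (m.*2.+1 ^ d)%:R))%:E *
   (\int[L]_(v in @box R d) F v * \int[L]_(v in @box R d) G v))%E.
Proof.
move=> K0 HK.
have mb := @measurable_eball R d a.
have mB := @measurable_box R d.
have ms := measurable_sphere.
have IF0 : (0 <= \int[L]_(v in @box R d) F v)%E by exact: integral_ge0.
rewrite (@fubini_tonelli_in _ _ _ _ R L pair_measure (@box R d) D J mB mD mJ J0).
apply: (@le_trans _ _ (\int[pair_measure]_(p in D)
   ((3 ^ d)%:R%:E * \int[L]_(v in @box R d) J' (v, p)))%E).
  apply: ge0_le_integral => //.
  - by move=> p _; exact: integral_ge0.
  - apply: measurable_funTS.
    exact: (@measurable_integral_param2 _ _ _ _ R L (@box R d) J mB mJ J0).
  - apply: emeasurable_funM; first exact: measurable_cst.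
    apply: measurable_funTS.
    exact: (@measurable_integral_param2 _ _ _ _ R L (@box R d) J' mB mJ' J'0).
  move=> p _.
  (* The translation that carries v to v'. *)
  pose c := (enorm p.1 / 2) *: p.2 - 2^-1 *: p.1.
  pose H (w : rV) := J' (w, p).
  rewrite (eq_integral (fun v : rV => H (v + c))); last first.
    by move=> v _; rewrite /J /H /J' /= vpost_E vpostE.
  apply: integral_box_shift.
  - exact: (measurableT_comp mJ' (measurable_pair2 _)).
  - by move=> v; exact: J'0.
  - by move=> v i; rewrite /H /J' /= pG addrAC pF.
have mI : measurable_fun setT (fun p : rV * rV => \int[L]_(v in @box R d) J' (v, p))%E.
  exact: (@measurable_integral_param2 _ _ _ _ R L (@box R d) J' mB mJ' J'0).
have I0 (p : rV * rV) : (0 <= \int[L]_(v in @box R d) J' (v, p))%E.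
  exact: integral_ge0.
rewrite ge0_integralZl//; last exact: measurable_funTS.
rewrite EFinM -muleA; apply: lee_wpmul2l => //.
rewrite -(@fubini_tonelli_in _ _ _ _ R L pair_measure (@box R d) D J' mB mD mJ' J'0).
rewrite muleA -ge0_integralZl//; last 2 first.
  - exact: measurable_funTS.
  - by rewrite mule_ge0// lee_fin mulr_ge0.
apply: ge0_le_integral => //.
- by move=> v _; apply: integral_ge0.
- apply: measurable_funTS.
  exact: (@measurable_integral_param _ _ _ _ R pair_measure D J' mD mJ' J'0).
- by apply: emeasurable_funM; [exact: measurable_cst|exact: measurable_funTS].
move=> v vb.
pose h (y : rV) := F (v - y).
have mh : measurable_fun setT h.
  apply: (measurableT_comp mF); apply: measurable_add_rV; first exact: measurable_cst.
  exact: measurable_opp_rV.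
have h0 y : (0 <= h y)%E by exact: F0.
have msc : measurable_fun setT (fun p : rV * rV => h (enorm p.1 *: p.2)).
  apply: (measurableT_comp mh); apply: measurable_scale_rV => //.
  exact: (measurableT_comp (@measurable_enorm R d) measurable_fst).
rewrite /J' /= ge0_integralZr//; last exact: measurable_funTS.
apply: lee_wpmul2r => //.
rewrite ge0_integral_setX//= EFinM -muleA.
apply: (@le_trans _ _ (K%:E * \int[L]_(y in eball d a) h y)%E); last first.
  by apply: lee_wpmul2l => //; exact: integral_ball_reflect.
apply: le_trans (HK _ mh h0).
apply: ge0_le_integral => //.
- by move=> q _; exact: integral_ge0.
- apply: measurable_funTS.
  exact: (@measurable_integral_param _ _ _ _ R S (sphere R d) (fun p : rV *
    rV => h (enorm p.1 *: p.2)) ms msc (fun p => h0 _)).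
- apply: measurable_funTS.
  exact: (@measurable_integral_param _ _ _ _ R S setT (fun p : rV *
    rV => h (enorm p.1 *: p.2)) measurableT msc (fun p => h0 _)).
move=> q _; apply: ge0_subset_integral => //.
exact: (measurableT_comp msc (measurable_pair1 _)).
Qed.

End periodic_pair.
End convolution_bounds.

(** * Square of an integral *)

Section square_of_integral.
Context dT (T : measurableType dT) (R : realType)
  (mu : {measure set T -> \bar R}) (D : set T).
Hypotheses (mD : measurable D) (Dfin : (mu D < +oo)%E).

Lemma integrable_of_sqr (w : T -> R) : measurable_fun D w ->
  (\int[mu]_(x in D) (w x ^+ 2)%:E < +oo)%E -> mu.-integrable D (EFin \o w).
Proof.
move=> mw foo.
have i1 : mu.-integrable D (fun=> 1%E).
  by apply/integrableP; split => //; rewrite integral_cst//= normr1 mul1e.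
have i2 : mu.-integrable D (fun x => (w x ^+ 2)%:E).
  apply/integrableP; split.
    by apply/measurable_EFinP; exact: measurable_funX.
  rewrite (eq_integral (fun x => (w x ^+ 2)%:E))// => x _.
  by rewrite gee0_abs// lee_fin sqr_ge0.
apply: le_integrable (integrableD mD i1 i2) => //.
  exact/measurable_EFinP.
move=> x _ /=; rewrite lee_fin [leRHS]ger0_norm ?addr_ge0 ?sqr_ge0//.
rewrite -(real_normK (num_real (w x))); have := sqr_ge0 (`|w x| - 1).
have := normr_ge0 (w x); rewrite sqrrB1; lra.
Qed.

(** Cauchy-Schwarz against the constant 1. The summand 1 makes the factor
    positive, so that the bound also holds when the right-hand integral is
    infinite. *)
Lemma sqr_Rintegral_le (w : T -> R) : measurable_fun D w ->
  (((\int[mu]_(x in D) w x) ^+ 2)%:E <=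
   (fine (mu D) + 1)%:E * \int[mu]_(x in D) (w x ^+ 2)%:E)%E.
Proof.
move=> mw; set m := fine (mu D).
have m0 : 0 <= m by rewrite /m fine_ge0.
have W0 : (0 <= \int[mu]_(x in D) (w x ^+ 2)%:E)%E.
  by apply: integral_ge0 => x _; rewrite lee_fin sqr_ge0.
have [->|] := eqVneq (\int[mu]_(x in D) (w x ^+ 2)%:E)%E +oo%E.
  by rewrite gt0_muley ?leey// lte_fin; lra.
rewrite -ltey => foo; have iw := integrable_of_sqr mw foo.
have i1 (c : R) : mu.-integrable D (fun=> c%:E).
  apply/integrableP; split => //; rewrite integral_cst//=.
  by apply: lte_mul_pinfty => //; rewrite lee_fin.
have i2 : mu.-integrable D (fun x => (w x ^+ 2)%:E).
  apply/integrableP; split.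
    by apply/measurable_EFinP; exact: measurable_funX.
  rewrite (eq_integral (fun x => (w x ^+ 2)%:E))// => x _.
  by rewrite gee0_abs// lee_fin sqr_ge0.
rewrite -(@fineK _ (\int[mu]_(x in D) (w x ^+ 2)%:E)%E) ?ge0_fin_numE//.
rewrite -EFinM lee_fin -[X in _ <= _ * X]/(\int[mu]_(x in D) (w x ^+ 2)).
set I := \int[mu]_(x in D) w x; set W := \int[mu]_(x in D) (w x ^+ 2).
have H (t : R) : 0 <= t ^+ 2 * m - 2 * t * I + W.
  have -> : t ^+ 2 * m - 2 * t * I + W = \int[mu]_(x in D) (t - w x) ^+ 2.
    transitivity (\int[mu]_(x in D) (t ^+ 2 + (- (2 * t) * w x + w x ^+ 2))).
      have i3 := integrableZl mD (- (2 * t)) iw.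
      rewrite (RintegralD mD (i1 (t ^+ 2)) (integrableD mD i3 i2)).
      rewrite (RintegralD mD i3 i2).
      rewrite (RintegralZl _ mD iw) (Rintegral_cst mu mD) -/I -/W -/m.
      by ring.
    by apply: eq_Rintegral => x _; ring.
  by apply: Rintegral_ge0 => x _; exact: sqr_ge0.
have disc : (- I) ^+ 2 <= W * m.
  apply: discriminant_le0 => // [|t]; last by have := H t; lra.
  by apply: Rintegral_ge0 => x _; exact: sqr_ge0.
have W1 : 0 <= W by apply: Rintegral_ge0 => x _; exact: sqr_ge0.
by move: disc; rewrite sqrrN; lra.
Qed.

End square_of_integral.

(** * The collision operator as a bilinear form *)

Section bilinear_collision.
Context (R : realType) (d : nat).
Local Notation L := (lebesgue_rV R d).
Local Notation S := (sphere_measure R d).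
Local Notation rV := 'rV[R]_d.
Local Notation box := (@box R d).
Local Notation PM := (@pair_measure R d).
Implicit Types f g : rV -> R.

Variables (k : rV * rV -> R) (M a K : R) (m : nat).
Hypotheses (mk : measurable_fun setT k) (kM : forall p, `|k p| <= M).
Hypothesis ma : pi + a <= pi *+ m.*2.+1.
Hypothesis K0 : 0 <= K.
Hypothesis HK : forall h : rV -> \bar R,
  measurable_fun setT h -> (forall v, 0 <= h v)%E ->
  (\int[L]_(q in eball d a) \int[S]_w h (enorm q *: w) <=
   K%:E * \int[L]_(y in eball d a) h y)%E.

Let D := eball d a `*` sphere R d.

Let mD : measurable D.
Proof. by apply: measurableX; [exact: measurable_eball|exact: measurable_sphere]. Qed.

Let M0 : 0 <= M. Proof. by apply: le_trans (kM (0, 0)). Qed.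

Let S_fin : (S (sphere R d) < +oo)%E.
Proof. by rewrite ltey_eq fin_num_measure//; exact: measurable_sphere. Qed.

Let D_fin : (PM D < +oo)%E.
Proof.
have ms := @measurable_sphere R d; have me := @measurable_eball R d a.
rewrite /pair_measure product_measure1E//; apply: lte_mul_pinfty => //.
rewrite ge0_fin_numE//.
have b0 : box 0 by move=> i; rewrite mxE oppr_le0 pi_ge0.
have := @integral_ball_reflect R d (fun=> 1%E) (measurable_cst _) (fun=> lee01)
  (fun _ _ => erefl) m a ma 0 b0.
rewrite !integral_cst ?mul1e//; last exact: measurable_box.
by move=> /le_lt_trans; apply; apply: lte_mul_pinfty => //; exact: box_fin.
Qed.

Definition coll_integrand f g (v : rV) (p : rV * rV) : R :=
  k p * (f (vpost_ v p) * g (vpost v p) - f (v - p.1) * g v).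

(** The polarization of the collision operator, with an arbitrary bounded weight
    in place of the kernel. *)
Definition coll f g (v : rV) : R := \int[PM]_(p in D) coll_integrand f g v p.

Section pair.
Variables f g : rV -> R.
Hypotheses (Lf : L2box f) (Lg : L2box g) (pf : Defs.periodic f) (pg : Defs.periodic g).

Let z (y : rV * (rV * rV)) : R := coll_integrand f g y.1 y.2.

Let mv_ : measurable_fun setT (fun y : rV * (rV * rV) => f (vpost_ y.1 y.2) *
  g (vpost y.1 y.2)).
Proof.
apply: measurable_funM.
  exact: (measurableT_comp (L2box_meas Lf) (@measurable_vpost_ R d)).
exact: (measurableT_comp (L2box_meas Lg) (@measurable_vpost R d)).
Qed.

Let mv : measurable_fun setT (fun y : rV * (rV * rV) => f (y.1 - y.2.1) * g y.1).
Proof.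
apply: measurable_funM; last exact: (measurableT_comp (L2box_meas Lg) measurable_fst).
apply: (measurableT_comp (L2box_meas Lf)); apply: measurable_add_rV => //.
by apply: measurable_opp_rV; exact: (measurableT_comp measurable_fst measurable_snd).
Qed.

Let mz : measurable_fun setT z.
Proof.
apply: measurable_funM; first exact: (measurableT_comp mk measurable_snd).
exact: measurable_funB.
Qed.

Let mzv v : measurable_fun D (coll_integrand f g v).
Proof.
by apply: measurable_funTS; exact: (measurableT_comp mz (measurable_pair1 v)).
Qed.

Let Y v := (\int[PM]_(p in D) (coll_integrand f g v p ^+ 2)%:E)%E.

Let mY : measurable_fun setT Y.
Proof.
apply: (@measurable_integral_param _ _ _ _ R PM D (fun y => (z y ^+ 2)%:E) mD).
  by apply/measurable_EFinP; exact: measurable_funX.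
by move=> y; rewrite lee_fin sqr_ge0.
Qed.

Definition coll_mean_const : R :=
  M ^+ 2 * (2 * ((3 ^ d)%:R * (K * (m.*2.+1 ^ d)%:R) +
    fine (S (sphere R d)) * (m.*2.+1 ^ d)%:R)).

Lemma coll_mean_const_ge0 : 0 <= coll_mean_const.
Proof.
rewrite /coll_mean_const mulr_ge0 ?sqr_ge0// mulr_ge0// addr_ge0 ?mulr_ge0//.
by rewrite fine_ge0.
Qed.

Let gainE (v : rV) := (\int[PM]_(p in D) ((f (vpost_ v p) ^+ 2)%:E *
  (g (vpost v p) ^+ 2)%:E))%E.
Let lossE (v : rV) := (\int[PM]_(p in D) ((f (v - p.1)%R ^+ 2)%:E * (g v ^+ 2)%:E))%E.

Let mgain : measurable_fun setT gainE.
Proof.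
apply: (@measurable_integral_param _ _ _ _ R PM D
  (fun y => (f (vpost_ y.1 y.2) ^+ 2)%:E * (g (vpost y.1 y.2) ^+ 2)%:E)%E mD).
  apply: (eq_measurable_fun (fun y : rV * (rV * rV) =>
     ((f (vpost_ y.1 y.2) * g (vpost y.1 y.2)) ^+ 2)%:E)).
    by move=> y _; rewrite -EFinM exprMn.
  by apply/measurable_EFinP; exact: measurable_funX.
by move=> y; rewrite -EFinM lee_fin mulr_ge0 ?sqr_ge0.
Qed.

Let mloss : measurable_fun setT lossE.
Proof.
apply: (@measurable_integral_param _ _ _ _ R PM D
  (fun y : rV * (rV * rV) => (f (y.1 - y.2.1)%R ^+ 2)%:E * (g y.1 ^+ 2)%:E)%E mD).
  apply: (eq_measurable_fun (fun y : rV * (rV * rV) =>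
     ((f (y.1 - y.2.1) * g y.1) ^+ 2)%:E)).
    by move=> y _; rewrite -EFinM exprMn.
  by apply/measurable_EFinP; exact: measurable_funX.
by move=> y; rewrite -EFinM lee_fin mulr_ge0 ?sqr_ge0.
Qed.

Let gain0 v : (0 <= gainE v)%E.
Proof. by apply: integral_ge0 => p _; rewrite -EFinM lee_fin mulr_ge0 ?sqr_ge0. Qed.

Let loss0 v : (0 <= lossE v)%E.
Proof. by apply: integral_ge0 => p _; rewrite -EFinM lee_fin mulr_ge0 ?sqr_ge0. Qed.

Let Y_le v : (Y v <= (M ^+ 2 * 2)%:E * (gainE v + lossE v))%E.
Proof.
have mg1 : measurable_fun D (fun p => ((f (vpost_ v p) ^+ 2)%:E *
  (g (vpost v p) ^+ 2)%:E)%E).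
  apply: (eq_measurable_fun (fun p : rV * rV =>
     ((f (vpost_ v p) * g (vpost v p)) ^+ 2)%:E)).
    by move=> y _; rewrite -EFinM exprMn.
  apply: measurable_funTS; apply/measurable_EFinP; apply: measurable_funX.
  exact: (measurableT_comp mv_ (measurable_pair1 v)).
have ml1 : measurable_fun D (fun p => ((f (v - p.1)%R ^+ 2)%:E * (g v ^+ 2)%:E)%E).
  apply: (eq_measurable_fun (fun p : rV * rV => ((f (v - p.1) * g v) ^+ 2)%:E)).
    by move=> y _; rewrite -EFinM exprMn.
  apply: measurable_funTS; apply/measurable_EFinP; apply: measurable_funX.
  exact: (measurableT_comp mv (measurable_pair1 v)).
rewrite -ge0_integralD//; last 2 first.
- by move=> p _; rewrite -EFinM lee_fin mulr_ge0 ?sqr_ge0.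
- by move=> p _; rewrite -EFinM lee_fin mulr_ge0 ?sqr_ge0.
rewrite -ge0_integralZl//; last 3 first.
- exact: emeasurable_funD.
- by move=> p _; apply: adde_ge0; rewrite -EFinM lee_fin mulr_ge0 ?sqr_ge0.
- by rewrite lee_fin mulr_ge0 ?sqr_ge0.
apply: ge0_le_integral => //.
- by move=> p _; rewrite lee_fin sqr_ge0.
- by apply/measurable_EFinP; exact: measurable_funX.
- by apply: emeasurable_funM; [exact: measurable_cst|exact: emeasurable_funD].
move=> p _.
rewrite [leRHS](_ : _ = (M ^+ 2 * 2 * ((f (vpost_ v p) * g (vpost v p)) ^+ 2 +
  (f (v - p.1) * g v) ^+ 2))%:E); last by rewrite !(exprMn 2 (f _)).
rewrite lee_fin /coll_integrand.
set x := f _ * _; set y := f _ * _; rewrite exprMn -mulrA.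
apply: ler_pM; [exact: sqr_ge0|exact: sqr_ge0| |].
  rewrite -(real_normK (num_real (k p))) lerXn2r ?nnegrE//.
by have := sqr_ge0 (x + y); rewrite sqrrB sqrrD; lra.
Qed.

Let Y_int : (\int[L]_(v in box) Y v <= (coll_mean_const * (inner f f * inner g g))%:E)%E.
Proof.
have mb := @measurable_box R d.
have mf2 : measurable_fun setT (fun v : rV => (f v ^+ 2)%:E).
  by apply/measurable_EFinP; apply: measurable_funX; exact: L2box_meas.
have mg2 : measurable_fun setT (fun v : rV => (g v ^+ 2)%:E).
  by apply/measurable_EFinP; apply: measurable_funX; exact: L2box_meas.
have f20 v : (0 <= (f v ^+ 2)%:E)%E by rewrite lee_fin sqr_ge0.
have g20 v : (0 <= (g v ^+ 2)%:E)%E by rewrite lee_fin sqr_ge0.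
have pf2 v i : ((f (v + (pi *+ 2) *: delta_mx ord0 i) ^+ 2)%:E =
  (f v ^+ 2)%:E)%E by rewrite pf.
have pg2 v i : ((g (v + (pi *+ 2) *: delta_mx ord0 i) ^+ 2)%:E =
  (g v ^+ 2)%:E)%E by rewrite pg.
have G1 := gain_bound mf2 f20 pf2 mg2 g20 pg2 ma K0 HK.
have L1 := loss_bound mf2 f20 pf2 mg2 g20 ma.
rewrite !integral_sqr// in G1 L1.
apply: (@le_trans _ _ (\int[L]_(v in box) ((M ^+ 2 * 2)%:E * (gainE v + lossE v)))%E).
  apply: ge0_le_integral => //.
  - by move=> v _; apply: integral_ge0 => p _; rewrite lee_fin sqr_ge0.
  - exact: measurable_funTS.
  - apply: emeasurable_funM; first exact: measurable_cst.
    by apply: measurable_funTS; exact: emeasurable_funD.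
have c0 : (0 <= (M ^+ 2 * 2)%:E :> \bar R)%E by rewrite lee_fin mulr_ge0 ?sqr_ge0.
rewrite (ge0_integralZl L mb _ (fun x _ => adde_ge0 (gain0 x) (loss0 x)) c0); last first.
  by apply: measurable_funTS; exact: emeasurable_funD.
rewrite (ge0_integralD L mb (fun x _ => gain0 x) _ (fun x _ => loss0 x)); last 2 first.
- exact: measurable_funTS.
- exact: measurable_funTS.
apply: (@le_trans _ _ ((M ^+ 2 * 2)%:E *
  (((3 ^ d)%:R * (K * (m.*2.+1 ^ d)%:R))%:E * ((inner f f)%:E * (inner g g)%:E) +
   S (sphere R d) * ((m.*2.+1 ^ d)%:R)%:E * ((inner f f)%:E * (inner g g)%:E)))%E).
  by apply: lee_wpmul2l => //; apply: leeD.
rewrite -(@fineK _ (S (sphere R d))) ?ge0_fin_numE//.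
suff <- : M ^+ 2 * 2 *
    ((3 ^ d)%:R * (K * (m.*2.+1 ^ d)%:R) * (inner f f * inner g g) +
     fine (S (sphere R d)) * (m.*2.+1 ^ d)%:R * (inner f f * inner g g)) =
    coll_mean_const * (inner f f * inner g g) by exact: lexx.
by rewrite /coll_mean_const; ring.
Qed.

(** The integral over the box of the integrals of the squares is finite, so
    almost all of these are finite. *)
Lemma coll_integrable :
  {ae L, forall v, box v -> PM.-integrable D (EFin \o coll_integrand f g v)}.
Proof.
have mb := @measurable_box R d.
have iY : L.-integrable box Y.
  apply/integrableP; split; first exact: measurable_funTS.
  rewrite (eq_integral Y); last first.
    move=> v _; rewrite gee0_abs//.
    by apply: integral_ge0 => p _; rewrite lee_fin sqr_ge0.
  by apply: le_lt_trans Y_int _; exact: ltry.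
have FF : Filter (nbhs (almost_everywhere L)) by exact: ae_filter_ringOfSetsType.
have := integrable_ae mb iY; apply: filterS => v Yv vb.
apply: (integrable_of_sqr mD D_fin (mzv v)).
have := Yv vb; rewrite ge0_fin_numE//.
by apply: integral_ge0 => p _; rewrite lee_fin sqr_ge0.
Qed.

(** By Tonelli for the positive and the negative part. *)
Lemma measurable_coll : measurable_fun setT (coll f g).
Proof.
pose zp (y : rV * (rV * rV)) := ((EFin \o z)^\+ y)%E.
pose zn (y : rV * (rV * rV)) := ((EFin \o z)^\- y)%E.
have mE : measurable_fun setT (EFin \o z) by exact/measurable_EFinP.
have m1 := @measurable_integral_param _ _ _ _ R PM D zp mD
  (measurable_funepos mE) (fun y => funepos_ge0 _ y).
have m2 := @measurable_integral_param _ _ _ _ R PM D zn mD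
  (measurable_funeneg mE) (fun y => funeneg_ge0 _ y).
have m3 := measurableT_comp (@fine_measurable R setT measurableT) (emeasurable_funB m1 m2).
apply: eq_measurable_fun m3 => v _ /=.
rewrite /coll /Rintegral [in RHS]integralE.
by congr (fine (_ - _)%E); apply: eq_integral => p _;
  rewrite /zp /zn /= ?funeposE ?funenegE.
Qed.

Definition coll_const : R := (fine (PM D) + 1) * coll_mean_const.

Lemma coll_const_ge0 : 0 <= coll_const.
Proof. by rewrite /coll_const mulr_ge0 ?coll_mean_const_ge0// addr_ge0// fine_ge0. Qed.

(** Cauchy-Schwarz in [(q, omega)], and the bounds on the integrals of the
    squares. *)
Lemma coll_sqr_int : (\int[L]_(v in box) (coll f g v ^+ 2)%:E <=
  (coll_const * (inner f f * inner g g))%:E)%E.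
Proof.
have mb := @measurable_box R d.
have c0 : 0 <= fine (PM D) + 1 by rewrite addr_ge0// fine_ge0.
have Y0 v : (0 <= Y v)%E by apply: integral_ge0 => p _; rewrite lee_fin sqr_ge0.
apply: (@le_trans _ _ (\int[L]_(v in box) ((fine (PM D) + 1)%:E * Y v))%E).
  apply: ge0_le_integral => //.
  - by move=> v _; rewrite lee_fin sqr_ge0.
  - apply: measurable_funTS; apply/measurable_EFinP; apply: measurable_funX.
    exact: measurable_coll.
  - by apply: emeasurable_funM; [exact: measurable_cst|exact: measurable_funTS].
  by move=> v _; exact: (sqr_Rintegral_le mD D_fin (mzv v)).
rewrite (ge0_integralZl L mb (measurable_funTS mY) (fun x _ => Y0 x)) ?lee_fin//.
rewrite /coll_const -mulrA EFinM; apply: lee_wpmul2l; first by rewrite lee_fin.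
exact: Y_int.
Qed.

Lemma L2box_coll : L2box (coll f g).
Proof.
split; first exact: measurable_coll.
apply/integrableP; split.
  apply: measurable_funTS; apply/measurable_EFinP; apply: measurable_funX.
  exact: measurable_coll.
rewrite (eq_integral (fun v => (coll f g v ^+ 2)%:E)).
  by apply: le_lt_trans coll_sqr_int _; exact: ltry.
by move=> v _; rewrite gee0_abs// lee_fin sqr_ge0.
Qed.

Lemma nrm_coll : nrm (coll f g) <= Num.sqrt coll_const * (nrm f * nrm g).
Proof.
rewrite /nrm -!sqrtrM ?inner_ge0 ?coll_const_ge0//; apply: ler_wsqrtr.
by rewrite -lee_fin -(integral_sqr L2box_coll); exact: coll_sqr_int.
Qed.

End pair.

Lemma nrm_ae_eq f g : L2box f -> L2box g -> {ae L, forall v, box v -> f v = g v} ->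
  nrm f = nrm g.
Proof.
move=> Lf Lg fg; congr Num.sqrt; apply: EFin_inj; rewrite -!integral_sqr//.
have FF : Filter (nbhs (almost_everywhere L)) by exact: ae_filter_ringOfSetsType.
have m2 h : L2box h -> measurable_fun box (fun v => (h v ^+ 2)%:E).
  move=> Lh; apply: measurable_funTS; apply/measurable_EFinP.
  by apply: measurable_funX; exact: L2box_meas.
apply: ae_eq_integral.
- exact: measurable_box.
- exact: m2.
- exact: m2.
by apply: filterS fg => v fgv vb; rewrite fgv.
Qed.

Lemma periodicB f g : Defs.periodic f -> Defs.periodic g ->
  Defs.periodic (fun v => f v - g v).
Proof. by move=> pf pg v i; rewrite pf pg. Qed.

(** From [f'_* f' - g'_* g' = f'_* e' + e'_* g'] with [e = f - g], and the same
    for the loss term. The integrals can be added only where all of them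
    converge, which is almost everywhere. *)
Lemma nrm_collB f g : L2box f -> L2box g -> Defs.periodic f -> Defs.periodic g ->
  nrm (fun v => coll f f v - coll g g v) <=
  Num.sqrt coll_const * ((nrm f + nrm g) * nrm (fun v => f v - g v)).
Proof.
move=> Lf Lg pf pg; pose e v := f v - g v.
have Le : L2box e by exact: L2boxB.
have pe : Defs.periodic e by exact: periodicB.
have FF : Filter (nbhs (almost_everywhere L)) by exact: ae_filter_ringOfSetsType.
have L1 := L2box_coll Lf Le pf pe; have L2 := L2box_coll Le Lg pe pg.
have L3 := L2box_coll Lf Lf pf pf; have L4 := L2box_coll Lg Lg pg pg.
rewrite (nrm_ae_eq (L2boxB L3 L4) (L2boxD L1 L2)); last first.
  have h12 := filterI (coll_integrable Lf Le pf pe) (coll_integrable Le Lg pe pg).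
  have h34 := filterI (coll_integrable Lf Lf pf pf) (coll_integrable Lg Lg pg pg).
  apply: filterS2 (h12 FF) (h34 FF) => v [i1 i2] [i3 i4] vb.
  rewrite /coll -(RintegralB mD (i3 vb) (i4 vb)) -(RintegralD mD (i1 vb) (i2 vb)).
  by apply: eq_Rintegral => p _; rewrite /coll_integrand /e; ring.
apply: le_trans (nrmD L1 L2) _.
have H1 := nrm_coll Lf Le pf pe; have H2 := nrm_coll Le Lg pe pg.
by apply: le_trans (lerD H1 H2) _; rewrite -/e; lra.
Qed.

End bilinear_collision.

Section collision_operator.
Context (R : realType) (d : nat) (d0 : (0 < d)%N).
Local Notation L := (lebesgue_rV R d).
Local Notation rV := 'rV[R]_d.
Variable cs : R -> R -> R.
Hypothesis B_ge0 : forall q c : R, 0 <= q -> -1 <= c <= 1 -> 0 <= coll_kernel cs q c.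
Hypothesis B_meas : measurable_fun [set p : R * R | 0 <= p.1 /\ -1 <= p.2 <= 1]
      (fun p : R * R => coll_kernel cs p.1 p.2).

Lemma dotv_le (u w : rV) : `|dotv u w| <= enorm u * enorm w.
Proof.
have D0 (x : rV) : 0 <= dotv x x by apply: sumr_ge0 => i _; rewrite -expr2 sqr_ge0.
rewrite /enorm -sqrtrM// -sqrtr_sqr; apply: ler_wsqrtr.
have H (t : R) : 0 <= dotv w w * t ^+ 2 + 2 * dotv u w * t + dotv u u.
  rewrite (_ : _ + _ = dotv (u + t *: w) (u + t *: w))//.
  rewrite /dotv mulr_suml mulr_sumr mulr_suml -!big_split/=.
  by apply: eq_bigr => i _; rewrite !mxE; ring.
by apply: discriminant_le0 H; exact: D0.
Qed.

Lemma enorm_unit_dir_le (q : rV) : enorm (unit_dir q) <= 1.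
Proof.
rewrite /unit_dir enormZ ger0_norm ?invr_ge0 ?enorm_ge0//.
have [->|q0] := eqVneq (enorm q) 0; first by rewrite mulr0.
by rewrite mulVf.
Qed.

Lemma cos_itv (q w : rV) : sphere R d w -> -1 <= dotv (unit_dir q) w <= 1.
Proof.
move=> w1; rewrite -ler_norml; apply: le_trans (dotv_le _ _) _.
by rewrite w1 mulr1 enorm_unit_dir_le.
Qed.

(** The kernel cut off outside the domain of integration: off the sphere the
    cosine may leave [[-1, 1]], and at large relative velocities no bound is
    assumed. *)
Definition weight (rho : R) : rV * rV -> R :=
  (fun p => coll_kernel cs (enorm p.1) (dotv (unit_dir p.1) p.2)) \_
    (eball d (2 * rho) `*` sphere R d).

Lemma measurable_weight rho : measurable_fun setT (weight rho).
Proof.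
have mE : measurable (eball d (2 * rho) `*` sphere R d).
  by apply: measurableX; [exact: measurable_eball|exact: measurable_sphere].
rewrite /weight; apply/(measurable_restrictT _ _).1 => //.
have mS : measurable [set p : R * R | 0 <= p.1 /\ -1 <= p.2 <= 1].
  rewrite (_ : mkset _ = `[0, +oo[ `*` `[-1, 1]); first exact: measurableX.
  by apply/seteqP; split => -[x y] /=; rewrite !in_itv/= andbT.
apply: (@measurable_comp _ _ _ _ _ _ _ (fun p : R * R => coll_kernel cs p.1 p.2)
  _ (fun p : rV * rV => (enorm p.1, dotv (unit_dir p.1) p.2)) mS _ B_meas).
  by move=> _ [[q w] [/= _ w1] <-] /=; split; [exact: enorm_ge0|exact: cos_itv].
apply: measurable_funTS; apply/measurable_fun_pairP; split => /=.
  exact: (measurableT_comp (@measurable_enorm R d) measurable_fst).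
apply: measurable_dotv => //.
exact: (measurableT_comp (@measurable_unit_dir R d) measurable_fst).
Qed.

Lemma weight_le rho (M : R) : (forall q c : R, 0 <= q < 2 * rho -> -1 <= c <= 1 ->
  coll_kernel cs q c <= M) -> forall p, `|weight rho p| <= `|M|.
Proof.
move=> BM [q w]; rewrite /weight /patch; case: ifPn => [|_]; last by rewrite normr0.
rewrite inE => -[/= qr w1]; have c1 := cos_itv q w1.
rewrite ger0_norm ?B_ge0 ?enorm_ge0//; apply: le_trans (ler_norm M).
by apply: BM => //; rewrite enorm_ge0.
Qed.

Lemma Q_coll rho (f : rV -> R) : Q cs rho f = coll (weight rho) (2 * rho) f f.
Proof.
apply/funext => v; rewrite /Q /coll; apply: eq_Rintegral => p pD.
by rewrite /coll_integrand /weight /patch pD.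
Qed.

Lemma collision_lipschitz (rho M : R) : exists K, 0 <= K /\
  ((forall q c : R, 0 <= q < 2 * rho -> -1 <= c <= 1 -> coll_kernel cs q c <= M) ->
  forall f g : rV -> R, L2box f -> L2box g -> Defs.periodic f -> Defs.periodic g ->
  [/\ L2box (Q cs rho f), L2box (Q cs rho g) &
  nrm (fun v => Q cs rho f v - Q cs rho g v) <=
    K * ((nrm f + nrm g) * nrm (fun v => f v - g v))]).
Proof.
have [K [K0 HK]] := @polar_bound R d d0.
have [m ma] : exists m, pi + 2 * rho <= pi *+ m.*2.+1.
  (* Enough periods to cover the ball of radius 2 rho around any point of the box. *)
  exists (Num.truncn (`|2 * rho| / pi)).+1.
  have p0 := @pi_gt0 R.
  have := @truncnS_gt R (`|2 * rho| / pi); rewrite ltr_pdivrMr// => h.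
  set n := (Num.truncn _).+1 in h *.
  have -> : pi *+ n.*2.+1 = pi + 2 * (n%:R * pi) :> R.
    by rewrite -[LHS]mulr_natl -natr1 -mul2n natrM; ring.
  have := ler_norm (2 * rho).
  have := normr_ge0 (2 * rho); lra.
exists (Num.sqrt (@coll_const R d `|M| (2 * rho) K m)); split; first exact: sqrtr_ge0.
move=> BM f g Lf Lg pf pg; rewrite !Q_coll.
have mw := measurable_weight rho; have wM := weight_le BM.
have HKa := HK (2 * rho); split.
- exact: (L2box_coll mw wM ma K0 HKa).
- exact: (L2box_coll mw wM ma K0 HKa).
- exact: (nrm_collB mw wM ma K0 HKa).
Qed.

End collision_operator.

(** * The error estimate *)

Section lipschitz_constant.
Context (R : realType) (d : nat) (d0 : (0 < d)%N).
Variable cs : R -> R -> R.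
Hypothesis B_ge0 : forall q c : R, 0 <= q -> -1 <= c <= 1 -> 0 <= coll_kernel cs q c.
Hypothesis B_meas : measurable_fun [set p : R * R | 0 <= p.1 /\ -1 <= p.2 <= 1]
      (fun p : R * R => coll_kernel cs p.1 p.2).

Definition kernel_bounded (rho : R) := exists M : R, forall q c : R,
  0 <= q < 2 * rho -> -1 <= c <= 1 -> coll_kernel cs q c <= M.

Definition lipschitz_with (rho K : R) := 0 <= K /\
  (kernel_bounded rho ->
  forall f g : 'rV[R]_d -> R, L2box f -> L2box g -> Defs.periodic f -> Defs.periodic g ->
  [/\ L2box (Q cs rho f), L2box (Q cs rho g) &
  nrm (fun v => Q cs rho f v - Q cs rho g v) <=
    K * ((nrm f + nrm g) * nrm (fun v => f v - g v))]).

(** The constant is chosen for each radius before the function, from some bound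
    of the kernel if there is one. *)
Lemma lipschitz_constant : exists K : R -> R, forall rho, lipschitz_with rho (K rho).
Proof.
suff H rho : exists K, lipschitz_with rho K by have [K HK] := choice H; exists K.
have [[M BM]|nM] := pselect (kernel_bounded rho).
  have [K [K0 HK]] := collision_lipschitz d0 B_ge0 B_meas rho M.
  by exists K; split => // _; exact: HK.
by exists 0; split.
Qed.

End lipschitz_constant.

(** The cross terms of the product are nonnegative. *)
Lemma diagonal_le (R : realDomainType) (a b c x y z : R) :
  0 <= a -> 0 <= b -> 0 <= c -> 0 <= x -> 0 <= y -> 0 <= z ->
  a * x + b * y + c * z <= (a + b + c) * (x + y + z).
Proof.
move=> a0 b0 c0 x0 y0 z0; rewrite !mulrDl.
by apply: lerD; [apply: lerD|]; apply: ler_wpM2l => //; lra.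
Qed.

Theorem corollary4p3 (R : realType) (d r : nat) (cs : R -> R -> R) (Ct : R)
    (hd : (0 < d <= 3)%N) (hr : (1 <= r)%N) (hCt : 0 < Ct)
    (B_ge0 : forall q c : R, 0 <= q -> -1 <= c <= 1 -> 0 <= coll_kernel cs q c)
    (B_meas : measurable_fun [set p : R * R | 0 <= p.1 /\ -1 <= p.2 <= 1]
      (fun p : R * R => coll_kernel cs p.1 p.2)) :
  exists C : R -> R -> R,
  forall (N : nat) (delta' : R) (f : 'rV[R]_d -> R) (rho : R),
    (1 <= N)%N -> 0 < delta' -> Hp r f -> 0 < rho ->
    (exists M : R, forall q c : R, 0 <= q < 2 * rho -> -1 <= c <= 1 ->
      coll_kernel cs q c <= M) ->
    let delta := delta' / N%:R ^+ r in
    enorm (moments (Q cs rho f)) <= Ct * delta ->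
    let fN := cons_proj N f in
    (L2norm (Q cs rho f \- Qc cs rho N fN)%R
      <= (C (fine (Hnorm r f)) rho / N%:R ^+ r)%:E *
         (Hnorm r f + Hnorm r (Q cs rho fN) + delta'%:E))%E.
Proof.
have d0 : (0 < d)%N by case/andP: hd.
have [K HK] := @lipschitz_constant R d d0 cs B_ge0 B_meas.
pose kap := @constraint_const R d d0.
pose lam := @lift_const R d d0; pose phi := moment_const R d.
have kap1 : 1 <= kap by exact: constraint_const_ge1.
have lam0 : 0 <= lam by exact: lift_const_ge0.
have k0 : 0 <= kap by exact: le_trans kap1.
have phi0 : 0 <= phi by exact: moment_const_ge0.
(* The terms of C stem from the Lipschitz bound, from the projection of the operator at
   fN, and from the moments of the operator at f. *)
pose A rho := (1 + lam * phi) * (K rho * ((2 + kap) * kap)).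
exists (fun h rho => A rho * h + kap + lam * Ct).
move=> N delta' f rho N0 de0 Hf rho0 BM delta mom; cbv zeta; set fN := cons_proj N f.
have [K0 Klip] := HK rho.
have Np : 0 < N%:R ^+ r :> R by rewrite exprn_gt0// ltr0n.
have N1 : 1 <= N%:R ^+ r :> R by rewrite exprn_ege1// ler1n.
have [[pf mf foo] Lf] : L2p f /\ L2box f.
  by have [D [Lp _]] := Hf; split => //; exact: L2p_L2box.
have NfN : trig_poly N fN by exact: trig_poly_cons_proj.
have LfN : L2box fN by exact: trig_poly_L2box NfN.
have pfN : Defs.periodic fN by exact: trig_poly_periodic NfN.
have [LQ LQN lip] := Klip BM f fN Lf LfN pf pfN.
set q := Q cs rho f in LQ lip mom *; set qN := Q cs rho fN in LQN lip *.
set G := Qc cs rho N fN.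
have LG : L2box G by apply: trig_poly_L2box; exact: trig_poly_Qc LQN.
have -> : L2norm (q \- G)%R = (nrm (fun v => q v - G v))%:E.
  exact: (L2norm_nrm (L2boxB LQ LG)).
have Hfin := Hnorm_fin Hf; set H := fine (Hnorm r f).
have HE : Hnorm r f = H%:E by rewrite fineK.
have fH : nrm f <= H by rewrite -lee_fin -HE; exact: nrm_Hnorm.
pose e := nrm (fun v => f v - trig_proj N f v).
have eH : N%:R ^+ r * e <= H by rewrite -lee_fin -HE; exact: proj_Hnorm.
have H0 : 0 <= H by apply: le_trans (nrm_ge0 _) fH.
have e0 : 0 <= e by exact: nrm_ge0.
have ffN : nrm (fun v => f v - fN v) <= kap * e by exact: cons_proj_error.
have A0 : 0 <= A rho.
  by rewrite !mulr_ge0// ?addr_ge0 ?mulr_ge0// ltW// (lt_le_trans _ kap1).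
have C0 : 0 < A rho * H + kap + lam * Ct.
  have := mulr_ge0 A0 H0; have := mulr_ge0 lam0 (ltW hCt); lra.
rewrite HE; have [->|HQ] := eqVneq (Hnorm r qN) +oo%E.
  by rewrite addeC addey// gt0_muley ?leey// lte_fin divr_gt0.
have HQ0 : (0 <= Hnorm r qN)%E.
  by apply: le_trans (nrm_Hnorm r qN); rewrite lee_fin nrm_ge0.
pose h := fine (Hnorm r qN).
have HQE : Hnorm r qN = h%:E by rewrite fineK// ge0_fin_numE// ltey.
pose eQ := nrm (fun v => qN v - trig_proj N qN v).
have eQH : N%:R ^+ r * eQ <= h by rewrite -lee_fin -HQE; exact: proj_Hnorm.
have h0 : 0 <= h by rewrite -lee_fin -HQE.
rewrite HQE -!EFinD -EFinM lee_fin mulrAC ler_pdivlMr//.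
(* Here N^r >= 1 bounds the norm of fN independently of N. *)
have fNH : nrm fN <= (1 + kap) * H.
  have := nrm_leB LfN Lf; rewrite (nrmB_sym LfN Lf) => /le_trans; apply.
  rewrite mulrDl mul1r; apply: lerD fH _; apply: le_trans ffN _.
  apply: ler_wpM2l; first lra.
  by apply: le_trans eH; rewrite ler_peMl.
pose E1 := nrm (fun v => q v - qN v).
have E1H : N%:R ^+ r * E1 <= K rho * ((2 + kap) * kap) * H * H.
  have : E1 <= K rho * (((2 + kap) * H) * (kap * e)).
    apply: le_trans lip _; apply: ler_wpM2l => //; apply: ler_pM => //.
    - by rewrite addr_ge0 ?nrm_ge0.
    - exact: nrm_ge0.
    - by lra.
  move=> /(ler_wpM2l (ltW Np))/le_trans; apply.
  have -> : N%:R ^+ r * (K rho * ((2 + kap) * H * (kap * e))) =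
    (K rho * ((2 + kap) * kap) * H) * (N%:R ^+ r * e) by ring.
  apply: ler_wpM2l => //; rewrite !mulr_ge0//; lra.
have momH : N%:R ^+ r * enorm (moments q) <= Ct * delta'.
  by rewrite mulrC -ler_pdivlMr// -mulrA.
have E2 := Qc_error d0 N0 LQN LQ; rewrite -/G -/kap -/lam -/phi -/eQ -/E1 in E2.
have tri := nrm_triangle LQ LQN LG.
rewrite mulrC; apply: le_trans (ler_wpM2l (ltW Np) (le_trans tri (lerD (lexx _) E2))) _.
have -> : N%:R ^+ r * (nrm (fun v => q v - qN v) +
    (kap * eQ + lam * (phi * E1 + enorm (moments q)))) =
  (1 + lam * phi) * (N%:R ^+ r * E1) + kap * (N%:R ^+ r * eQ) +
  lam * (N%:R ^+ r * enorm (moments q)) by rewrite /E1; ring.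
apply: (@le_trans _ _ (A rho * H * H + kap * h + lam * (Ct * delta'))).
  apply: lerD; last exact: ler_wpM2l.
  apply: lerD; last exact: ler_wpM2l.
  have -> : A rho * H * H = (1 + lam * phi) * (K rho * ((2 + kap) * kap) * H * H).
    by rewrite /A; ring.
  by apply: ler_wpM2l => //; rewrite addr_ge0// mulr_ge0.
rewrite [lam * (Ct * delta')]mulrA; apply: diagonal_le => //.
- exact: mulr_ge0.
- by rewrite mulr_ge0// ltW.
- exact: ltW.
Qed.
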